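(* Every $3$-connected $\{K_{1,3},B_{1,1}\}$-free graph has a spanning Halin subgraph.
   Context: All graphs are finite and simple. A graph is $\mathcal{F}$-free if it contains no member of $\mathcal{F}$ as an induced subgraph. $K_{1,3}$ is the star with three leaves. $B_{1,1}$ is obtained from a triangle $abc$ by adding a vertex adjacent only to $a$ and another vertex adjacent only to $b$. A Halin graph is a plane graph $T\cup C$ consisting of a tree $T$ having no vertex of degree $2$ and a cycle $C$ whose vertex set is exactly the set of leaves of $T$ (the union being embeddable in the plane without crossings). A spanning Halin subgraph of $G$ is a spanning subgraph of $G$ that is a Halin graph. *)

(* Defs.v *)
From HB Require Import structures.
From mathcomp Require Import all_boot all_order all_algebra.
From mathcomp Require Import all_classical all_reals all_analysis.
Set Implicit Arguments.
Unset Strict Implicit.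
Unset Printing Implicit Defensive.
Import Order.TTheory GRing.Theory Num.Theory.
Import numFieldNormedType.Exports.
Local Open Scope classical_set_scope.
Local Open Scope ring_scope.

Record sgraph (V : finType) := SGraph {
  adj :> rel V;
  adj_sym : symmetric adj;
  adj_irr : irreflexive adj }.

Definition edges_rel (n : nat) (s : seq (nat * nat)) : rel 'I_n :=
  fun i j => ((val i, val j) \in s) || ((val j, val i) \in s).

Lemma edges_rel_sym n s : symmetric (@edges_rel n s).
Proof. by move=> i j; rewrite /edges_rel orbC. Qed.

Lemma edges_rel_irr n s :
  all (fun p => p.1 != p.2) s -> irreflexive (@edges_rel n s).
Proof.
by move=> /allP s_irr i; rewrite /edges_rel orbb; apply/negP=> /s_irr; rewrite eqxx.
Qed.

Definition edges_graph n s (s_irr : all (fun p => p.1 != p.2) s) : sgraph 'I_n :=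
  SGraph (@edges_rel_sym n s) (edges_rel_irr s_irr).

Definition K13 : sgraph 'I_4 :=
  @edges_graph 4 [:: (0, 1); (0, 2); (0, 3)]%N isT.

(* The triangle is 0, 1, 2; the pendant vertices 3 and 4 hang at 0 and 1. *)
Definition B11 : sgraph 'I_5 :=
  @edges_graph 5 [:: (0, 1); (0, 2); (1, 2); (0, 3); (1, 4)]%N isT.

Section Graph.
Variable V : finType.
Implicit Types (G H T C : sgraph V) (X : {set V}).

Definition induced_subgraph (W : finType) (F : sgraph W) G :=
  exists f : W -> V, injective f /\ forall x y, adj G (f x) (f y) = adj F x y.

Definition induced_free (W : finType) (F : sgraph W) G := ~ induced_subgraph F G.

Definition delete_vertices G X : rel V :=
  fun x y => [&& x \notin X, y \notin X & G x y].

Definition k_connected (k : nat) G :=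
  (k < #|V|)%N /\
  forall X, (#|X| < k)%N ->
    forall x y, x \notin X -> y \notin X -> connect (delete_vertices G X) x y.

Definition degree G (x : V) : nat := #|[set y | G x y]%SET|.

Definition leaves G : {set V} := [set x | degree G x == 1%N]%SET.

Definition connected_graph G := (0 < #|V|)%N /\ forall x y, connect G x y.

Definition acyclic G := forall c : seq V, (2 < size c)%N -> ~ ucycle G c.

Definition is_tree G := connected_graph G /\ acyclic G.

Definition is_cycle_on C X :=
  exists c : seq V,
    [/\ (2 < size c)%N, uniq c, c =i X &
        forall x y, C x y = (x \in c) && (y == next c x) ||
                            (y \in c) && (x == next c y)].

Definition spanning_subgraph H G := forall x y, H x y -> G x y.

End Graph.

Section Plane.
Variable R : realType.

Definition is_arc (A : set (R * R)) (a b : R * R) :=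
  exists g : R -> R * R,
    [/\ {within `[0, 1], continuous g},
        {in `[0, 1] &, injective g},
        g 0 = a, g 1 = b & g @` `[0, 1] = A].

(* A plane drawing: pos places the vertices and E x y is the closed arc that
   draws the edge xy. *)
Definition is_drawing (V : finType) (H : sgraph V)
    (pos : V -> R * R) (E : V -> V -> set (R * R)) :=
  [/\ injective pos,
      forall x y, H x y -> is_arc (E x y) (pos x) (pos y),
      forall x y, H x y -> E x y = E y x,
      forall x y z, H x y -> E x y (pos z) -> z = x \/ z = y &
      forall x y x' y', H x y -> H x' y' ->
        [set x; y]%SET <> [set x'; y']%SET ->
        (E x y `\` [set pos x; pos y]) `&` E x' y' = set0].

Definition planar (V : finType) (H : sgraph V) :=
  exists pos E, @is_drawing V H pos E.

Definition halin (V : finType) (H : sgraph V) :=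
  exists T C : sgraph V,
    [/\ is_tree T,
        forall x, degree T x <> 2%N,
        is_cycle_on C (leaves T),
        forall x y, H x y = T x y || C x y &
        planar H].

End Plane.

(* Main.v *)
Require Import Defs.
From HB Require Import structures.
From mathcomp Require Import all_boot all_order all_algebra.
From mathcomp Require Import all_classical all_reals all_analysis.
From mathcomp Require Import zify ring lra.
Set Implicit Arguments.
Unset Strict Implicit.
Unset Printing Implicit Defensive.
Import Order.TTheory GRing.Theory Num.Theory.
Import numFieldNormedType.Exports.

(**
The Halin subgraph is always built from a caterpillar: a spine whose leaves lie in two rows, one
above and one below it, the rim running through the upper row and back through the lower one.
Such a graph has an evident straight-line drawing.

[B11] is the bull. If [G] has three independent vertices, it contains an induced path on five
vertices; relative to a longest induced path every vertex is a twin of a vertex of the path, or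
closes it to a cycle, so [G] is a clique blow-up of a path or of a cycle. The spine follows the
classes, whose sizes are bounded below by 3-connectivity.

Otherwise the non-neighbours of every vertex form a clique. Take [x] with the largest number of
non-neighbours, let [K] be the clique of its non-neighbours and [X] its neighbourhood. Two
non-adjacent vertices of [X] together see all of [K], and by the choice of [x] a vertex of [X]
has at most as many non-neighbours in [X] as neighbours in [K]. If [K] has at least three
elements and [X] is connected, then a path in [X] whose first, second and last vertices have
distinct representatives in [K] can be enlarged until it covers [X]; its first vertex [m] and a
neighbour [k] of [m] in [K] give the spine [x, m, k]. If [X] is disconnected, it consists of two
cliques and [G] nearly is a clique blow-up of a 5-cycle. If [K] has at most two elements, [G] is
almost complete.
*)

(** * Halin graphs from caterpillars *)

(** The obstacle is the degree condition. An inner spine vertex needs at least one leaf and an end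
    of a longer spine at least two, while the leaves, in the order in which they hang, must close up
    to a cycle. In a blow-up of a path an inner class separates the graph, so it has at least three
    vertices: one for the spine and one for each row. In a blow-up of a cycle two non-adjacent
    classes together separate the graph, so at most two consecutive classes are singletons, and the
    spine skips these. With independence number two there is no such layering. This is the origin of
    the distinct representatives; König's theorem provides them, because two vertices covering all
    edges between [X] and [K] would separate the graph. *)

Section RankedTrees.
Variables (V : finType) (T : sgraph V).

Lemma next_neq_prev (c : seq V) (x : V) :
  2 < size c -> uniq c -> x \in c -> next c x <> prev c x.
Proof.
move=> sc Uc xc; have [i c' Dc] := rot_to xc.
have Uc' : uniq (x :: c') by rewrite -Dc rot_uniq.
have sc' : 2 < size (x :: c') by rewrite -Dc size_rot.
rewrite -(next_rot i Uc) -(prev_rot i Uc) Dc.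
case: c' Uc' sc' {Dc} => [//|a [//|b c']] /= /and3P[xabc abc _] _.
rewrite eqxx; have -> : (x == b) = false by move: xabc; rewrite !inE => /norP[_ /norP[/negbTE]].
have -> : (x == a) = false by move: xabc; rewrite !inE => /norP[/negbTE].
have -> : forall y l, x \notin l -> prev_at x x y l = last y l.
  move=> y l; elim: l y => [|z l IH] y /=; first by rewrite eqxx.
  by rewrite inE => /norP[/negbTE-> /IH].
- by move=> /= E; move: abc; rewrite E mem_last.
- by move: xabc; rewrite !inE !negb_or => /and3P[].
Qed.

(* The vertex of largest rank on a cycle would have two smaller neighbours. *)
Lemma ranked_acyclic (r : V -> nat) :
  injective r ->
  (forall x y z, T x y -> T x z -> r y < r x -> r z < r x -> y = z) ->
  acyclic T.
Proof.
move=> rI low c sc /andP[cyc Uc].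
have [x xc maxx] : exists2 x, x \in c & forall y, y \in c -> r y <= r x.
  case: c sc cyc Uc => [//|a c] _ _ _.
  case: (@arg_maxnP _ a (mem (a :: c)) r) => /=; first by rewrite inE eqxx.
  by move=> x xc H; exists x.
have := next_cycle cyc xc; have := prev_cycle cyc xc.
set u := prev c x; set v := next c x => Tux Txv.
have Txu : T x u by rewrite adj_sym.
have lt y : T x y -> y \in c -> r y < r x.
  move=> Txy yc; rewrite ltn_neqAle maxx // andbT.
  by apply: contraTneq Txy => /rI->; rewrite adj_irr.
have uc : u \in c by rewrite mem_prev.
have vc : v \in c by rewrite mem_next.
by apply: (next_neq_prev sc Uc xc); apply: (low x) => //; apply: lt.
Qed.

End RankedTrees.

(* [par v] is the position in the spine [s] of the tree neighbour of the leaf [v]; the rim is [up]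
   followed by the reversal of [lo]. *)
Record caterpillar (V : finType) (G : rel V) (s up lo : seq V) (par : V -> nat) :
    Prop := Caterpillar {
  ctp_uniq : uniq (s ++ up ++ lo);
  ctp_all : forall v, v \in s ++ up ++ lo;
  ctp_spine : sorted G s;
  ctp_up : sorted G up;
  ctp_lo : sorted G lo;
  ctp_up0 : 0 < size up;
  ctp_lo0 : 0 < size lo;
  ctp_size : 2 < size up + size lo;
  ctp_head : forall x, G (head x up) (head x lo);
  ctp_last : forall x, G (last x up) (last x lo);
  ctp_par : forall v, v \in up ++ lo -> par v < size s /\ G v (nth v s (par v));
  ctp_par_up : sorted leq (map par up);
  ctp_par_lo : sorted leq (map par lo);
  ctp_deg : forall i, i < size s ->
    2 < (0 < i) + (i.+1 < size s) + count (fun v => par v == i) (up ++ lo) }.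

Section Caterpillar.
Variables (V : finType) (G : sgraph V) (s up lo : seq V) (par : V -> nat).
Hypothesis cat : caterpillar G s up lo par.

Definition up_edge (x y : V) :=
  [&& x \in s, y \in s & index y s == (index x s).+1] ||
  [&& x \notin s, y \in s & index y s == par x].

Definition rim := up ++ rev lo.

Definition rim_edge (x y : V) := (x \in rim) && (y == next rim x).

Let Us : uniq s. Proof. by have := ctp_uniq cat; rewrite cat_uniq => /andP[]. Qed.
Let Uul : uniq (up ++ lo).
Proof. by have := ctp_uniq cat; rewrite cat_uniq => /and3P[]. Qed.
Let Uup : uniq up. Proof. by have := Uul; rewrite cat_uniq => /andP[]. Qed.
Let Ulo : uniq lo. Proof. by have := Uul; rewrite cat_uniq => /and3P[]. Qed.

Lemma mem_rim x : (x \in rim) = (x \notin s).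
Proof.
rewrite /rim mem_cat mem_rev -mem_cat.
have := ctp_all cat x; have := ctp_uniq cat; rewrite cat_uniq => /and3P[_ /hasPn H _].
rewrite [x \in s ++ _]mem_cat; case: (boolP (x \in s)) => xs /=; last by move->.
by move=> _; apply/negbTE/negP => /H /=; rewrite xs.
Qed.

Lemma lo_notin_up x : x \in lo -> x \notin up.
Proof.
by move=> xlo; have := Uul; rewrite cat_uniq => /and3P[_ /hasPn H _]; apply: H.
Qed.

Lemma rim_uniq : uniq rim.
Proof.
rewrite /rim cat_uniq Uup rev_uniq Ulo andbT /=.
by apply/hasPn => x; rewrite mem_rev => /lo_notin_up.
Qed.

Lemma par_rim x : x \notin s -> par x < size s /\ G x (nth x s (par x)).
Proof.
by move=> xs; apply: (ctp_par cat); have := ctp_all cat x; rewrite mem_cat (negbTE xs).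
Qed.

Lemma up_edge_sub x y : up_edge x y -> G x y.
Proof.
case/orP=> /and3P[xs ys /eqP e].
- have := ctp_spine cat => /(sortedP x) /(_ (index x s)).
  by rewrite -e !nth_index // index_mem; apply.
- by have [_] := par_rim xs; rewrite -e nth_index.
Qed.

(** The relation need not be symmetric; the lower row is traversed backwards and therefore needs the
    converse. This generality serves twice: with [G] itself, and with a relation recording
    positions, which classifies the rim edges for the drawing. *)
Lemma rim_cycle (e : rel V) :
  sorted e up -> sorted (fun x y => e y x) lo ->
  (forall x, e (last x up) (last x lo)) -> (forall x, e (head x lo) (head x up)) ->
  cycle e rim.
Proof.
move=> eu el elast ehead; rewrite /rim.
case: up eu elast ehead (ctp_up0 cat) => [//|u us] /= eu elast ehead _.
rewrite -cats1 -catA cat_path eu /=.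
case/lastP: lo el elast ehead (ctp_lo0 cat) => [//|ls l] el elast ehead _.
rewrite rev_rcons /=; have := elast u; rewrite last_rcons => -> /=.
have := el; rewrite -rev_sorted rev_rcons /= cat_path => -> /=.
rewrite andbT; have := ehead u.
case: ls {el elast ehead} => [|z ls] //=.
by rewrite rev_cons last_rcons.
Qed.

Lemma rim_edge_sub x y : rim_edge x y -> G x y.
Proof.
case/andP=> xr /eqP->; apply: next_cycle => //; apply: rim_cycle.
- exact: ctp_up cat.
- rewrite (eq_sorted (e' := G)) ?(ctp_lo cat) // => a b.
  by rewrite adj_sym.
- exact: ctp_last cat.
- by move=> z; rewrite adj_sym; apply: (ctp_head cat z).
Qed.

Definition tree_rel x y := up_edge x y || up_edge y x.
Definition cycle_rel x y := rim_edge x y || rim_edge y x.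

Lemma tree_rel_sub x y : tree_rel x y -> G x y.
Proof. by case/orP=> /up_edge_sub //; rewrite adj_sym. Qed.

Lemma cycle_rel_sub x y : cycle_rel x y -> G x y.
Proof. by case/orP=> /rim_edge_sub //; rewrite adj_sym. Qed.

Lemma tree_rel_sym : symmetric tree_rel.
Proof. by move=> x y; rewrite /tree_rel orbC. Qed.
Lemma tree_rel_irr : irreflexive tree_rel.
Proof. by move=> x; apply: contraFF (adj_irr G x) => /tree_rel_sub. Qed.
Lemma cycle_rel_sym : symmetric cycle_rel.
Proof. by move=> x y; rewrite /cycle_rel orbC. Qed.
Lemma cycle_rel_irr : irreflexive cycle_rel.
Proof. by move=> x; apply: contraFF (adj_irr G x) => /cycle_rel_sub. Qed.

Definition cat_tree := SGraph tree_rel_sym tree_rel_irr.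
Definition cat_cycle := SGraph cycle_rel_sym cycle_rel_irr.

Lemma halin_rel_sym : symmetric (fun x y => cat_tree x y || cat_cycle x y).
Proof. by move=> x y; rewrite adj_sym (adj_sym cat_cycle). Qed.
Lemma halin_rel_irr : irreflexive (fun x y => cat_tree x y || cat_cycle x y).
Proof. by move=> x; rewrite !adj_irr. Qed.
Definition cat_halin := SGraph halin_rel_sym halin_rel_irr.

Lemma size_spine_gt0 : 0 < size s.
Proof.
have := ctp_up0 cat; case e: up => [//|u us] _.
have /(ctp_par cat)[] : u \in up ++ lo by rewrite e inE eqxx.
by case: (size s).
Qed.

(** Predecessor, successor and hanging leaves are pairwise distinct tree neighbours, so the count in
    [ctp_deg] bounds the degree from below. *)
Lemma spine_deg x : x \in s -> 2 < degree cat_tree x.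
Proof.
move=> xs; have ix : index x s < size s by rewrite index_mem.
apply: leq_trans (ctp_deg cat ix) _.
set l1 := if 0 < index x s then [:: nth x s (index x s).-1] else [::].
set l2 := if (index x s).+1 < size s then [:: nth x s (index x s).+1] else [::].
set l3 := [seq v <- up ++ lo | par v == index x s].
have -> : (0 < index x s) + ((index x s).+1 < size s) +
   count (fun v => par v == index x s) (up ++ lo) = size (l1 ++ l2 ++ l3).
  by rewrite !size_cat size_filter addnA /l1 /l2; case: ifP; case: ifP.
have m12 v : v \in l1 ++ l2 -> v \in s.
  rewrite mem_cat /l1 /l2 => /orP[]; case: ifP => // h; rewrite inE => /eqP->;
  by rewrite mem_nth // (leq_ltn_trans (leq_pred _)).
have m3 v : v \in l3 -> v \notin s.
  rewrite mem_filter => /andP[_ vul]; rewrite -mem_rim /rim mem_cat mem_rev -mem_cat.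
  exact: vul.
have U : uniq (l1 ++ l2 ++ l3).
  rewrite catA cat_uniq (filter_uniq _ Uul) andbT; apply/andP; split; last first.
    by apply/hasPn => v /m3; apply: contra => /m12.
  rewrite /l1 /l2; case: ifP => h1; case: ifP => h2 //=.
  rewrite inE nth_uniq //; first by rewrite andbT neq_ltn ltnS leq_pred.
  exact: leq_ltn_trans (leq_pred _) ix.
rewrite /degree -(card_uniqP U); apply: subset_leq_card; apply/fintype.subsetP => v.
rewrite catA mem_cat inE /= /tree_rel => /orP[v12|v3]; last first.
  apply/orP; right; apply/orP; right; rewrite xs m3 //=.
  by move: v3; rewrite mem_filter eq_sym => /andP[].
rewrite /up_edge xs (m12 v v12) /= !orbF.
move: v12; rewrite mem_cat /l1 /l2 => /orP[]; case: ifP => // h; rewrite inE => /eqP->;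
  rewrite index_uniq ?(leq_ltn_trans (leq_pred _) ix) //; lia.
Qed.

Lemma leaf_nbr x y : x \notin s -> cat_tree x y = (y == nth x s (par x)).
Proof.
move=> xs; have [px _] := par_rim xs.
rewrite /= /tree_rel /up_edge (negbTE xs) /= andbF /= andbF !orbF.
apply/andP/eqP => [[ys /eqP<-]|->]; first by rewrite nth_index.
by rewrite mem_nth // index_uniq.
Qed.

Lemma leaf_deg x : x \notin s -> degree cat_tree x = 1.
Proof.
move=> xs; rewrite /degree (_ : finset _ = [set nth x s (par x)]) ?cards1 //.
by apply/setP => y; rewrite !inE leaf_nbr.
Qed.

Lemma cat_leaves : rim =i leaves cat_tree.
Proof.
move=> x; rewrite mem_rim inE; case xs: (x \in s) => /=.
  by have := spine_deg xs; case: (degree _ _) => [|[|[]]].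
by rewrite leaf_deg ?xs.
Qed.

Lemma cat_treeP : is_tree cat_tree.
Proof.
have sym : connect_sym cat_tree by apply: sym_connect_sym; apply: adj_sym.
have := size_spine_gt0; case es: s => [//|x0 s'] _; rewrite -?es.
split; first split.
- by apply/card_gt0P; exists x0.
- have con x : connect cat_tree x x0.
    have spine y : y \in s -> connect cat_tree y x0.
      move=> ys; have := erefl (index y s); move: {2}(index y s) => n.
      elim: n y ys => [|n IH] y ys iy.
        by have := nth_index x0 ys; rewrite iy es /= => ->.
      have ny : n < size s by have := ys; rewrite -index_mem iy; apply: ltnW.
      have zs : nth x0 s n \in s by rewrite mem_nth.
      apply: connect_trans (connect1 _) (IH _ zs _); last by rewrite index_uniq.
      by rewrite /= /tree_rel /up_edge zs ys iy index_uniq // eqxx !orbT.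
    case xs: (x \in s); first exact: spine.
    have [px _] := par_rim (negbT xs).
    apply: connect_trans (connect1 _) (spine (nth x s (par x)) _); last exact: mem_nth.
    by rewrite leaf_nbr ?xs.
  by move=> x y; apply: connect_trans (con x) _; rewrite sym.
(* Rank by position, spine before leaves: the only tree neighbour of smaller rank is the preceding
   spine vertex or, for a leaf, its parent. *)
- pose r x := index x (s ++ up ++ lo).
  apply: (@ranked_acyclic _ _ r).
    move=> x y e; rewrite -(nth_index x (ctp_all cat x)) -(nth_index x (ctp_all cat y)).
    by congr nth.
  have rs x : x \in s -> r x = index x s by rewrite /r index_cat => ->.
  have rn x : x \notin s -> size s <= r x.
    by rewrite /r index_cat => /negbTE->; rewrite leq_addr.
  have low x y : cat_tree x y -> r y < r x -> if x \in s
      then (y \in s) && (index x s == (index y s).+1) else y == nth x s (par x).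
    case xs: (x \in s); last by rewrite leaf_nbr ?xs.
    case ys: (y \in s); last first.
      rewrite (rs x xs) => _ h; have := rn y (negbT ys).
      by rewrite leqNgt (ltn_trans h) // index_mem.
    by rewrite (rs x xs) (rs y ys) /= /tree_rel /up_edge xs ys /= !orbF; lia.
  move=> x y z Txy Txz /(low _ _ Txy) + /(low _ _ Txz).
  case: ifP => xs; last by move=> /eqP-> /eqP->.
  move=> /andP[ys /eqP e] /andP[zs]; rewrite e => /eqP[] e'.
  by rewrite -(nth_index x ys) -(nth_index x zs) e'.
Qed.

Lemma cat_cycleP : is_cycle_on cat_cycle (leaves cat_tree).
Proof.
exists rim; split=> //; first by rewrite /rim size_cat size_rev (ctp_size cat).
- exact: rim_uniq.
- exact: cat_leaves.
Qed.

Lemma cat_halinP (R : realType) : planar R cat_halin -> halin R cat_halin.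
Proof.
move=> pl; exists cat_tree, cat_cycle; split=> //; first exact: cat_treeP.
  move=> x; case xs: (x \in s); last by rewrite leaf_deg ?xs.
  by have := spine_deg xs; case: (degree _ _) => [|[|[|]]].
exact: cat_cycleP.
Qed.

Lemma cat_halin_sub : spanning_subgraph cat_halin G.
Proof. by move=> x y /orP[/tree_rel_sub|/cycle_rel_sub]. Qed.

End Caterpillar.

(** * A straight-line drawing *)

Section Segments.
Variable R : realType.
Local Open Scope ring_scope.
Local Open Scope classical_set_scope.

Definition segment (a b : R * R) : set (R * R) :=
  [set p | exists2 t : R, 0 <= t <= 1 &
     p = ((1 - t) * a.1 + t * b.1, (1 - t) * a.2 + t * b.2)].

Lemma segment_sym a b : segment a b = segment b a.
Proof.
apply/seteqP; split => p [t /andP[t0 t1] ->]; (exists (1 - t); [by apply/andP; split; lra | by congr pair; ring]).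
Qed.

Lemma segment_arc a b : a <> b -> is_arc (segment a b) a b.
Proof.
move=> ab; exists (fun t => ((1 - t) * a.1 + t * b.1, (1 - t) * a.2 + t * b.2)).
split.
- apply: continuous_subspaceT => t.
  have c (u v : R) : (1 - x) * u + x * v @[x --> t] --> (1 - t) * u + t * v.
    apply: cvgD; apply: cvgM;
      [apply: cvgB; [exact: cvg_cst|exact: cvg_id]|exact: cvg_cst|exact: cvg_id|exact: cvg_cst].
  exact: (cvg_pair (c a.1 b.1) (c a.2 b.2)).
- move=> t u _ _ [e1 e2]; apply/eqP; rewrite -subr_eq0.
  have f1 : (t - u) * (b.1 - a.1) = 0 by lra.
  have f2 : (t - u) * (b.2 - a.2) = 0 by lra.
  case/eqP: f1; rewrite mulf_eq0 => /orP[//|/eqP g1].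
  case/eqP: f2; rewrite mulf_eq0 => /orP[//|/eqP g2].
  by case: ab; rewrite (surjective_pairing a) (surjective_pairing b); congr pair; lra.
- by rewrite !subr0 !mul1r !mul0r !addr0 -surjective_pairing.
- by rewrite !subrr !mul1r !mul0r !add0r -surjective_pairing.
- apply/seteqP; split => p /=.
    by case=> t; rewrite in_itv /= => t01 <-; exists t.
  by case=> t t01 ->; exists t => //; rewrite /= in_itv.
Qed.

(** Two segments across a strip, weakly ordered at height 0 and strictly at height 1: their
    horizontal distance is a sum of two nonnegative terms, so it vanishes only at height 0 and only
    if the feet coincide. *)
Lemma transversals_meet (t a a' b b' : R) :
  0 <= t <= 1 -> a <= a' -> b < b' ->
  (1 - t) * a + t * b = (1 - t) * a' + t * b' -> t = 0 /\ a = a'.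
Proof.
case/andP=> t0 t1 aa bb e.
have h1 : 0 <= (1 - t) * (a' - a) by apply: mulr_ge0; lra.
have h2 : 0 <= t * (b' - b) by apply: mulr_ge0; lra.
have : t * (b' - b) = 0 by lra.
move/eqP; rewrite mulf_eq0 => /orP[/eqP t0'|/eqP]; last by lra.
by split=> //; move: h1 e; rewrite t0'; lra.
Qed.

End Segments.

Section Drawing.
Variables (V : finType) (G : sgraph V) (s up lo : seq V) (par : V -> nat).
Hypothesis cat : caterpillar G s up lo par.

Let Us : uniq s. Proof. by have := ctp_uniq cat; rewrite cat_uniq => /andP[]. Qed.
Let Uul : uniq (up ++ lo).
Proof. by have := ctp_uniq cat; rewrite cat_uniq => /and3P[]. Qed.

Let L (b : bool) := if b then up else lo.

Let UL b : uniq (L b).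
Proof. by have := Uul; rewrite cat_uniq /L; case: b => /and3P[]. Qed.

Let L0 b : 0 < size (L b).
Proof. by case: b; [exact: ctp_up0 cat | exact: ctp_lo0 cat]. Qed.

Variant edge_kind (x y : V) : Prop :=
| EdgeSpine of x \in s & y \in s & index y s = (index x s).+1
| EdgeRim b of x \in L b & y \in L b & index y (L b) = (index x (L b)).+1
| EdgePar b of x \in L b & y \in s & index y s = par x
| EdgeHead of x \in up & y \in lo & index x up = 0 & index y lo = 0
| EdgeLast of x \in up & y \in lo & index x up = (size up).-1 & index y lo = (size lo).-1.

Let sLn x b : x \in s -> x \in L b = false.
Proof.
have := ctp_uniq cat; rewrite cat_uniq => /and3P[_ /hasPn H _] xs.
apply/negbTE/negP => xl; have /H : x \in up ++ lo.
  by rewrite mem_cat; move: xl; rewrite /L; case: b => ->; rewrite ?orbT.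
by rewrite /= xs.
Qed.

Let LLn x b : x \in L b -> x \in L (~~ b) = false.
Proof.
move=> h; apply/negbTE; move: h; rewrite /L; case: b => /=; last exact: (lo_notin_up cat).
by apply: contraL => /(lo_notin_up cat).
Qed.

Lemma vertex_cases x : x \in s \/ exists b, x \in L b.
Proof.
have := ctp_all cat x; rewrite !mem_cat => /or3P[|h|h]; [by left | right..].
  by exists true.
by exists false.
Qed.

Let index_inj (l : seq V) x y : x \in l -> y \in l -> index x l = index y l -> x = y.
Proof. by move=> xl yl e; rewrite -(nth_index x xl) e nth_index. Qed.

Lemma halin_edge x y : cat_halin cat x y -> edge_kind x y \/ edge_kind y x.
Proof.
have tree u v : up_edge s par u v -> edge_kind u v.
  case/orP=> /and3P[us vs /eqP e]; first exact: EdgeSpine.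
  by have [|[b ub]] := vertex_cases u; [rewrite (negbTE us) | apply: EdgePar ub vs e].
suff rim u v : rim_edge up lo u v -> edge_kind u v \/ edge_kind v u.
  by case/orP=> /orP[] h; do [move/tree: h | move/rim: h]; tauto.
case/andP=> ur /eqP->.
(* Positions of two consecutive rim vertices, written in the direction of the rim; the lower row
   decreases. By [rim_cycle] every rim edge is then of one of these four kinds. *)
pose e u v := [|| [&& u \in up, v \in up & index v up == (index u up).+1],
  [&& u \in lo, v \in lo & index u lo == (index v lo).+1],
  [&& u \in up, v \in lo, index u up == (size up).-1 & index v lo == (size lo).-1] |
  [&& u \in lo, v \in up, index u lo == 0 & index v up == 0]].
have /next_cycle/(_ ur) : cycle e (rim up lo).
  apply: (rim_cycle cat).
  - apply/(sortedP u) => i iu; rewrite /e !mem_nth ?index_uniq ?(UL true) ?(ltnW iu) //.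
    by rewrite eqxx.
  - apply/(sortedP u) => i il; rewrite /e !(mem_nth u il) !(mem_nth u (ltnW il)).
    by rewrite !index_uniq ?(UL false) ?(ltnW il) // eqxx !orbT.
  - move=> z; rewrite /e; move: (UL true) (UL false) (L0 true) (L0 false); rewrite /L.
    case/lastP: up => // u1 z1; case/lastP: lo => // l1 z2 U1 U2 _ _.
    rewrite !last_rcons !mem_rcons !inE !eqxx !size_rcons /= -!cats1 !index_cat.
    move: U1 U2; rewrite !rcons_uniq => /andP[/negbTE-> _] /andP[/negbTE-> _].
    by rewrite /= !eqxx !addn0 !eqxx !orbT.
  - move=> z; rewrite /e; move: (L0 true) (L0 false); rewrite /L.
    by case: up => // u1 z1; case: lo => // l1 z2 _ _; rewrite /= !inE !eqxx !orbT.
case/or4P => [/and3P[h1 h2 /eqP h3]|/and3P[h1 h2 /eqP h3]|/and4P[h1 h2 /eqP h3 /eqP h4]|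
   /and4P[h1 h2 /eqP h3 /eqP h4]].
- by left; apply: (@EdgeRim _ _ true).
- by right; apply: (@EdgeRim _ _ false).
- by left; apply: EdgeLast.
- by right; apply: EdgeHead.
Qed.

Variable R : realType.
Local Open Scope ring_scope.

Let q := size s.

Definition spine_coord (i : nat) : R := i%:R.

(* A one-vertex row sits at abscissa 0; a longer row reaches from -1 beyond 2q, so the two
   edges joining the rows pass strictly to the left and to the right of the spine. *)
Definition row_coord (m j : nat) : R :=
  if (m == 1)%N then 0 else (j * (2 * q).+1)%:R - 1.

Definition row_height (b : bool) : R := if b then 1 else -1.

Definition vertex_pos (x : V) : R * R :=
  if x \in s then (spine_coord (index x s), 0)
  else if x \in up then (row_coord (size up) (index x up), 1)
  else (row_coord (size lo) (index x lo), -1).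

Lemma pos_spine x : x \in s -> vertex_pos x = (spine_coord (index x s), 0).
Proof. by rewrite /vertex_pos => ->. Qed.

Let X b z := row_coord (size (L b)) (index z (L b)).

Lemma pos_row b x : x \in L b -> vertex_pos x = (X b x, row_height b).
Proof.
move=> xb; rewrite /vertex_pos; case: ifP => [/(@sLn x b)|_]; first by rewrite xb.
case: b xb => [-> //|xl]; have := LLn xl; rewrite /L /= => ->.
by [].
Qed.

Lemma spine_coord_lt i j : (i < j)%N -> spine_coord i < spine_coord j.
Proof. by move=> ij; rewrite ltr_nat. Qed.

Lemma spine_coord_le i j : (i <= j)%N -> spine_coord i <= spine_coord j.
Proof. by move=> ij; rewrite ler_nat. Qed.

Lemma spine_coord_inj : injective spine_coord.
Proof. by move=> i j /eqP; rewrite eqr_nat => /eqP. Qed.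

Lemma row_coord_lt m i j : (i < j < m)%N -> row_coord m i < row_coord m j.
Proof.
case/andP=> ij jm; rewrite /row_coord; case: eqP => [m1|_].
  by move: ij jm; rewrite m1; case: j => //; case: i.
by rewrite ltrD2r ltr_nat ltn_mul2r.
Qed.

Lemma X_lt b x y : y \in L b -> (index x (L b) < index y (L b))%N -> X b x < X b y.
Proof. by move=> yb xy; apply: row_coord_lt; rewrite xy index_mem. Qed.

Lemma X_inj b x y : x \in L b -> y \in L b -> X b x = X b y -> x = y.
Proof.
move=> xb yb e; apply: (index_inj xb yb); apply/eqP.
case: ltngtP => // /X_lt; first by move=> /(_ yb); rewrite e ltxx.
by move=> /(_ xb); rewrite e ltxx.
Qed.

(** The edge between the first vertices of the rows runs from height 1 to height -1, so it crosses
    the line of the spine at the midpoint [cL]; [cR] is the same point for the last vertices. *)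
Let cL : R := (row_coord (size up) 0 + row_coord (size lo) 0) / 2.
Let cR : R := (row_coord (size up) (size up).-1 + row_coord (size lo) (size lo).-1) / 2.

(** With at least three leaves, one row has two vertices and starts at -1; the other starts at -1 or
    0, so [cL] is negative. *)
Lemma left_lt i : cL < spine_coord i.
Proof.
have i0 : 0 <= spine_coord i by rewrite ler0n.
have h m : row_coord m 0 <= 0 by rewrite /row_coord; case: ifP => // _; rewrite mul0n; lra.
have := ctp_size cat; rewrite /cL; move: (h (size up)) (h (size lo)).
rewrite /row_coord; case: eqP => [->|_]; case: eqP => [->|_] //; rewrite ?mul0n; lra.
Qed.

(** A row of more than one vertex ends at 2q or further, so even if the other row is a single vertex
    at 0 the midpoint is at least q, beyond the last spine vertex at q - 1. This is the reason for
    the factor 2q + 1 in [row_coord]. *)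
Lemma right_gt i : (i < q)%N -> spine_coord i < cR.
Proof.
move=> iq; have i1 : spine_coord i <= q%:R - 1.
  by rewrite lerBrDr -[X in _ + X]/1%:R -natrD ler_nat addn1.
have q0 : (0 : R) <= q%:R by rewrite ler0n.
have h m : (0 < m)%N -> m != 1%N -> 2 * q%:R <= row_coord m m.-1.
  move=> m0 m1; rewrite /row_coord (negbTE m1) lerBrDr -[X in _ + X]/1%:R -natrM -natrD.
  by rewrite ler_nat addn1; case: m m0 m1 => [|[|m]] //= _ _; rewrite mulSn leq_addr.
have := ctp_size cat; rewrite /cR.
have := h _ (L0 true); have := h _ (L0 false); rewrite /L.
case: (eqVneq (size up) 1%N) => [->|u1]; case: (eqVneq (size lo) 1%N) => [->|l1] //;
  rewrite /row_coord ?eqxx ?(negbTE u1) ?(negbTE l1).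
- by move=> /(_ isT) + _ _; lra.
- by move=> _ /(_ isT) + _; lra.
- by move=> /(_ isT) + /(_ isT) + _; lra.
Qed.

Lemma left_lt_right : cL < cR.
Proof. by have := left_lt 0; have := right_gt (size_spine_gt0 cat); lra. Qed.

(** The abscissa [a] at which the edge from the row vertex [z] to [w] reaches height 0: at the
    parent of [z], or at one of the two crossing points if the edge joins the rows. *)
Let anchor b z w (a : R) : Prop :=
  [\/ [/\ w \in s, index w s = par z & a = spine_coord (par z)],
      [/\ w \in L (~~ b), index z (L b) = 0%N, index w (L (~~ b)) = 0%N & a = cL] |
      [/\ w \in L (~~ b), index z (L b) = (size (L b)).-1,
          index w (L (~~ b)) = (size (L (~~ b))).-1 & a = cR]].

(** An edge joining the rows is cut at height 0, and each half is treated like a segment from a leaf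
    to the line of the spine. In [TraceStrip], [row_height b * p.2] is the distance of the point
    from that line, 1 being the row. *)
Variant trace (x y : V) (p : R * R) : Prop :=
| TraceSpine of x \in s & y \in s & index y s = (index x s).+1 & p.2 = 0 &
    spine_coord (index x s) <= p.1 <= spine_coord (index y s)
| TraceRow b of x \in L b & y \in L b & index y (L b) = (index x (L b)).+1 &
    p.2 = row_height b & X b x <= p.1 <= X b y
| TraceStrip b z w a of x = z /\ y = w \/ x = w /\ y = z & z \in L b & anchor b z w a &
    0 <= row_height b * p.2 <= 1 &
    p.1 = (1 - row_height b * p.2) * a + row_height b * p.2 * X b z.

Lemma edge_trace x y p :
  edge_kind x y -> segment (vertex_pos x) (vertex_pos y) p -> trace x y p.
Proof.
case=> [xs ys e|b xb yb e|b xb ys e|xu yl e1 e2|xu yl e1 e2] [t /andP[t0 t1] ->].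
- rewrite (pos_spine xs) (pos_spine ys); apply: TraceSpine => //=; first by lra.
  have : spine_coord (index x s) <= spine_coord (index y s).
    by rewrite e; apply: spine_coord_le.
  move: (spine_coord (index y s)) (spine_coord (index x s)) => c a ac.
  have : 0 <= t * (c - a) by apply: mulr_ge0; lra.
  have : 0 <= (1 - t) * (c - a) by apply: mulr_ge0; lra.
  by lra.
- rewrite (pos_row xb) (pos_row yb); apply: (@TraceRow _ _ _ b) => //=; first by lra.
  have : X b x < X b y by apply: X_lt => //; rewrite e.
  move: (X b y) (X b x) => c a ac.
  have : 0 <= t * (c - a) by apply: mulr_ge0; lra.
  have : 0 <= (1 - t) * (c - a) by apply: mulr_ge0; lra.
  by lra.
- rewrite (pos_row xb) (pos_spine ys).
  have E : row_height b * ((1 - t) * row_height b + t * 0) = 1 - t.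
    by rewrite /row_height; case: (b) => /=; ring.
  apply: (@TraceStrip _ _ _ b x y (spine_coord (par x))) => //=; first by left.
  + by constructor 1.
  + by rewrite E; lra.
  + by rewrite E e; ring.
- have xu' : x \in L true by []. have yl' : y \in L false by [].
  rewrite (pos_row xu') (pos_row yl') /X e1 e2 /L /=.
  (* Parameter 1/2 is the point at height 0: up to it the point lies in the upper strip, beyond it
     in the lower strip, seen from [y]. *)
  case: (leP t (1/2)) => h.
  + apply: (@TraceStrip _ _ _ true x y cL) => //=; first by left.
    * by constructor 2.
    * by rewrite /row_height /=; lra.
    * by rewrite /row_height /cL /X /= /L e1; field.
  + apply: (@TraceStrip _ _ _ false y x cL) => //=; first by right.
    * by constructor 2.
    * by rewrite /row_height /=; lra.
    * by rewrite /row_height /cL /X /= /L e2; field.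
- have xu' : x \in L true by []. have yl' : y \in L false by [].
  rewrite (pos_row xu') (pos_row yl') /X e1 e2 /L /=.
  case: (leP t (1/2)) => h.
  + apply: (@TraceStrip _ _ _ true x y cR) => //=; first by left.
    * by constructor 3.
    * by rewrite /row_height /=; lra.
    * by rewrite /row_height /cR /X /= /L e1; field.
  + apply: (@TraceStrip _ _ _ false y x cR) => //=; first by right.
    * by constructor 3.
    * by rewrite /row_height /=; lra.
    * by rewrite /row_height /cR /X /= /L e2; field.
Qed.

Lemma par_mono b z z' : z \in L b -> z' \in L b ->
  (index z (L b) <= index z' (L b))%N -> (par z <= par z')%N.
Proof.
move=> zb zb' le.
have srt : sorted leq (map par (L b)).
  by case: b {zb zb' le}; [exact: ctp_par_up cat | exact: ctp_par_lo cat].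
have := sorted_leq_nth leq_trans leqnn 0%N srt (index z (L b)) (index z' (L b)).
rewrite !inE size_map !index_mem => /(_ zb zb' le).
by rewrite !(nth_map z) ?index_mem // !nth_index.
Qed.

Lemma par_lt b z : z \in L b -> (par z < q)%N.
Proof.
move=> zb; have : z \in up ++ lo by rewrite mem_cat; case: b zb => /= ->; rewrite ?orbT.
by case/(ctp_par cat).
Qed.

(** Anchors keep the order of the row: parents are monotone, [cL] belongs only to the first vertex
    and [cR] only to the last. This prevents crossings inside a strip. *)
Lemma anchor_le b z w a z' w' a' :
  z \in L b -> z' \in L b -> anchor b z w a -> anchor b z' w' a' ->
  (index z (L b) < index z' (L b))%N -> a <= a'.
Proof.
move=> zb zb' + + lt.
have lz := left_lt_right.
have lt' : (index z' (L b) < size (L b))%N by rewrite index_mem.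
case=> [[_ _ ->]|[_ i0 _ ->]|[_ i0 _ _]]; last by move: lt lt'; rewrite i0; case: (size _) => // n /=; lia.
- case=> [[_ _ ->]|[_ j0 _ _]|[_ _ _ ->]]; first by apply: spine_coord_le (par_mono zb zb' (ltnW lt)).
    by move: lt; rewrite j0.
  by apply: ltW; apply: right_gt (par_lt zb).
- case=> [[_ _ ->]|[_ j0 _ _]|[_ _ _ ->]]; first by apply: ltW; apply: left_lt.
    by move: lt; rewrite j0.
  exact: ltW.
Qed.

(** Different edges of one strip share a foot only at a spine vertex, because [cL] and [cR] lie
    outside the spine and each carries a single edge. *)
Lemma anchor_eq b z w z' w' a :
  z \in L b -> z' \in L b -> anchor b z w a -> anchor b z' w' a ->
  (w \in s /\ w = w' /\ a = spine_coord (index w s)) \/ (z = z' /\ w = w').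
Proof.
move=> zb zb'.
have lz := left_lt_right.
have pl i : cL <> spine_coord i by have := left_lt i => + e; rewrite e ltxx.
have pr y : y \in L b -> cR <> spine_coord (par y).
  by move=> /par_lt/right_gt + e; rewrite e ltxx.
have lr : cL <> cR by move=> e; move: lz; rewrite e ltxx.
case=> [[h1 h2 ->]|[h1 h2 h3 ->]|[h1 h2 h3 ->]]; case=> [[g1 g2 e]|[g1 g2 g3 e]|[g1 g2 g3 e]].
- left; rewrite h2; split=> //; split=> //; apply: (index_inj h1 g1).
  by rewrite h2 g2; apply: spine_coord_inj.
- by case: (pl (par z)).
- by case: (pr z zb).
- by case: (pl (par z')).
- by right; split; apply: index_inj; eauto; congruence.
- by case: lr.
- by case: (pr z' zb').
- by case: lr.
- by right; split; apply: index_inj; eauto; congruence.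
Qed.

(** Across the line of the spine, equal feet lie at a spine vertex or belong to the two halves of
    one edge between the rows. *)
Lemma anchor_opp b z w z' w' a :
  z \in L b -> z' \in L (~~ b) -> anchor b z w a -> anchor (~~ b) z' w' a ->
  (w \in s /\ a = spine_coord (index w s)) \/ (z = w' /\ w = z').
Proof.
move=> zb zb'.
have lz := left_lt_right.
have pl i : cL <> spine_coord i by have := left_lt i => + e; rewrite e ltxx.
have pr c y : y \in L c -> cR <> spine_coord (par y).
  by move=> /par_lt/right_gt + e; rewrite e ltxx.
have lr : cL <> cR by move=> e; move: lz; rewrite e ltxx.
case=> [[h1 h2 ->]|[h1 h2 h3 ->]|[h1 h2 h3 ->]]; first by left; rewrite h2.
- case=> [[g1 g2 e]|[g1 g2 g3 e]|[g1 g2 g3 e]]; [by case: (pl (par z'))| |by case: lr].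
  move: g1 g3; rewrite negbK => g1 g3.
  by right; split; apply: index_inj; eauto; congruence.
- case=> [[g1 g2 e]|[g1 g2 g3 e]|[g1 g2 g3 e]]; [by case: (pr _ _ zb')|by case: lr|].
  move: g1 g3; rewrite negbK => g1 g3.
  by right; split; apply: index_inj; eauto; congruence.
Qed.

Lemma height_neq0 b : row_height b != 0.
Proof. by rewrite /row_height; case: b; rewrite ?oppr_eq0 oner_eq0. Qed.

Lemma height_sq b : row_height b * row_height b = 1.
Proof. by rewrite /row_height; case: b => /=; ring. Qed.

Lemma strip_top b z a (p : R * R) : z \in L b -> row_height b * p.2 = 1 ->
  p.1 = (1 - row_height b * p.2) * a + row_height b * p.2 * X b z -> p = vertex_pos z.
Proof.
move=> zb e; rewrite e => e1; rewrite (pos_row zb) (surjective_pairing p) e1; congr pair; first by lra.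
by rewrite -[p.2]mul1r -(height_sq b) -mulrA e mulr1.
Qed.

Lemma row_height_row b b' (p : R * R) :
  p.2 = row_height b' -> 0 <= row_height b * p.2 -> b = b'.
Proof. by move=> ->; rewrite /row_height; case: b; case: b' => //=; lra. Qed.

(** In one strip, edges with different top ends meet only at a common foot, by [transversals_meet];
    with the same top end and different feet they meet only at the top. All other pairs of pieces
    can meet only on the line of the spine or on a row, where abscissae are compared. *)
Lemma traces_cross x y x' y' p :
  trace x y p -> trace x' y' p -> [set x; y]%SET <> [set x'; y']%SET ->
  p = vertex_pos x \/ p = vertex_pos y.
Proof.
have pE c : p = c <-> p.1 = c.1 /\ p.2 = c.2.
  by case: p c => a b [c d]; split => [[-> ->]|[/= -> ->]].
case=> [xs ys e p2 /andP[l1 l2]|b xb yb e p2 /andP[l1 l2]|b z w a zw zb an t01 p1].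
- rewrite (pos_spine xs) (pos_spine ys).
  case=> [xs' ys' e' _ /andP[l1' l2']|b' xb' yb' e' p2' _|b' z' w' a' zw' zb' an' t01' p1'] ne.
  + case: (ltngtP (index x s) (index x' s)) => h.
    * have : spine_coord (index y s) <= spine_coord (index x' s).
        by apply: spine_coord_le; rewrite e.
      by move=> h'; right; apply/pE => /=; split=> //; lra.
    * have : spine_coord (index y' s) <= spine_coord (index x s).
        by apply: spine_coord_le; rewrite e'.
      by move=> h'; left; apply/pE => /=; split=> //; lra.
    * have ex := index_inj xs xs' h; have ey : y = y' by apply: (index_inj ys ys'); lia.
      by case: ne; rewrite ex ey.
  + by move: (height_neq0 b'); rewrite -p2' p2 eqxx.
  + have {}p1' : p.1 = a' by rewrite p1' p2 mulr0 mul0r subr0 mul1r addr0.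
    case: an' => [[h1 h2 h3]|[_ _ _ h3]|[_ _ _ h3]].
    * have i1 : (index x s <= par z')%N by rewrite leqNgt; apply/negP => /spine_coord_lt; lra.
      have i2 : (par z' <= index y s)%N by rewrite leqNgt; apply/negP => /spine_coord_lt; lra.
      have : (par z' == index x s) || (par z' == index y s) by lia.
      by case/orP=> /eqP E; [left|right]; apply/pE => /=; rewrite p1' h3 E.
    * by exfalso; have := left_lt (index x s); lra.
    * exfalso; have iq : (index y s < q)%N by rewrite index_mem.
      by have := right_gt iq; lra.
- rewrite (pos_row xb) (pos_row yb).
  case=> [xs' ys' e' p2' _|b' xb' yb' e' p2' /andP[l1' l2']|b' z' w' a' zw' zb' an' t01' p1'] ne.
  + by move: (height_neq0 b); rewrite -p2 p2' eqxx.
  + have bb : b' = b by apply: (@row_height_row b' b p) => //; rewrite p2' height_sq.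
    move: xb' yb' e' l1' l2'; rewrite bb => xb' yb' e' l1' l2'.
    case: (ltngtP (index x (L b)) (index x' (L b))) => h.
    * have : X b y <= X b x'.
        move: h; rewrite -e leq_eqVlt => /orP[/eqP h|]; last by move/X_lt => /(_ xb')/ltW.
        by rewrite (index_inj yb xb' h).
      by move=> h'; right; apply/pE => /=; split=> //; lra.
    * have : X b y' <= X b x.
        move: h; rewrite -e' leq_eqVlt => /orP[/eqP h|]; last by move/X_lt => /(_ xb)/ltW.
        by rewrite (index_inj yb' xb h).
      by move=> h'; left; apply/pE => /=; split=> //; lra.
    * have ex := index_inj xb xb' h; have ey : y = y' by apply: (index_inj yb yb'); lia.
      by case: ne; rewrite ex ey.
  + have bb : b' = b by apply: (@row_height_row b' b p) => //; case/andP: t01'.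
    move: zb' t01' p1'; rewrite bb => zb' t01' p1'.
    have {}p1' : p.1 = X b z' by rewrite p1' p2 height_sq subrr mul0r mul1r add0r.
    have i1 : (index x (L b) <= index z' (L b))%N.
      by rewrite leqNgt; apply/negP => /(X_lt xb); lra.
    have i2 : (index z' (L b) <= index y (L b))%N.
      by rewrite leqNgt; apply/negP => /(X_lt zb'); lra.
    have : (index z' (L b) == index x (L b)) || (index z' (L b) == index y (L b)) by lia.
    case/orP=> /eqP E; [left|right]; apply/pE => /=; rewrite p1'.
      by rewrite (index_inj zb' xb E).
    by rewrite (index_inj zb' yb E).
- move=> tr' ne; suff : p = vertex_pos z \/ p = vertex_pos w.
    by case: zw => [[-> ->]|[-> ->]]; tauto.
  have setzw : [set x; y]%SET = [set z; w]%SET.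
    by case: zw => [[-> ->]|[-> ->]] //; rewrite finset.setUC.
  have pw0 : w \in s -> a = spine_coord (index w s) -> p.2 = 0 -> p = vertex_pos w.
    move=> ws ea p2; rewrite (pos_spine ws); apply/pE; split=> //=.
    by rewrite p1 p2 mulr0 mul0r subr0 mul1r addr0.
  case: tr' => [xs' ys' e' p2' /andP[l1 l2]|b' xb' yb' e' p2' _|b' z' w' a' zw' zb' an' t01' p1'].
  + have E : p.1 = a by rewrite p1 p2' mulr0 mul0r subr0 mul1r addr0.
    case: an => [[h1 h2 h3]|[_ _ _ h3]|[_ _ _ h3]].
    * by right; apply: pw0; rewrite ?h2.
    * by exfalso; have := left_lt (index x' s); lra.
    * exfalso; have iq : (index y' s < q)%N by rewrite index_mem.
      by have := right_gt iq; lra.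
  + have bb : b = b' by apply: (@row_height_row b b' p) => //; case/andP: t01.
    by left; apply: strip_top zb _ p1; rewrite p2' bb height_sq.
  + have setzw' : [set x'; y']%SET = [set z'; w']%SET.
      by case: zw' => [[-> ->]|[-> ->]] //; rewrite finset.setUC.
    case: (eqVneq b' b) => bb; last first.
      have bb' : b' = ~~ b by move: bb; case: (b); case: (b').
      have p20 : p.2 = 0.
        by move: t01 t01'; rewrite bb' /row_height; case: (b) => /=; lra.
      have ea : a' = a by move: p1 p1'; rewrite p20 !mulr0 !mul0r !subr0; lra.
      move: zb' an'; rewrite bb' ea => zb' an'.
      case: (anchor_opp zb zb' an an') => [[ws ew]|[e1 e2]]; first by right; apply: pw0.
      by case: ne; rewrite setzw setzw' e1 e2 finset.setUC.
    move: zb' an' t01' p1'; rewrite bb => zb' an' t01' p1'.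
    case: (ltngtP (index z (L b)) (index z' (L b))) => h.
    * have [t0 ea] := transversals_meet t01 (anchor_le zb zb' an an' h) (X_lt zb' h)
        (etrans (esym p1) p1').
      have p20 : p.2 = 0.
        by move/eqP: t0; rewrite mulf_eq0 (negbTE (height_neq0 b)) => /eqP.
      move: an'; rewrite -ea => an'.
      case: (anchor_eq zb zb' an an') => [[ws [_ ew]]|[e1 _]]; first by right; apply: pw0.
      by move: h; rewrite e1 ltnn.
    * have [t0 ea] := transversals_meet t01 (anchor_le zb' zb an' an h) (X_lt zb h)
        (etrans (esym p1') p1).
      have p20 : p.2 = 0.
        by move/eqP: t0; rewrite mulf_eq0 (negbTE (height_neq0 b)) => /eqP.
      move: an'; rewrite ea => an'.
      case: (anchor_eq zb zb' an an') => [[ws [_ ew]]|[e1 _]]; first by right; apply: pw0.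
      by move: h; rewrite e1 ltnn.
    * have ez := index_inj zb zb' h.
      case: (eqVneq (row_height b * p.2) 1) => [t1|t1]; first by left; apply: strip_top zb t1 p1.
      have ea : a' = a.
        have : (1 - row_height b * p.2) * (a' - a) = 0 by move: p1 p1'; rewrite -ez; lra.
        move/eqP; rewrite mulf_eq0 subr_eq0 eq_sym (negbTE t1) /= subr_eq0.
        by move/eqP.
      move: an'; rewrite ea => an'.
      case: (anchor_eq zb zb' an an') => [[_ [ew _]]|[_ ew]];
        by case: ne; rewrite setzw setzw' ez ew.
Qed.

Lemma trace_vertex x y z : trace x y (vertex_pos z) -> z = x \/ z = y.
Proof.
case=> [xs ys e p2 /andP[l1 l2]|b xb yb e p2 /andP[l1 l2]|b u w a uw ub an t01 p1].
- case: (vertex_cases z) => [zs|[b zb]]; last first.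
    by move: (height_neq0 b) p2; rewrite (pos_row zb) /= => /eqP.
  move: l1 l2; rewrite (pos_spine zs) /= => l1 l2.
  have i1 : (index x s <= index z s)%N by rewrite leqNgt; apply/negP => /spine_coord_lt; lra.
  have i2 : (index z s <= index y s)%N by rewrite leqNgt; apply/negP => /spine_coord_lt; lra.
  have : (index z s == index x s) || (index z s == index y s) by lia.
  by case/orP=> /eqP E; [left|right]; apply: index_inj E.
- case: (vertex_cases z) => [zs|[b' zb]].
    by move: (height_neq0 b) p2; rewrite (pos_spine zs) /= => /eqP h /esym.
  have bb : b' = b by move: p2; rewrite (pos_row zb) /= /row_height; case: (b); case: (b') => //=; lra.
  move: zb l1 l2; rewrite bb => zb; rewrite (pos_row zb) /= => l1 l2.
  have i1 : (index x (L b) <= index z (L b))%N by rewrite leqNgt; apply/negP => /(X_lt xb); lra.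
  have i2 : (index z (L b) <= index y (L b))%N by rewrite leqNgt; apply/negP => /(X_lt zb); lra.
  have : (index z (L b) == index x (L b)) || (index z (L b) == index y (L b)) by lia.
  by case/orP=> /eqP E; [left|right]; apply: index_inj E.
- suff : z = u \/ z = w by case: uw => [[-> ->]|[-> ->]]; tauto.
  move: t01 p1; case: (vertex_cases z) => [zs|[b' zb]].
    rewrite (pos_spine zs) /= mulr0 mul0r subr0 mul1r addr0 => _ ea.
    case: an => [[h1 h2 h3]|[_ _ _ h3]|[_ _ _ h3]].
    * right; apply: (index_inj zs h1); rewrite h2; apply: spine_coord_inj.
      by rewrite ea h3.
    * by have := left_lt (index z s); rewrite ea h3 ltxx.
    * have : (index z s < q)%N by rewrite index_mem.
      by move/right_gt; rewrite ea h3 ltxx.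
  rewrite (pos_row zb) /= => t01.
  have bb : b' = b by move: t01; rewrite /row_height; case: (b); case: (b') => //=; lra.
  move: zb; rewrite bb height_sq subrr mul0r mul1r add0r => zb e.
  by left; apply: X_inj e.
Qed.

Lemma vertex_pos_inj : injective vertex_pos.
Proof.
move=> x y; case: (vertex_cases x) => [xs|[b xb]]; case: (vertex_cases y) => [ys|[b' yb]].
- by rewrite (pos_spine xs) (pos_spine ys) => -[] /spine_coord_inj; apply: index_inj.
- by rewrite (pos_spine xs) (pos_row yb) => -[_] e; move: (height_neq0 b'); rewrite -e eqxx.
- by rewrite (pos_row xb) (pos_spine ys) => -[_] e; move: (height_neq0 b); rewrite e eqxx.
- rewrite (pos_row xb) (pos_row yb) => -[+ e].
  have bb : b' = b by move: e; rewrite /row_height; case: (b); case: (b') => //=; lra.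
  by move: yb; rewrite bb => yb; apply: X_inj.
Qed.

Lemma cat_planar : planar R (cat_halin cat).
Proof.
exists vertex_pos, (fun x y => segment (vertex_pos x) (vertex_pos y)).
have tr x y p : cat_halin cat x y -> segment (vertex_pos x) (vertex_pos y) p ->
    trace x y p \/ trace y x p.
  by case/halin_edge=> k; [left|rewrite segment_sym; right]; apply: edge_trace.
split.
- exact: vertex_pos_inj.
- move=> x y Hxy; apply: segment_arc => /vertex_pos_inj e.
  by move: Hxy; rewrite e adj_irr.
- by move=> x y _; apply: segment_sym.
- by move=> x y z /tr h /h[] /trace_vertex; tauto.
- move=> x y x' y' h h' ne; apply/seteqP; split=> // p [[sp /= np] sp'].
  apply: np; have C u v : [set u; v]%SET = [set v; u]%SET :> {set V} by rewrite finset.setUC.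
  case: (tr _ _ _ h sp) => t1; case: (tr _ _ _ h' sp') => t2.
  + by case: (traces_cross t1 t2 ne) => ->; [left|right].
  + by case: (traces_cross t1 t2) => [|->|->]; [rewrite (C y')|left|right].
  + by case: (traces_cross t1 t2) => [|->|->]; [rewrite (C y)|right|left].
  + by case: (traces_cross t1 t2) => [|->|->]; [rewrite (C y) (C y')|right|left].
Qed.

End Drawing.

Theorem caterpillar_halin (R : realType) (V : finType) (G : sgraph V) s up lo par :
  caterpillar G s up lo par -> exists H : sgraph V, spanning_subgraph H G /\ halin R H.
Proof.
move=> cat; exists (cat_halin cat); split; first exact: cat_halin_sub.
by apply: cat_halinP; apply: cat_planar.
Qed.

(** * Caterpillars with a short spine *)

Section Lists.
Variable V : finType.
Implicit Types (A : {set V}) (l : seq V) (v : V).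

(** That spine and rows list each vertex exactly once is expressed by multiplicities. It then
    becomes an arithmetical identity for each vertex, from which distinctness and completeness both
    follow. *)
Lemma count1_uniq l : (forall v, count_mem v l = 1) -> uniq l.
Proof.
suff H : (forall v, count_mem v l <= 1) -> uniq l by move=> h; apply: H => v; rewrite h.
elim: l => [|x l IH] //= H; apply/andP; split.
  by apply/count_memPn; have := H x; rewrite /= eqxx; case: (count_mem x l).
by apply: IH => v; apply: leq_trans (H v); rewrite leq_addl.
Qed.

Lemma count1_mem l : (forall v, count_mem v l = 1) -> forall v, v \in l.
Proof. by move=> H v; rewrite -has_pred1 has_count H. Qed.

(** The vertices of [A] that have no assigned role; in a clique they form a path in any order and
    are threaded into a row as filler. *)
Definition rest A l := enum (A :\: [set z in l]).

Lemma mem_rest A l v : (v \in rest A l) = (v \in A) && (v \notin l).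
Proof. by rewrite mem_enum !inE andbC. Qed.

Lemma rest_uniq A l : uniq (rest A l).
Proof. exact: enum_uniq. Qed.

Lemma count_mem_uniq l v : uniq l -> count_mem v l = (v \in l).
Proof. by move=> U; rewrite count_uniq_mem. Qed.

Lemma count_rest A l v : uniq l -> {subset l <= A} ->
  count_mem v l + count_mem v (rest A l) = (v \in A).
Proof.
move=> U sub; rewrite !count_mem_uniq ?rest_uniq // mem_rest.
by case vl: (v \in l) => /=; [rewrite (sub v vl) | rewrite andbT].
Qed.

Lemma size_rest A l : uniq l -> {subset l <= A} -> size l + size (rest A l) = #|A|.
Proof.
move=> U sub; rewrite /rest -cardE -(card_uniqP U) -(cardsID [set z in l] A); congr addn.
apply: eq_card => v; rewrite !inE andbC.
by case vl: (v \in l) => //=; rewrite (sub v vl).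
Qed.

Lemma sorted_const (par : V -> nat) i l : (forall v, v \in l -> par v = i) ->
  map par l = nseq (size l) i.
Proof.
elim: l => //= x l IH H; rewrite H ?inE ?eqxx // IH // => v vl.
by apply: H; rewrite inE vl orbT.
Qed.

Lemma count_const (par : V -> nat) i l : (forall v, v \in l -> par v = i) ->
  count (fun v => par v == i) l = size l.
Proof. by move=> H; apply/eqP; rewrite -all_count; apply/allP => v /H->. Qed.

End Lists.

Lemma path_leq_nseq a b n : a <= b -> path leq a (nseq n b).
Proof.
by elim: n a => //= n IH a ab; rewrite ab; apply: IH.
Qed.

Lemma last_nseq_le a b n : a <= b -> last a (nseq n b) <= b.
Proof. by case: n => //= n ab; elim: n => //=. Qed.

Section Stars.
Variables (V : finType) (G : sgraph V).

Definition has_caterpillar := exists s up lo par, @caterpillar V G s up lo par.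

Definition clique (A : {set V}) := forall a b, a \in A -> b \in A -> a != b -> G a b.

Lemma clique_sorted (l : seq V) : uniq l ->
  (forall a b, a \in l -> b \in l -> a != b -> G a b) -> sorted G l.
Proof.
move=> U H; case: l U H => // x l; elim: l x => //= y l IH x /andP[xyl U] H.
rewrite H ?inE ?eqxx ?orbT //=; last by move: xyl; rewrite inE => /norP[].
by apply: IH => // a b al bl; apply: H; rewrite inE ?al ?bl orbT.
Qed.

(** Here and in the two longer versions the lower row is the single vertex [z], hung at the first
    spine vertex, and each block of the upper row hangs at the spine vertex of the same index. The
    bounds on the block sizes give every spine vertex three tree neighbours. *)
Lemma caterpillar1 (s0 : V) (l0 : seq V) z :
  (forall v, count_mem v (s0 :: l0 ++ [:: z]) = 1) ->
  sorted G l0 -> 1 < size l0 -> G z (head z l0) -> G (last z l0) z ->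
  (forall v, v \in z :: l0 -> G v s0) -> has_caterpillar.
Proof.
move=> cnt srt sz hd lst adj.
exists [:: s0], l0, [:: z], (fun=> 0).
have h0 x : head x l0 = head z l0 by case: l0 sz {cnt srt hd lst adj}.
have h1 x : last x l0 = last z l0 by case: l0 sz {cnt srt hd lst adj h0}.
constructor=> //.
- exact: count1_uniq cnt.
- exact: count1_mem cnt.
- exact: ltnW.
- by rewrite /= addn1.
- by move=> x; rewrite h0 adj_sym.
- by move=> x; rewrite h1.
- move=> v vl; split=> //=; apply: adj; move: vl.
  by rewrite mem_cat !inE orbC.
- by rewrite (@sorted_const _ _ 0) //; case: (size l0) => //= n; apply: path_leq_nseq.
- by case=> // _; rewrite count_cat (@count_const _ _ 0) //=; lia.
Qed.

Lemma caterpillar2 (s0 s1 : V) (l0 l1 : seq V) z :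
  (forall v, count_mem v (s0 :: s1 :: (l0 ++ l1) ++ [:: z]) = 1) ->
  G s0 s1 -> sorted G (l0 ++ l1) -> 0 < size l0 -> 1 < size l1 ->
  G z (head z l0) -> G (last z l1) z ->
  (forall v, v \in z :: l0 -> G v s0) -> (forall v, v \in l1 -> G v s1) ->
  has_caterpillar.
Proof.
move=> cnt g01 srt sz0 sz1 hd lst adj0 adj1.
pose par v := (v \notin z :: l0) : nat.
have U := count1_uniq cnt.
have p0 v : v \in z :: l0 -> par v = 0 by rewrite /par => ->.
have p1 v : v \in l1 -> par v = 1.
  move=> vl; rewrite /par; case: (boolP (v \in _)) => // /= vz.
  have cm (l : seq V) : v \in l -> 0 < count_mem v l by rewrite -has_count has_pred1.
  have := cm _ vl; have := cnt v; rewrite /= !count_cat /=.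
  move: vz; rewrite inE => /orP[/eqP->|/cm /=]; first by rewrite eqxx; lia.
  by lia.
exists [:: s0; s1], (l0 ++ l1), [:: z], par.
have h0 x : head x (l0 ++ l1) = head z l0 by case: l0 sz0 {cnt srt hd lst adj0 U p0 p1 par}.
have h1 x : last x (l0 ++ l1) = last z l1.
  by rewrite last_cat; case: l1 sz1 {cnt srt lst adj1 U p1 h0}.
have p0' v : v \in l0 -> par v = 0 by move=> vl; apply: p0; rewrite inE vl orbT.
constructor=> //.
- exact: count1_mem cnt.
- by rewrite /= g01.
- by rewrite size_cat; lia.
- by rewrite size_cat /=; lia.
- by move=> x; rewrite h0 adj_sym.
- by move=> x; rewrite h1.
- move=> v; rewrite !mem_cat => /orP[/orP[vl|vl]|].
  + by rewrite p0' //; split=> //; apply: adj0; rewrite inE vl orbT.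
  + by rewrite p1 //; split=> //; apply: adj1.
  + rewrite inE => /eqP->; rewrite p0 ?inE ?eqxx //; split=> //.
    by apply: adj0; rewrite inE eqxx.
- rewrite map_cat (sorted_const p0') (sorted_const p1).
  case: (size l0) => [|n] /=; last by rewrite cat_path !path_leq_nseq ?last_nseq_le //=;
    apply: leq_trans (last_nseq_le _ _) _.
  by case: (size l1) => //= n; apply: path_leq_nseq.
- have pz : par z = 0 by apply: p0; rewrite inE eqxx.
  case=> [|[|]] //= _; rewrite !count_cat.
    by rewrite (count_const p0') /= pz; lia.
  by rewrite (count_const p1); lia.
Qed.

Lemma caterpillar3 (s0 s1 s2 : V) (l0 l1 l2 : seq V) z :
  (forall v, count_mem v ([:: s0; s1; s2] ++ (l0 ++ l1 ++ l2) ++ [:: z]) = 1) ->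
  G s0 s1 -> G s1 s2 -> sorted G (l0 ++ l1 ++ l2) ->
  0 < size l0 -> 0 < size l1 -> 1 < size l2 ->
  G z (head z l0) -> G (last z l2) z ->
  (forall v, v \in z :: l0 -> G v s0) -> (forall v, v \in l1 -> G v s1) ->
  (forall v, v \in l2 -> G v s2) -> has_caterpillar.
Proof.
move=> cnt g01 g12 srt sz0 sz1 sz2 hd lst adj0 adj1 adj2.
pose par v := if v \in z :: l0 then 0 else if v \in l1 then 1 else 2.
have U := count1_uniq cnt.
have cm v (l : seq V) : v \in l -> 0 < count_mem v l by rewrite -has_count has_pred1.
have p0 v : v \in z :: l0 -> par v = 0 by rewrite /par => ->.
have nz v : v \in l1 ++ l2 -> v \in z :: l0 = false.
  move=> vl; apply/negbTE/negP => vz; have := cnt v; have := cm v _ vl.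
  rewrite !count_cat /=; move: vz; rewrite inE => /orP[/eqP->|/cm /=]; last by lia.
  by rewrite eqxx; lia.
have p1 v : v \in l1 -> par v = 1.
  by move=> vl; rewrite /par nz ?vl // mem_cat vl.
have p2 v : v \in l2 -> par v = 2.
  move=> vl; rewrite /par nz ?mem_cat ?vl ?orbT //; case: ifP => // vl1.
  by have := cnt v; have := cm v _ vl; have := cm v _ vl1; rewrite !count_cat /=; lia.
exists [:: s0; s1; s2], (l0 ++ l1 ++ l2), [:: z], par.
have h0 x : head x (l0 ++ l1 ++ l2) = head z l0.
  by case: l0 sz0 {cnt srt hd lst adj0 U p0 nz p1 p2 par}.
have h1 x : last x (l0 ++ l1 ++ l2) = last z l2.
  by rewrite !last_cat; case: l2 sz2 {cnt srt lst adj2 U p1 p2 nz h0}.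
have p0' v : v \in l0 -> par v = 0 by move=> vl; apply: p0; rewrite inE vl orbT.
constructor=> //.
- exact: count1_mem cnt.
- by rewrite /= g01 g12.
- by rewrite size_cat; lia.
- by rewrite !size_cat /=; lia.
- by move=> x; rewrite h0 adj_sym.
- by move=> x; rewrite h1.
- move=> v; rewrite !mem_cat => /orP[/or3P[vl|vl|vl]|].
  + by rewrite p0' //; split=> //; apply: adj0; rewrite inE vl orbT.
  + by rewrite p1 //; split=> //; apply: adj1.
  + by rewrite p2 //; split=> //; apply: adj2.
  + rewrite inE => /eqP->; rewrite p0 ?inE ?eqxx //; split=> //.
    by apply: adj0; rewrite inE eqxx.
- rewrite !map_cat (sorted_const p0') (sorted_const p1) (sorted_const p2).
  case: (size l0) sz0 => [//|n] _; case: (size l1) sz1 => [//|m] _ /=.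
  rewrite cat_path path_leq_nseq //= cat_path path_leq_nseq // path_leq_nseq /=.
    by rewrite (leq_trans (last_nseq_le _ _)).
  by rewrite (leq_trans (last_nseq_le _ _)).
- have pz : par z = 0 by apply: p0; rewrite inE eqxx.
  case=> [|[|[|]]] //= _; rewrite !count_cat.
  + by rewrite (count_const p0') /= pz; lia.
  + by rewrite (count_const p1); lia.
  + by rewrite (count_const p2); lia.
Qed.

End Stars.

Section Cuts.
Variables (V : finType) (G : sgraph V).

Lemma path_leaves (e : rel V) (A : {set V}) x p :
  path e x p -> x \in A -> last x p \notin A -> exists a b, [/\ a \in A, b \notin A & e a b].
Proof.
elim: p x => [|y p IH] x /=; first by move=> _ ->.
case/andP=> exy py xA lA; case yA: (y \in A); first exact: IH py yA lA.
by exists x, y; rewrite xA yA.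
Qed.

(** The form in which 3-connectivity is used: a path from [u] to [v] avoiding [C] has to leave [A]
    somewhere. *)
Lemma cut_edge (A C : {set V}) u v : k_connected 3 G -> #|C| < 3 ->
  u \in A -> u \notin C -> v \notin A -> v \notin C ->
  exists a b, [/\ a \in A, a \notin C, b \notin A, b \notin C & G a b].
Proof.
move=> [_ con] C3 uA uC vA vC.
have /connectP[p pp lp] := con C C3 u v uC vC.
have := path_leaves pp uA; rewrite -lp => /(_ vA)[a [b [aA bA /and3P[aC bC ab]]]].
by exists a, b.
Qed.

End Cuts.

(** * Independence number two *)

Ltac count_lia :=
  repeat match goal with |- context [nat_of_bool ?b] => generalize (nat_of_bool b) end; lia.

(** König's theorem for matchings of three edges: if no two vertices cover all edges, such a
    matching exists. Two disjoint edges are found greedily and then augmented. *)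
Lemma konig3 (T : eqType) (x0 : T) (e : rel T) :
  (forall a b a' b', e a b -> e a' b' -> a != b') ->
  (forall p q, exists a b, [/\ e a b, a \notin [:: p; q] & b \notin [:: p; q]]) ->
  exists a1 a2 a3 b1 b2 b3,
    [/\ uniq [:: a1; a2; a3], uniq [:: b1; b2; b3], e a1 b1, e a2 b2 & e a3 b3].
Proof.
move=> bip cov.
have [a1 [b1 [e1 _ _]]] := cov x0 x0.
have [a2 [b2 [e2 na2 nb2]]] := cov a1 b1.
have {na2 nb2} [n21 m21] : a2 != a1 /\ b2 != b1.
  by move: na2 nb2; rewrite !inE !negb_or => /andP[-> _] /andP[_ ->].
have [a' [b' [e' na' _]]] := cov a1 a2.
have {na'} [n1 n2] : a' != a1 /\ a' != a2.
  by move: na'; rewrite !inE !negb_or => /andP[-> ->].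
case: (boolP (b' \in [:: b1; b2])) => hb'; last first.
  exists a1, a2, a', b1, b2, b'; split=> //=; rewrite !inE !negb_or.
    by rewrite (eq_sym a1) n21 (eq_sym a1) n1 (eq_sym a2) n2.
  move: hb'; rewrite !inE !negb_or => /andP[g1 g2].
  by rewrite (eq_sym b1) m21 (eq_sym b1) g1 (eq_sym b2) g2.
(* The third edge has a new left end but a right end already in use; the two matching edges play
   symmetric roles. *)
wlog eb : a1 b1 a2 b2 e1 e2 n21 m21 n1 n2 hb' / b' = b1.
  move=> H; move: (hb'); rewrite !inE => /orP[/eqP|/eqP] E; first exact: (H a1 b1 a2 b2).
  by apply: (H a2 b2 a1 b1) => //; rewrite ?(eq_sym a1) ?(eq_sym b1) // !inE E eqxx.
move: e'; rewrite {}eb {hb' b'} => e'.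
have [a'' [b'' [e'' _ nb'']]] := cov b1 b2.
have {nb''} [p1 p2] : b'' != b1 /\ b'' != b2.
  by move: nb''; rewrite !inE !negb_or => /andP[-> ->].
case: (eqVneq a'' a1) => [ea|q1].
  exists a', a1, a2, b1, b'', b2; rewrite -{2}ea /= !inE !negb_or; split=> //.
    by rewrite n1 n2 (eq_sym a1) n21.
  by rewrite (eq_sym b1) p1 (eq_sym b1) m21 p2.
case: (eqVneq a'' a2) => [ea|q2]; last first.
  exists a1, a2, a'', b1, b2, b''; rewrite /= !inE !negb_or; split=> //.
    by rewrite (eq_sym a1) n21 (eq_sym a1) q1 (eq_sym a2) q2.
  by rewrite (eq_sym b1) m21 (eq_sym b1) p1 (eq_sym b2) p2.
(* The edges found so far, [a1 b1], [a' b1], [a2 b2] and [a2 b''], are all covered by [b1] and [a2].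
   An edge avoiding this pair leaves a choice at [b1] and at [a2] that is disjoint from it. *)
have [a3 [b3 [e3 na3 nb3]]] := cov b1 a2.
have [r1 r2] : a3 != a2 /\ b3 != b1.
  by move: na3 nb3; rewrite !inE !negb_or => /andP[_ ->] /andP[-> _].
have [a [ea1 s1 s2]] : exists a, [/\ e a b1, a != a3 & a != a2].
  case: (eqVneq a1 a3) => [E|N]; last by exists a1; rewrite N eq_sym.
  by exists a'; rewrite -E.
have [b [eb1 t1 t2]] : exists b, [/\ e a2 b, b != b3 & b != b1].
  case: (eqVneq b2 b3) => [E|N]; last by exists b2; rewrite N.
  by exists b''; rewrite -E -ea.
exists a3, a, a2, b3, b1, b; rewrite /= !inE !negb_or; split=> //.
  by rewrite (eq_sym a3) s1 r1 s2.
by rewrite r2 (eq_sym b3) t1 (eq_sym b1) t2.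
Qed.

Section AlphaTwo.
Variables (V : finType) (G : sgraph V).
Hypothesis kc : k_connected 3 G.
Hypothesis a2 : forall a b c, a != b -> a != c -> b != c -> [|| G a b, G a c | G b c].

Definition nonnbr v := [set u | (u != v) && ~~ G v u].

Variable x : V.
Hypothesis xmax : forall v, #|nonnbr v| <= #|nonnbr x|.

Let K := nonnbr x.
Let X := [set u | G x u].

Lemma GC u v : G u v = G v u. Proof. exact: adj_sym. Qed.

Lemma adj_neq u v : G u v -> u != v.
Proof. by apply: contraTneq => ->; rewrite adj_irr. Qed.

Lemma inX v : (v \in X) = G x v. Proof. by rewrite inE. Qed.
Lemma inK v : (v \in K) = (v != x) && ~~ G x v. Proof. by rewrite inE. Qed.

Lemma xXK v : (x == v) + (v \in X) + (v \in K) = 1.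
Proof.
rewrite inX inK eq_sym; case: eqP => [->|_] /=; first by rewrite adj_irr.
by case: (G x v).
Qed.

Lemma XnK u k : u \in X -> k \in K -> u != k.
Proof. by rewrite inX inK => h /andP[_ nk]; apply: contraNneq nk => <-. Qed.

Lemma nonadj_third y u v : u != v -> y != u -> y != v -> ~~ G y u -> ~~ G y v -> G u v.
Proof. by move=> uv yu yv /negbTE nu /negbTE nv; have := a2 yu yv uv; rewrite nu nv. Qed.

Lemma Kclique : clique G K.
Proof.
move=> a b; rewrite !inK => /andP[ax na] /andP[bx nb] ab.
by apply: (@nonadj_third x) => //; rewrite eq_sym.
Qed.

Lemma KG a b : a \in K -> b \in K -> a != b -> G a b. Proof. exact: Kclique. Qed.

Lemma star u v k : u \in X -> v \in X -> u != v -> ~~ G u v -> k \in K -> ~~ G u k -> G v k.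
Proof.
move=> uX vX uv nuv kK nuk; apply: (@nonadj_third u) => //; exact: XnK.
Qed.

(** By the choice of [x], the non-neighbours of [v] in [X] and in [K] together number at most |K|;
    cancelling those in [K] leaves the bound. *)
Lemma nonnbr_le v (l : seq V) : v \in X -> uniq l ->
  (forall u, u \in l -> [/\ u \in X, u != v & ~~ G v u]) ->
  size l <= #|[set k in K | G v k]|.
Proof.
move=> vX U H.
have e1 : #|K| = #|[set k in K | G v k]| + #|[set k in K | ~~ G v k]|.
  rewrite -(cardsID [set k | G v k] K); congr (_ + _); apply: eq_card => u;
  by rewrite !inE // andbC.
have sub : [set u in l] :|: [set k in K | ~~ G v k] \subset nonnbr v.
  apply/fintype.subsetP => u; rewrite !inE => /orP[/H[_ -> ->] //|/andP[h ->]].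
  rewrite andbT; have uK : u \in K by rewrite inE.
  by rewrite eq_sym; apply: XnK.
have := leq_trans (subset_leq_card sub) (xmax v).
have d : [disjoint [set u in l] & [set k in K | ~~ G v k]].
  rewrite -setI_eq0; apply/eqP/setP => u; rewrite !inE; apply/negbTE/negP.
  case/and3P=> /H[uX _ _] h _; have uK : u \in K by rewrite inE.
  by have := XnK uX uK; rewrite eqxx.
rewrite cardsU (disjoint_setI0 d) cards0 subn0 -/K e1 leq_add2r.
by apply: leq_trans; rewrite cardsE (card_uniqP U).
Qed.

Lemma has_Knbr v u : v \in X -> u \in X -> u != v -> ~~ G v u -> exists2 k, k \in K & G v k.
Proof.
move=> vX uX uv nuv.
have /card_gt0P[k] : 0 < #|[set k in K | G v k]|.
  by apply: (@nonnbr_le v [:: u]) => // z; rewrite inE => /eqP->.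
by rewrite inE => /andP[]; exists k.
Qed.

(** At least two neighbours in [K], phrased so that a neighbour different from a representative
    already in use can be chosen directly. *)
Definition two_Knbrs v := forall k0, exists k, [/\ k \in K, k != k0 & G v k].

Lemma two_KnbrsP v u w : v \in X -> u \in X -> w \in X -> u != v -> w != v -> u != w ->
  ~~ G v u -> ~~ G v w -> two_Knbrs v.
Proof.
move=> vX uX wX uv wv uw nu nw k0.
have : 1 < #|[set k in K | G v k]|.
  apply: (@nonnbr_le v [:: u; w]) => //=; first by rewrite inE uw.
  by move=> z; rewrite mem_seq2 => /orP[]/eqP->.
rewrite (cardsD1 k0) => h.
have : 0 < #|[set k in K | G v k] :\ k0| by move: h; case: (_ \in _) => /=; lia.
by case/card_gt0P=> k; rewrite in_setD1 finset.in_set => /and3P[h1 h2 h3]; exists k.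
Qed.

Lemma two_Knbrs_or v : two_Knbrs v \/ exists k0, forall k, k \in K -> G v k -> k = k0.
Proof.
case: (boolP [forall k0, exists k, [&& k \in K, k != k0 & G v k]]) => h.
  by left=> k0; have /forallP/(_ k0)/existsP[k /and3P[]] := h; exists k.
right; move: h; rewrite negb_forall => /existsP[k0]; rewrite negb_exists => /forallP h.
exists k0 => k kK vk; apply/eqP; have := h k; rewrite kK vk andbT /=.
by rewrite negbK.
Qed.

(** The graph has at least four vertices, so a neighbourhood of at most two would separate [x] from
    some other vertex. *)
Lemma X_gt2 : 2 < #|X|.
Proof.
rewrite ltnNge; apply/negP => X2.
have [v vx vX] : exists2 v, v != x & v \notin X.
  have : #|[set x] :|: X| < #|[set: V]|.
    rewrite cardsT; apply: leq_trans (proj1 kc); rewrite ltnS.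
    by apply: leq_trans (leq_card_setU _ _) _; rewrite cards1 add1n ltnS.
  move=> lt; have : ~~ ([set: V] \subset [set x] :|: X).
    by apply: contraL lt => /subset_leq_card; rewrite leqNgt.
  by case/subsetPn=> v _; rewrite !inE negb_or => /andP[]; exists v; rewrite ?inE.
have := @cut_edge _ G [set x] X x v kc; rewrite ltnS X2 !inE eqxx adj_irr.
case=> // [|a [b [/set1P-> _ _ + h]]]; first by move: vX; rewrite inE.
by rewrite inE h.
Qed.

(** A system of distinct representatives: a matching of [a], [b], [c] into [K]. *)
Definition sdr3 a b c := exists k1 k2 k3,
  [/\ [/\ k1 \in K, k2 \in K & k3 \in K], [/\ k1 != k2, k1 != k3 & k2 != k3] &
      [/\ G a k1, G b k2 & G c k3]].

Lemma sdr3_swap a b c : sdr3 a b c -> sdr3 b a c.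
Proof.
case=> k1 [k2 [k3 [[h1 h2 h3] [n1 n2 n3] [g1 g2 g3]]]].
by exists k2, k1, k3; split=> //; split=> //; rewrite eq_sym.
Qed.

Lemma sdr3_rot a b c : sdr3 a b c -> sdr3 b c a.
Proof.
case=> k1 [k2 [k3 [[h1 h2 h3] [n1 n2 n3] [g1 g2 g3]]]].
by exists k2, k3, k1; split=> //; split=> //; rewrite eq_sym.
Qed.

Lemma grow_path (P : seq V -> Prop) (Y : {set V}) p0 :
  P p0 -> (forall p, P p -> uniq p /\ {subset p <= Y}) ->
  (forall p y, P p -> y \in Y -> y \notin p -> exists2 p', P p' & size p' = (size p).+1) ->
  exists2 p, P p & forall v, v \in Y -> v \in p.
Proof.
move=> Pp0 sub step; have [n] := ubnP (#|Y| - size p0).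
elim: n p0 Pp0 => // n IH p Pp lt.
have [Up pY] := sub p Pp.
case: (boolP (Y \subset p)) => [/fintype.subsetP h|]; first by exists p.
case/subsetPn=> y yY yp.
have sz : size p < #|Y|.
  rewrite -(card_uniqP Up); apply: proper_card; apply/properP; split.
    by apply/fintype.subsetP.
  by exists y.
have [p' Pp' sp'] := step p y Pp yY yp.
by apply: (IH p') => //; rewrite sp'; move: lt sz; clear; lia.
Qed.

(** * At least three non-neighbours of [x] *)

Section BigK.
Hypothesis K3 : 2 < #|K|.

Lemma K_third k1 k2 : exists k, [/\ k \in K, k != k1 & k != k2].
Proof.
have : 0 < #|K :\ k1 :\ k2|.
  have := cardsD1 k1 K; have := cardsD1 k2 (K :\ k1).
  by case: (_ \in _) => /=; case: (_ \in _) => /=; lia.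
by case/card_gt0P=> k; rewrite !in_setD1 => /and3P[h1 h2 h3]; exists k.
Qed.

(** König's theorem between [X] and [K]: after any two vertices are deleted an element of [K]
    survives, and an edge leaving the set of [x] and its neighbours must run from [X] to [K]. *)
Lemma matching3 : exists a b c, [/\ a \in X, b \in X & c \in X] /\
  [/\ a != b, a != c & b != c] /\ sdr3 a b c.
Proof.
pose e u k := [&& u \in X, k \in K & G u k].
have [] := @konig3 V x e.
- by move=> a b a' b' /and3P[aX _ _] /and3P[_ bK _]; apply: XnK.
(* [x] is kept even if it is one of the two vertices, since it has to remain as the starting
   point. *)
- move=> p q; pose C := [set p; q] :\ x.
  have C3 : #|C| < 3.
    apply: leq_ltn_trans (subset_leq_card (subsetDl _ _)) _.
    by rewrite cards2; case: (p != q).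
  have [k [kK kp kq]] := K_third p q.
  have xC : x \notin C by rewrite !inE eqxx.
  have kx : k != x by move: kK; rewrite inK => /andP[].
  have := @cut_edge _ G (x |: X) C x k kc C3.
  case=> //; first by rewrite !inE eqxx.
  + by move: kK; rewrite !inE => /andP[/negbTE-> ->].
  + by rewrite !inE (negbTE kp) (negbTE kq) andbF.
  move=> a [b [aX aC bX bC ab]].
  have bK : b \in K by move: bX; rewrite inK !inE negb_or.
  have ax : a != x by apply: contraTneq ab => ->; move: bK; rewrite inK => /andP[].
  have {}aX : a \in X by move: aX; rewrite !inE (negbTE ax).
  have bx : b != x by move: bK; rewrite inK => /andP[].
  exists a, b; rewrite /e aX bK ab; split=> //.
    by move: aC; rewrite !inE ax.
  by move: bC; rewrite !inE bx.
move=> a [b [c [k1 [k2 [k3 [U1 U2 /and3P[aX k1K g1] /and3P[bX k2K g2] /and3P[cX k3K g3]]]]]]].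
exists a, b, c; split=> //; move: U1 U2; rewrite /= !inE !negb_or !andbT.
move=> /andP[/andP[-> ->] ->] /andP[/andP[n1 n2] n3]; split=> //.
by exists k1, k2, k3.
Qed.

(** These three vertices are where the caterpillar passes from [X] to [K]: one of the three edges
    lies on the spine, the other two on the rim. *)
Definition good (p : seq V) :=
  [/\ 2 < size p, uniq p, {subset p <= X}, sorted G p &
      sdr3 (nth x p 0) (nth x p 1) (last x p)].

(** The insertion takes place after the second and before the last vertex, so the three represented
    vertices stay in place. *)
Lemma good_insert m1 a u v b y :
  good (m1 :: a ++ u :: v :: b) -> y \in X -> y \notin m1 :: a ++ u :: v :: b ->
  G y u -> G y v -> good (m1 :: a ++ u :: y :: v :: b).
Proof.
case=> _ U sub srt sdr yX ny yu yv.
have P : perm_eq (m1 :: a ++ u :: y :: v :: b) (y :: m1 :: a ++ u :: v :: b).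
  apply/seq.permP => f /=; rewrite !count_cat /=; clear; lia.
split.
- by rewrite (perm_size P) /= size_cat /=; lia.
- by rewrite (perm_uniq P) /= ny.
- by move=> z; rewrite (perm_mem P) inE => /orP[/eqP->|/sub].
- move: srt; rewrite /= !cat_path /= => /and3P[-> -> /andP[_ ->]].
  by rewrite GC yu yv.
- by move: sdr; rewrite /= !last_cat /=; case: a {U sub srt ny P}.
Qed.

(** If [y] has two neighbours in [K], it can become an end of the path; when it misses both ends, it
    is inserted or the path is rotated at a neighbour of [y]. If [y] has at most one neighbour in
    [K], it has at most one non-neighbour in [X] and fits into most gaps; only short paths have to
    be rearranged. *)
Lemma good_step p y z : good p -> y \in X -> y \notin p -> z \in p -> G y z ->
  exists2 p', good p' & size p' = (size p).+1.
Proof.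
case: p => [|m1 [|m2 [|m3 q]]]; try by case.
set p := (m1 :: _) => gp yX yp zp yz; have [_ U sub srt sdr] := gp.
have ml : last m3 q \in p by rewrite /p 2!in_cons mem_last !orbT.
have m1ml : m1 != last m3 q.
  have := U; rewrite /= inE negb_or -andbA => /and3P[_ + _].
  by apply: contraNneq => ->; apply: mem_last.
have ny u : u \in p -> y != u by apply: contraTneq => <-.
have m1X : m1 \in X by apply: sub; rewrite inE eqxx.
have m2X : m2 \in X by apply: sub; rewrite !inE eqxx orbT.
have m3X : m3 \in X by apply: sub; rewrite !inE eqxx !orbT.
have mlX : last m3 q \in X by apply: sub.
have my1 : y != m1 by apply: ny; rewrite inE eqxx.
have my2 : y != m2 by apply: ny; rewrite !inE eqxx orbT.
have my3 : y != m3 by apply: ny; rewrite !inE eqxx !orbT.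
have myl : y != last m3 q by apply: ny.
have [k1 [k2 [k3 [[k1K k2K k3K] [k12 k13 k23] [/= g1 g2 g3]]]]] := sdr.
have consG : G y m1 -> sdr3 y m1 (last m3 q) -> good (y :: p).
  move=> ym1 s; split=> //=; first by rewrite yp.
    by move=> u; rewrite inE => /orP[/eqP->|/sub].
  by move: srt; rewrite /= ym1.
have rconsG : G y (last m3 q) -> sdr3 m1 m2 y -> good (rcons p y).
  move=> yl s; split; rewrite ?last_rcons //.
  - by rewrite rcons_uniq yp.
  - by move=> u; rewrite mem_rcons inE => /orP[/eqP->|/sub].
  - by move: srt; rewrite /= => /and3P[-> -> h]; rewrite rcons_path h /= GC.
(* A vertex not adjacent to [y] sees every element of [K] that [y] misses, so a clash with
   the representative of [y] can be resolved by moving that vertex to a third element. *)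
have sdr_last a b k k' : a \in X -> y != a -> ~~ G y a -> k \in K -> k' \in K -> k != k' ->
    G a k -> G b k' -> (exists ky, [/\ ky \in K, ky != k' & G y ky]) -> sdr3 a b y.
  move=> aX ya nya kK k'K kk' ak bk' [ky [kyK kyk' yky]].
  case: (eqVneq ky k) => [E|N]; last first.
    by exists k, k', ky; split=> //; split=> //; rewrite eq_sym.
  have [k'' [hK h1 h2]] := K_third k k'.
  case: (boolP (G y k'')) => yk''.
    by exists k, k', k''; split=> //; split=> //; rewrite eq_sym.
  have ak'' : G a k'' by apply: (@star y).
  by exists k'', k', k; split=> //; [split=> //; rewrite eq_sym | rewrite -E].
case: (two_Knbrs_or y) => [two|[k0 one]].
  case: (boolP (G y m1)) => ym1.
    have [ky [kyK n1 yky]] := two k1.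
    case: (boolP (G y (last m3 q))) => yml.
      (* A clash with the representative of the last vertex is harmless: [y] is appended, and that
         vertex is no longer last. *)
      case: (eqVneq ky k3) => [E|n3].
        exists (rcons p y); last by rewrite size_rcons.
        by apply: rconsG => //; exists k1, k2, k3; split=> //; rewrite -E.
      by exists (y :: p) => //; apply: consG => //; exists ky, k1, k3; split.
    exists (y :: p) => //; apply: consG => //.
    apply: sdr3_swap; apply: sdr3_rot.
    by apply: (@sdr_last _ _ k3 k1) => //; rewrite eq_sym.
  have s12 : sdr3 m1 m2 y by apply: (@sdr_last _ _ k1 k2) => //; apply: two.
  case: (boolP (G y (last m3 q))) => yml.
    by exists (rcons p y); [apply: rconsG | rewrite size_rcons].
  have s13 : sdr3 m1 (last m3 q) y by apply: (@sdr_last _ _ k1 k3) => //; apply: two.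
  have [p1 [p2 Ep]] : exists p1 p2, p = p1 ++ z :: p2.
    by case/splitPr: zp => p1 p2; exists p1, p2.
  case/lastP: p1 Ep => [|p1 w] Ep.
    by case: Ep => E _; move: ym1; rewrite E yz.
  have El : last m3 q = last z p2.
    by have := congr1 (last x) Ep; rewrite last_cat.
  case: p2 Ep El => [|u p2] Ep El; first by move: yml; rewrite El yz.
  have wp : w \in p by rewrite Ep mem_cat mem_rcons inE eqxx.
  case: (boolP (G y w)) => yw.
    case: p1 Ep => [|m p1] Ep; first by case: Ep => E _; move: ym1; rewrite E yw.
    have Ep' : p = m :: p1 ++ w :: z :: u :: p2 by rewrite Ep cat_rcons.
    exists (m :: p1 ++ w :: y :: z :: u :: p2).
      by apply: good_insert => //; rewrite -Ep'.
    by have := congr1 size Ep'; rewrite /= !size_cat /=; clear; lia.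
  have wl : w != last m3 q.
    have := U; rewrite Ep cat_uniq => /and3P[_ /hasPn H _].
    have /H /= : last m3 q \in z :: u :: p2 by rewrite El mem_last.
    by apply: contraNneq => <-; rewrite mem_rcons inE eqxx.
  (* [y] misses both [w] and the last vertex, so these two are adjacent. Through this edge the
     segment from [z] to the end is reversed; [z] becomes the last vertex and [y] is appended to
     it. *)
  have Gwl : G w (last m3 q) by apply: (@nonadj_third y) => //; apply: ny.
  have [r Er lr] : exists2 r, z :: u :: p2 = rcons r (last m3 q) & last (last m3 q) (rev r) = z.
    exists (belast z (u :: p2)); first by rewrite El lastI.
    by rewrite /= rev_cons last_rcons.
  exists (p1 ++ w :: last m3 q :: rcons (rev r) y); last first.
    have := congr1 size Ep; rewrite cat_rcons Er /= !size_cat /= !size_rcons size_rev; clear; lia.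
  have P : perm_eq (p1 ++ w :: last m3 q :: rcons (rev r) y) (y :: p).
    apply/seq.permP => f; have := congr1 (count f) Ep.
    rewrite cat_rcons Er /= !count_cat /= -!cats1 !count_cat count_rev /=.
    clear; lia.
  have s1 : sorted G (rcons p1 w).
    by move: srt; rewrite Ep => /cat_sorted2[].
  have s2 : path G (last m3 q) (rev r).
    move: srt; rewrite Ep => /cat_sorted2[_]; rewrite Er => h.
    have : sorted G (rev (rcons r (last m3 q))).
      by rewrite rev_sorted (eq_sorted (e' := G)) // => a b; rewrite GC.
    by rewrite rev_rcons.
  split.
  - by rewrite (perm_size P).
  - by rewrite (perm_uniq P) /= yp.
  - by move=> v; rewrite (perm_mem P) inE => /orP[/eqP->|/sub].
  - by rewrite sorted_cat_cons s1 /= Gwl rcons_path s2 lr GC.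
  - rewrite last_cat /= last_rcons.
    (* If [w] is the first vertex, the old last vertex becomes the second; [s13] covers this case
       and [s12] the others. *)
    case: p1 Ep {wp P s1} => [|a [|b p1]] Ep /=.
    + by case: Ep => <-.
    + by case: Ep => <- <-.
    + by case: Ep => <- <-.
(* Two non-neighbours in [X] would give [y] two neighbours in [K], so [y] misses at most one vertex
   of the path. *)
have nn u v : u \in X -> v \in X -> y != u -> y != v -> ~~ G y u -> ~~ G y v -> u = v.
  move=> uX vX yu yv nu nv; apply/eqP; apply: contraT => uv.
  have := @two_KnbrsP y u v yX uX vX; rewrite eq_sym yu eq_sym yv uv => /(_ isT isT isT nu nv).
  by move=> /(_ k0)[k [kK + yk]]; rewrite (one k kK yk) eqxx.
have oth u v : u \in p -> v \in p -> ~~ G y u -> v != u -> G y v.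
  move=> up vp nu vu; apply: contraT => nv.
  by move: vu; rewrite (nn v u) ?eqxx ?ny ?sub.
have in1 : m1 \in p by rewrite !inE eqxx.
have in2 : m2 \in p by rewrite !inE eqxx ?orbT.
have in3 : m3 \in p by rewrite !inE eqxx ?orbT.
have [d12 d13 d23] : [/\ m1 != m2, m1 != m3 & m2 != m3].
  by have := U; rewrite /= !inE !negb_or => /and3P[/and3P[-> -> _] /andP[-> _] _].
have [g12 g23] : G m1 m2 /\ G m2 m3 by have := srt; rewrite /= => /and3P[].
case: (boolP (G y m2)) => ym2; last first.
  have ym1 := oth _ _ in2 in1 ym2 d12.
  have ym3 : G y m3 by apply: oth ym2 _; rewrite // eq_sym.
  case: q @p gp yp zp U sub srt sdr ml m1ml ny mlX myl g3 consG rconsG oth in1 in2 in3.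
    move=> p gp yp zp U sub srt sdr ml m1ml ny mlX myl g3 consG rconsG oth in1 in2 in3.
    exists [:: m2; m1; y; m3] => //; split=> //=.
    - by rewrite !inE !negb_or (eq_sym m2) d12 d23 d13 my3 (eq_sym m2) my2 (eq_sym m1) my1.
    - by move=> u; rewrite mem_seq4 => /or4P[]/eqP->.
    - by rewrite GC g12 GC ym1 ym3.
    - exact: sdr3_swap.
  move=> m4 q p gp yp zp U sub srt sdr ml m1ml ny mlX myl g3 consG rconsG oth in1 in2 in3.
  have ym4 : G y m4.
    apply: (oth m2) => //; first by rewrite !inE eqxx !orbT.
    have := U; rewrite /= !inE !negb_or => /and3P[_ /and3P[_ + _] _].
    by rewrite eq_sym.
  exists [:: m1, m2, m3, y, m4 & q] => //.
  exact: (@good_insert m1 [:: m2] m3 m4 q y).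
case: (boolP (G y m3)) => ym3.
  by exists [:: m1, m2, y, m3 & q] => //; apply: (@good_insert m1 [::] m2 m3 q y).
have ym1 := oth _ _ in3 in1 ym3 d13.
have [k0K yk0] : k0 \in K /\ G y k0.
  have [k kK yk] : exists2 k, k \in K & G y k by apply: (@has_Knbr y m3); rewrite // eq_sym.
  by rewrite -(one k kK yk).
have m3k k : k \in K -> k != k0 -> G m3 k.
  move=> kK kk; apply: (@star y) => //.
  by apply: contra kk => yk; rewrite (one k kK yk).
case: q @p gp yp zp U sub srt sdr ml m1ml ny mlX myl g3 consG rconsG oth in1 in2 in3.
  move=> p gp yp zp U sub srt sdr ml m1ml ny mlX myl g3 consG rconsG oth in1 in2 in3.
  exists [:: m3; m2; y; m1] => //; split=> //=.
  - by rewrite !inE !negb_or (eq_sym m3) d23 (eq_sym m3) my3 (eq_sym m3) d13 (eq_sym m2) my2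
      (eq_sym m2) d12 my1.
  - by move=> u; rewrite mem_seq4 => /or4P[]/eqP->.
  - by rewrite GC g23 GC ym2 ym1.
  - by apply: sdr3_swap; apply: sdr3_rot.
move=> m4 q p gp yp zp U sub srt sdr ml m1ml ny mlX myl g3 consG rconsG oth in1 in2 in3.
have in4 : m4 \in p by rewrite !inE eqxx !orbT.
have d43 : m4 != m3.
  by have := U; rewrite /= !inE !negb_or => /and4P[_ _ /andP[+ _] _]; rewrite eq_sym.
have ym4 := oth _ _ in3 in4 ym3 d43.
case: q @p gp yp zp U sub srt sdr ml m1ml ny mlX myl g3 consG rconsG oth in1 in2 in3 in4.
  move=> p gp yp zp U sub srt sdr ml m1ml ny mlX myl g3 consG rconsG oth in1 in2 in3 in4.
  have P1 : perm_eq [:: m3; m2; m1; y; m4] (y :: p) by apply/seq.permP => f /=; clear; lia.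
  have P2 : perm_eq [:: m4; y; m1; m2; m3] (y :: p) by apply/seq.permP => f /=; clear; lia.
  (* The path is rearranged so that [m3], which sees all of [K] except possibly [k0], becomes an
     end. The spare element [k] represents [y] if it is [k0], and [m3] otherwise. *)
  have [k [kK n2 n3]] := K_third k2 k3.
  case: (eqVneq k k0) => [E|N].
    exists [:: m4; y; m1; m2; m3] => //; split=> //.
    - by rewrite (perm_uniq P2) /= yp.
    - by move=> u; rewrite (perm_mem P2) inE => /orP[/eqP->|/sub].
    - by rewrite /= GC ym4 ym1 g12 g23.
    - exists k3, k0, k2; split=> //=; first by rewrite -E (eq_sym k3) n3 n2 eq_sym.
      by split=> //; apply: m3k; rewrite // -E eq_sym.
  exists [:: m3; m2; m1; y; m4] => //; split=> //.
  - by rewrite (perm_uniq P1) /= yp.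
  - by move=> u; rewrite (perm_mem P1) inE => /orP[/eqP->|/sub].
  - by rewrite /= GC g23 GC g12 GC ym1 ym4.
  - by exists k, k2, k3; split=> //; split=> //; apply: m3k.
move=> m5 q p gp yp zp U sub srt sdr ml m1ml ny mlX myl g3 consG rconsG oth in1 in2 in3 in4.
have ym5 : G y m5.
  apply: (oth m3) => //; first by rewrite !inE eqxx !orbT.
  by have := U; rewrite /= !inE !negb_or => /and4P[_ _ /and3P[_ + _] _]; rewrite eq_sym.
exists [:: m1, m2, m3, m4, y, m5 & q] => //.
exact: (@good_insert m1 [:: m2; m3] m4 m5 q y).
Qed.

(** Connectedness of the graph induced on [X], in the form of an edge across every cut. *)
Definition connX := forall (A : {set V}) a0 b0, A \subset X -> a0 \in A -> b0 \in X ->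
  b0 \notin A -> exists a b, [/\ a \in A, b \in X, b \notin A & G a b].

(** Of three vertices with distinct representatives two are adjacent. A path from the third is led
    to this edge, and the end of the edge that it reaches becomes the second vertex. *)
Lemma good_base : connX -> exists p, good p.
Proof.
move=> con; have [a [b [c [[aX bX cX] [[ab ac bc] sd]]]]] := matching3.
suff H s1 s2 s3 : s1 \in X -> s2 \in X -> s3 \in X -> s3 != s1 -> s3 != s2 ->
    G s1 s2 -> sdr3 s1 s2 s3 -> exists p, good p.
  case/or3P: (a2 ab ac bc) => g.
  - by apply: (H a b c) => //; rewrite eq_sym.
  - apply: (H a c b) => //; first by rewrite eq_sym.
    by apply: sdr3_swap; apply: sdr3_rot; apply: sdr3_rot.
  - by apply: (H b c a) => //; apply: sdr3_rot.
move=> s1X s2X s3X s31 s32 g12 sd123.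
pose F := X :\ s1 :\ s2.
pose e u v := [&& u \in F, v \in F & G u v].
have s3F : s3 \in F by rewrite !in_setD1 s32 s31.
have closed p u : path e s3 p -> u \in s3 :: p -> u \in F.
  move=> pp; rewrite in_cons => /orP[/eqP->//|].
  elim: p s3 {s3X s31 s32 sd123 s3F} pp => //= w p IH s3 /andP[/and3P[_ wF _] pp].
  by rewrite in_cons => /orP[/eqP->//|]; apply: IH pp.
have FX u : u \in F -> [/\ u \in X, u != s1 & u != s2].
  by rewrite !in_setD1 => /and3P[h1 h2 h3].
(* The component of [s3] in [X] without [s1] and [s2]; an edge of [X] leaving it can only lead to
   [s1] or [s2]. *)
pose D := [set u | connect e s3 u].
have DF u : u \in D -> u \in F.
  by rewrite inE => /connectP[p pp ->]; apply: closed pp _; rewrite mem_last.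
have s1D : s1 \notin D by apply/negP => /DF/FX[_]; rewrite eqxx.
have [||a' [b' [aD bX' bD gab]]] := con D s3 s1 _ _ s1X s1D.
- by apply/fintype.subsetP => u /DF/FX[].
- by rewrite inE connect0.
have bs : b' = s1 \/ b' = s2.
  suff /orP[/eqP|/eqP] : (b' == s1) || (b' == s2) by [left | right].
  apply: contraNT bD; rewrite negb_or => /andP[n1 n2].
  have bF : b' \in F by rewrite !in_setD1 n1 n2.
  have aF := DF _ aD; move: aD; rewrite !inE => aD; apply: connect_trans aD (connect1 _).
  by rewrite /e bF gab aF.
have [w [wX wb wg sw3 ws3]] : exists w, [/\ w \in X, w != b', G w b', sdr3 w b' s3 &
    (forall u, u \in F -> u != w /\ u != b')].
  case: bs => ->.
    exists s2; split=> //; [by rewrite eq_sym adj_neq|by rewrite GC|exact: sdr3_swap|].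
    by move=> u /FX[].
  by exists s1; split=> //; [exact: adj_neq|move=> u /FX[]].
have /connectP[p0 pp0 la] : connect e s3 a' by move: aD; rewrite inE.
case/shortenP: pp0 la => p pp Up _ la.
have pF u : u \in s3 :: p -> u \in F by apply: closed.
exists (w :: b' :: rev (s3 :: p)); split.
- by rewrite /= size_rev.
- rewrite /= rev_uniq Up andbT in_cons !mem_rev negb_or wb /=.
  by apply/andP; split; apply/negP => /pF/ws3[]; rewrite eqxx.
- by move=> u; rewrite !in_cons mem_rev => /or3P[/eqP->|/eqP->|/pF/FX[]].
- rewrite /= wg lastI rev_rcons /= -la GC gab /=.
  have h : sorted G (rev (s3 :: p)).
    rewrite rev_sorted /=; apply: sub_path pp => u v /and3P[_ _]; by rewrite GC.
  by move: h; rewrite lastI rev_rcons -la.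
- by rewrite /= rev_cons last_rcons.
Qed.

Lemma good_cover : connX -> exists p, good p /\ forall v, v \in X -> v \in p.
Proof.
move=> con; have [p0 gp0] := good_base con.
have [|p y gp yX yp|p gp cov] := grow_path (P := good) (Y := X) gp0; last by exists p.
  by move=> p [].
have [_ _ pX _ _] := gp.
have hp : nth x p 0 \in p by apply: mem_nth; case: gp; case: (size p).
have [|||a [b [ap bX bp gab]]] := con [set u in p] (nth x p 0) y _ _ yX.
- by apply/fintype.subsetP => u; rewrite inE => /pX.
- by rewrite inE.
- by rewrite inE.
move: ap bp; rewrite !inE => ap bp.
by apply: (good_step gp bX bp ap); rewrite GC.
Qed.

Lemma clique_path (A : {set V}) a b l : clique G A -> a \in A -> b \in A -> a != b ->
  a \in l -> b \in l -> path G a (rcons (rest A l) b).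
Proof.
move=> cA aA bA ab al bl; apply: (@clique_sorted _ _ (a :: rcons (rest A l) b)).
  rewrite /= mem_rcons inE negb_or ab rcons_uniq rest_uniq !mem_rest al bl.
  by rewrite !andbF.
have h u : u \in a :: rcons (rest A l) b -> u \in A.
  rewrite in_cons mem_rcons in_cons mem_rest => /or3P[/eqP->//|/eqP->//|/andP[]//].
by move=> u v /h uA /h vA; apply: cA.
Qed.

(** For a long path the first vertex joins the spine, and the rim follows the path from its last
    vertex back to the second, crosses to [k2], exhausts [K] and returns from [k3] to the last
    vertex. *)
Lemma conn_caterpillar : connX -> has_caterpillar G.
Proof.
move=> con; have [p [[sz U pX srt sd] cov]] := good_cover con.
have cp v : count_mem v p = (v \in X).
  by rewrite count_mem_uniq //; congr nat_of_bool; apply/idP/idP; [apply: pX | apply: cov].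
case: p sz U pX srt sd cov cp => [|m1 [|m2 [|m3 q]]] // _ U pX srt sd cov cp.
have [k1 [k2 [k3 [[k1K k2K k3K] [k12 k13 k23] [/= g1 g2 g3]]]]] := sd.
have Uk : uniq [:: k1; k2; k3] by rewrite /= !inE negb_or k12 k13 k23.
have subK : {subset [:: k1; k2; k3] <= K}.
  by move=> u; rewrite mem_seq3 => /or3P[]/eqP->.
set r := rest K [:: k1; k2; k3].
have cK v : _ := count_rest v Uk subK.
have rK v : v \in r -> [/\ v \in K, v != k1, v != k2 & v != k3].
  by rewrite mem_rest mem_seq3 !negb_or => /andP[-> /and3P[]].
have m1X : m1 \in X by apply: pX; rewrite !inE eqxx.
have m2X : m2 \in X by apply: pX; rewrite !inE eqxx ?orbT.
have m3X : m3 \in X by apply: pX; rewrite !inE eqxx ?orbT.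
have gx v : v \in X -> G v x by rewrite inX GC.
case/lastP: q U pX srt sd cov cp g3 => [|q ml] U pX srt sd cov cp g3.
  (* On a path of three vertices [x] would keep only one leaf. So the middle vertex and [k2] form
     the spine, and [x] joins the rim between [m1] and [m3]. *)
  apply: (@caterpillar2 _ _ m2 k2 [:: x; m3] (k3 :: rcons r k1) m1) => //.
  - move=> v; have := xXK v; have := cp v; have := cK v.
    by rewrite /= -/r -!cats1 !count_cat /=; clear; count_lia.
  - rewrite /= GC gx // g3 /=; apply: clique_path => //; rewrite ?inE ?eqxx ?orbT //.
    + exact: Kclique.
    + by rewrite eq_sym.
  - by rewrite /= size_rcons.
  - exact: gx.
  - by rewrite /= last_rcons GC.
  - move: srt; rewrite /= => /and3P[h1 h2 _] v; rewrite mem_seq3.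
    by case/or3P=> /eqP-> //; rewrite GC // gx.
  - move=> v; rewrite in_cons mem_rcons in_cons => /or3P[/eqP->|/eqP->|/rK[vK _ n _]];
      by apply: KG => //; rewrite eq_sym.
move: g3; rewrite last_rcons => g3.
move: srt; rewrite /= rcons_path => /and4P[h1 h2 h3 h4].
apply: (@caterpillar3 _ _ x m1 k1 (rev (m3 :: q)) [:: m2] (k2 :: rcons r k3) ml) => //.
- move=> v; have := xXK v; have := cp v; have := cK v.
  by rewrite rev_cons /= -/r -!cats1 /= !count_cat count_rev /= !count_cat /=; clear; count_lia.
- by rewrite GC gx.
- rewrite -[rev _ ++ _]/(rev (m3 :: q) ++ m2 :: (k2 :: rcons r k3)) sorted_cat_cons.
  rewrite -rev_cons rev_sorted /= g2.
  rewrite (@eq_path _ (fun u => G^~ u) G); last by move=> u v; rewrite GC.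
  rewrite GC h2 h3 /=; apply: clique_path => //; rewrite ?inE ?eqxx ?orbT //.
  exact: Kclique.
- by rewrite size_rev.
- by rewrite /= size_rcons.
- by rewrite lastI rev_rcons /= GC.
- by rewrite /= last_rcons GC.
- move=> v; rewrite in_cons mem_rev => h; apply: gx; apply: pX.
  by rewrite 2!in_cons -rcons_cons mem_rcons in_cons h !orbT.
- by move=> v; rewrite mem_seq1 => /eqP->; rewrite GC.
- move=> v; rewrite in_cons mem_rcons in_cons => /or3P[/eqP->|/eqP->|/rK[vK n _ _]];
    by apply: KG => //; rewrite eq_sym.
Qed.

(** * Disconnected neighbourhood: [X] as two cliques *)

Definition split_X (Y1 Y2 : {set V}) :=
  (forall v, (v \in Y1) + (v \in Y2) = (v \in X)) /\
  (forall u v, u \in Y1 -> v \in Y2 -> ~~ G u v).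

Lemma split_sym Y1 Y2 : split_X Y1 Y2 -> split_X Y2 Y1.
Proof. by case=> h1 h2; split=> [v|u v uY vY]; [rewrite addnC | rewrite GC h2]. Qed.

Lemma split_sub Y1 Y2 v : split_X Y1 Y2 -> v \in Y1 -> v \in X.
Proof. by case=> /(_ v) + _ => + vY; rewrite vY; case: (v \in X) => //; case: (v \in Y2). Qed.

Lemma split_neq Y1 Y2 u v : split_X Y1 Y2 -> u \in Y1 -> v \in Y2 -> u != v.
Proof.
case=> h _ uY vY; apply: contraTneq vY => <-; have := h u; rewrite uY.
by case: (u \in Y2) => //; case: (u \in X).
Qed.

Lemma split_clique Y1 Y2 e : split_X Y1 Y2 -> e \in Y2 -> clique G Y1.
Proof.
move=> sp eY a b aY bY ab.
have [_ h] := sp.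
by apply: (@nonadj_third e) => //; rewrite 1?eq_sym ?(split_neq sp) // GC h.
Qed.

Definition complete_to (Y : {set V}) k := [forall v in Y, G v k].

Lemma complete_toP Y k v : complete_to Y k -> v \in Y -> G v k.
Proof. by move=> /forall_inP; apply. Qed.

Lemma split_complete Y1 Y2 k : split_X Y1 Y2 -> k \in K -> complete_to Y1 k || complete_to Y2 k.
Proof.
move=> sp kK; case: (boolP (complete_to Y1 k)) => //= /forall_inPn[u uY nu].
apply/forall_inP => v vY; apply: (@star u) => //.
- exact: split_sub sp uY.
- exact: split_sub (split_sym sp) vY.
- exact: split_neq sp uY vY.
- by case: sp => _; apply.
Qed.

Lemma gxX v : v \in X -> G v x. Proof. by rewrite inX GC. Qed.

Lemma clique_X (Y : {set V}) (l : seq V) : clique G Y -> {subset Y <= X} -> uniq l ->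
  (forall u, u \in l -> (u \in Y) || (u == x)) -> sorted G l.
Proof.
move=> cY sub U h; apply: clique_sorted => // a b /h/orP[aY|/eqP->] /h/orP[bY|/eqP->].
- exact: cY.
- by move=> _; apply/gxX/sub.
- by move=> _; rewrite GC; apply/gxX/sub.
- by rewrite eqxx.
Qed.

Lemma clique_K (Y : {set V}) k (l : seq V) : clique G Y -> complete_to Y k -> uniq l ->
  (forall u, u \in l -> (u \in Y) || (u == k)) -> sorted G l.
Proof.
move=> cY cp U h; apply: clique_sorted => // a b /h/orP[aY|/eqP->] /h/orP[bY|/eqP->].
- exact: cY.
- by move=> _; apply: complete_toP cp _.
- by move=> _; rewrite GC; apply: complete_toP cp _.
- by rewrite eqxx.
Qed.

(** The rim runs round the ring of cliques: [s'] and the rest of [Y1], then [x], then [Y2] up to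
    [e], then [k''], the rest of [K] and [k'], which returns to [s']. Of the spine, [s] sees [Y1]
    and [x], while [k] sees [Y2] and [K]. *)
Lemma double_star Y1 Y2 s s' e k k' k'' : split_X Y1 Y2 ->
  s \in Y1 -> s' \in Y1 -> s != s' -> e \in Y2 ->
  k \in K -> k' \in K -> k'' \in K -> k != k' -> k != k'' -> k' != k'' ->
  complete_to Y2 k -> G s k -> G s' k' -> G e k'' -> has_caterpillar G.
Proof.
move=> sp sY s'Y ss eY kK k'K k''K n1 n2 n3 cp sk s'k' ek''.
have c1 := split_clique sp eY; have c2 := split_clique (split_sym sp) sY.
have sub1 : {subset Y1 <= X} by move=> v; apply: split_sub sp.
have sub2 : {subset Y2 <= X} by move=> v; apply: split_sub (split_sym sp).
have Us : uniq [:: s; s'] by rewrite /= inE ss.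
have Uk : uniq [:: k; k'; k''] by rewrite /= !inE negb_or n1 n2 n3.
have s1 : {subset [:: s; s'] <= Y1} by move=> u; rewrite mem_seq2 => /orP[]/eqP->.
have s2 : {subset [:: e] <= Y2} by move=> u; rewrite mem_seq1 => /eqP->.
have s3 : {subset [:: k; k'; k''] <= K} by move=> u; rewrite mem_seq3 => /or3P[]/eqP->.
set r1 := rest Y1 [:: s; s']; set r2 := rest Y2 [:: e]; set r3 := rest K [:: k; k'; k''].
have xn (Y : {set V}) : {subset Y <= X} -> x \notin Y.
  by move=> sub; apply/negP => /sub; rewrite inX adj_irr.
have m1 v : v \in r1 -> [/\ v \in Y1, v != s & v != s'].
  by rewrite mem_rest mem_seq2 negb_or => /andP[-> /andP[]].
have m2 v : v \in r2 -> v \in Y2 by rewrite mem_rest => /andP[].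
have m3 v : v \in r3 -> [/\ v \in K & v != k].
  by rewrite mem_rest mem_seq3 !negb_or => /andP[-> /and3P[]].
have hl0 : head s' (r1 ++ [:: x]) \in r1 ++ [:: x].
  by case: (r1) => [|a t] /=; rewrite inE eqxx.
apply: (@caterpillar2 _ _ s k (r1 ++ [:: x]) (r2 ++ e :: k'' :: rcons r3 k') s') => //.
- move=> v; have := xXK v; have [/(_ v) + _] := sp.
  have := count_rest v Us s1; have := count_rest v (isT : uniq [:: e]) s2.
  have := count_rest v Uk s3; rewrite -/r1 -/r2 -/r3 -!cats1 /= !count_cat /= !count_cat /=.
  by clear; count_lia.
- rewrite -!catA /= sorted_cat_cons -cat_rcons cat_path last_rcons /= ek''.
  apply/and3P; split.
  + apply: (clique_X c1 sub1).
      rewrite rcons_uniq rest_uniq andbT; apply/negP => /m1[h _ _].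
      by move: (xn _ sub1); rewrite h.
    by move=> u; rewrite mem_rcons in_cons orbC => /orP[/m1[->]|->]; rewrite ?orbT.
  + apply: (@clique_X _ (x :: rcons r2 e) c2 sub2).
      have ne : e \notin r2 by rewrite mem_rest mem_seq1 eqxx andbF.
      rewrite /= mem_rcons in_cons negb_or rcons_uniq rest_uniq ne !andbT.
      apply/andP; split; first by apply: contraTneq eY => <-; apply: xn.
      by apply: contra (xn _ sub2) => /m2.
    move=> u; rewrite in_cons mem_rcons in_cons => /or3P[->|/eqP->|/m2->] //.
      by rewrite orbT.
    by rewrite eY.
  + apply: clique_path => //; rewrite ?inE ?eqxx ?orbT //; first exact: Kclique.
    by rewrite eq_sym.
- by rewrite size_cat addn1.
- by rewrite size_cat /= size_rcons; clear; lia.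
- move: hl0; rewrite mem_cat mem_seq1 => /orP[/m1[h _ h']|/eqP->].
    by apply: c1; rewrite // eq_sym.
  by apply/gxX/sub1.
- by rewrite last_cat /= last_rcons GC.
- move=> v; rewrite in_cons mem_cat mem_seq1 => /or3P[/eqP->|/m1[h h' _]|/eqP->].
  + by apply: c1; rewrite // eq_sym.
  + exact: c1.
  + by rewrite GC; apply/gxX/sub1.
- move=> v; rewrite mem_cat !in_cons mem_rcons in_cons.
  case/or4P=> [/m2 h|/eqP->|/eqP->|/orP[/eqP->|/m3[h1 h2]]].
  + exact: complete_toP cp h.
  + exact: complete_toP cp eY.
  + by apply: KG; rewrite // eq_sym.
  + by apply: KG; rewrite // eq_sym.
  + exact: KG.
Qed.

(** Two vertices of [K] complete to each part: [k1] and [k2] continue the spine after [s], while [a]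
    carries the rim from [Y1] into [K] and [b] from [K] into [Y2]; [x] closes it. *)
Lemma triple_star Y1 Y2 s s' e k1 a k2 b : split_X Y1 Y2 ->
  s \in Y1 -> s' \in Y1 -> s != s' -> e \in Y2 ->
  k1 \in K -> a \in K -> k2 \in K -> b \in K -> uniq [:: k1; a; k2; b] ->
  complete_to Y1 k1 -> complete_to Y1 a -> complete_to Y2 k2 -> complete_to Y2 b ->
  has_caterpillar G.
Proof.
move=> sp sY s'Y ss eY k1K aK k2K bK Uk ck1 ca ck2 cb.
have c1 := split_clique sp eY; have c2 := split_clique (split_sym sp) sY.
have sub1 : {subset Y1 <= X} by move=> v; apply: split_sub sp.
have sub2 : {subset Y2 <= X} by move=> v; apply: split_sub (split_sym sp).
have Us : uniq [:: s; s'] by rewrite /= inE ss.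
have s1 : {subset [:: s; s'] <= Y1} by move=> u; rewrite mem_seq2 => /orP[]/eqP->.
have s2 : {subset [:: e] <= Y2} by move=> u; rewrite mem_seq1 => /eqP->.
have s3 : {subset [:: k1; a; k2; b] <= K}.
  by move=> u; rewrite mem_seq4 => /or4P[]/eqP->.
set r1 := rest Y1 [:: s; s']; set r2 := rest Y2 [:: e].
set r3 := rest K [:: k1; a; k2; b].
have m1 v : v \in r1 -> [/\ v \in Y1, v != s & v != s'].
  by rewrite mem_rest mem_seq2 negb_or => /andP[-> /andP[]].
have m2 v : v \in r2 -> v \in Y2 by rewrite mem_rest => /andP[].
have m3 v : v \in r3 -> [/\ v \in K & v != k1].
  by rewrite mem_rest mem_seq4 !negb_or => /andP[-> /and4P[]].
have [ak1 ab k12 k2b] : [/\ a != k1, a != b, k1 != k2 & b != k2].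
  move: Uk; rewrite /= !inE !negb_or => /and4P[/and3P[h1 h2 h3] /andP[h4 h5] h6 _].
  by split; rewrite // eq_sym.
have YK (Y : {set V}) u k : {subset Y <= X} -> k \in K -> u \in Y -> u != k.
  by move=> sub kK /sub uX; apply: XnK.
apply: (@caterpillar3 _ _ s k1 k2 (s' :: r1) (a :: r3) (b :: rcons r2 e) x) => //.
- move=> v; have := xXK v; have [/(_ v) + _] := sp.
  have := count_rest v Us s1; have := count_rest v (isT : uniq [:: e]) s2.
  have := count_rest v Uk s3.
  rewrite -/r1 -/r2 -/r3 -!cats1 /= !count_cat /= !count_cat /= !count_cat /=.
  by clear; count_lia.
- exact: complete_toP ck1 sY.
- exact: KG.
- rewrite /= -!cat_rcons cat_path last_rcons cat_path last_rcons.
  apply/and3P; split.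
  + apply: (@clique_K _ a (s' :: rcons r1 a) c1 ca).
      have ne : s' \notin r1 by rewrite mem_rest mem_seq2 eqxx orbT andbF.
      rewrite /= mem_rcons in_cons negb_or rcons_uniq rest_uniq ne (YK _ _ _ sub1) //= andbT.
      by apply/negP => /m1[h _ _]; have := YK _ _ _ sub1 aK h; rewrite eqxx.
    move=> u; rewrite in_cons mem_rcons in_cons => /or3P[/eqP->|->|/m1[->]] //.
      by rewrite s'Y.
    by rewrite orbT.
  + apply: clique_path => //; rewrite ?inE ?eqxx ?orbT //; exact: Kclique.
  + apply: (@clique_K _ b (b :: rcons r2 e) c2 cb).
      have ne : e \notin r2 by rewrite mem_rest mem_seq1 eqxx andbF.
      rewrite /= mem_rcons in_cons negb_or rcons_uniq rest_uniq ne eq_sym (YK _ _ _ sub2) //= andbT.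
      by apply/negP => /m2 h; have := YK _ _ _ sub2 bK h; rewrite eqxx.
    move=> u; rewrite in_cons mem_rcons in_cons => /or3P[->|/eqP->|/m2->] //.
      by rewrite orbT.
    by rewrite eY.
- by rewrite /= size_rcons.
- by rewrite /= GC; apply/gxX/sub1.
- by rewrite /= last_rcons; apply/gxX/sub2.
- move=> v; rewrite !in_cons => /or3P[/eqP->|/eqP->|/m1[h h' _]].
  + by rewrite GC; apply/gxX/sub1.
  + by apply: c1; rewrite // eq_sym.
  + exact: c1.
- move=> v; rewrite in_cons => /orP[/eqP->|/m3[h1 h2]]; exact: KG.
- move=> v; rewrite in_cons mem_rcons in_cons => /or3P[/eqP->|/eqP->|/m2 h].
  + exact: KG.
  + exact: complete_toP ck2 eY.
  + exact: complete_toP ck2 h.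
Qed.

Lemma split_two_Knbrs Y1 Y2 s s' e : split_X Y1 Y2 ->
  s \in Y1 -> s' \in Y1 -> s != s' -> e \in Y2 -> two_Knbrs e.
Proof.
move=> sp sY s'Y ss eY; have sp' := split_sym sp; have [_ h] := sp'.
apply: (@two_KnbrsP e s s') => //; try exact: h; try exact: split_neq sp _ eY.
- exact: split_sub sp' eY.
- exact: split_sub sp sY.
- exact: split_sub sp s'Y.
Qed.

(** All vertices of [K] but at most one are complete to [Y1], so [double_star] applies with the two
    parts exchanged. *)
Lemma split_one Y1 Y2 s s' e e' : split_X Y1 Y2 ->
  s \in Y1 -> s' \in Y1 -> s != s' -> e \in Y2 -> e' \in Y2 -> e != e' ->
  (forall k k', k \in K -> k' \in K -> complete_to Y2 k -> complete_to Y2 k' -> k = k') ->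
  has_caterpillar G.
Proof.
move=> sp sY s'Y ss eY e'Y ee one.
have sp' := split_sym sp.
have te := split_two_Knbrs sp sY s'Y ss eY; have te' := split_two_Knbrs sp sY s'Y ss e'Y.
(* The exceptional vertex [b], if there is one, is complete to [Y2] and serves on the rim as the
   neighbour of [e']; the spine uses another neighbour of [e]. *)
case: (boolP [exists b in K, complete_to Y2 b]) => [/exists_inP[b bK cb]|none].
  have C1 k : k \in K -> k != b -> complete_to Y1 k.
    move=> kK kb; case/orP: (split_complete sp kK) => // c.
    by move: kb; rewrite (one k b) ?eqxx.
  have [k [kK kb ek]] := te b; have [k'' [k''K n1 n2]] := K_third k b.
  apply: (@double_star Y2 Y1 e e' s k b k'') => //; try by rewrite eq_sym.
  + exact: C1.
  + exact: complete_toP cb e'Y.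
  + by apply: complete_toP (C1 _ _ _) sY.
have C1 k : k \in K -> complete_to Y1 k.
  move=> kK; case/orP: (split_complete sp kK) => // c.
  by case/negP: none; apply/exists_inP; exists k.
have [k [kK _ ek]] := te x; have [k' [k'K n0 e'k']] := te' k.
have [k'' [k''K n1 n2]] := K_third k k'.
apply: (@double_star Y2 Y1 e e' s k k' k'') => //; try by rewrite eq_sym.
  exact: C1.
by apply: complete_toP (C1 _ _) sY.
Qed.

(** At most one of the three edges of [matching3] is lost, the one at the only vertex of [Y2]. *)
Lemma split_matching Y1 Y2 e : split_X Y1 Y2 -> (forall v, v \in Y2 -> v = e) ->
  exists s s' k k', [/\ s \in Y1, s' \in Y1 & s != s'] /\
    [/\ k \in K, k' \in K, k != k', G s k & G s' k'].
Proof.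
move=> [h _] one.
have [a [b [c [[aX bX cX] [[ab ac bc]
  [k1 [k2 [k3 [[k1K k2K k3K] [k12 k13 k23] [g1 g2 g3]]]]]]]]]] := matching3.
have Y v : v \in X -> v != e -> v \in Y1.
  move=> vX ve; have := h v; rewrite vX; case: (v \in Y1) => //.
  by case vY: (v \in Y2) => //; move: ve; rewrite (one v vY) eqxx.
case: (eqVneq a e) => [E|na].
  exists b, c, k2, k3; split=> //; split=> //; apply: Y => //; by rewrite -E eq_sym.
case: (eqVneq b e) => [E|nb].
  exists a, c, k1, k3; split=> //; split=> //; apply: Y => //; by rewrite -E eq_sym.
by exists a, b, k1, k2; split=> //; split=> //; apply: Y.
Qed.

(** Every vertex of [K] is complete to [Y1], to [Y2] or to both. Among three of them either two have
    the same one-sided type, or one is complete to both and the other two supply a vertex for each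
    part. *)
Lemma split_caterpillar Y1 Y2 s s' e : split_X Y1 Y2 ->
  s \in Y1 -> s' \in Y1 -> s != s' -> e \in Y2 -> has_caterpillar G.
Proof.
move=> sp sY s'Y ss eY; have sp' := split_sym sp.
have both k0 u v : k0 \in K -> u \in K -> v \in K -> k0 != u -> k0 != v -> u != v ->
    complete_to Y1 k0 -> complete_to Y2 k0 -> complete_to Y1 u -> complete_to Y2 v ->
    has_caterpillar G.
  move=> h1 h2 h3 n1 n2 n3 c1 c2 cu cv.
  apply: (@double_star Y1 Y2 s s' e k0 u v) => //.
  + exact: complete_toP c1 sY.
  + exact: complete_toP cu s'Y.
  + exact: complete_toP cv eY.
have other : (forall v, v \in Y2 -> v = e) \/ exists2 e', e' \in Y2 & e != e'.
  case: (boolP [exists v in Y2, e != v]) => [/exists_inP[v vY ev]|]; first by right; exists v.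
  by rewrite negb_exists_in => /forall_inP h; left=> v /h; rewrite negbK => /eqP.
have only1 u v : u \in K -> v \in K -> u != v -> complete_to Y1 u -> ~~ complete_to Y2 u ->
    complete_to Y1 v -> ~~ complete_to Y2 v -> has_caterpillar G.
  move=> uK vK uv cu nu cv nv.
  case: (boolP [exists k in K, exists k' in K, [&& k != k', complete_to Y2 k & complete_to Y2 k']]).
    case/exists_inP=> k kK /exists_inP[k' k'K /and3P[kk ck ck']].
    apply: (@triple_star Y1 Y2 s s' e u v k k') => //=.
    have ne y w : ~~ complete_to Y2 y -> complete_to Y2 w -> y != w.
      by move=> ny; apply: contraTneq => <-.
    by rewrite !inE !negb_or uv kk !ne.
  move=> h; have one k k' : k \in K -> k' \in K -> complete_to Y2 k -> complete_to Y2 k' -> k = k'.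
    move=> kK k'K ck ck'; apply/eqP; apply: contraNT h => kk.
    by apply/exists_inP; exists k => //; apply/exists_inP; exists k' => //; rewrite kk ck.
  (* If [Y2] consists of [e] alone, two neighbours of [e] in [K] are complete to [Y2], which
     contradicts [one]. *)
  case: other => [all_e|[e' e'Y ee]]; last exact: (@split_one Y1 Y2 s s' e e').
  have te := split_two_Knbrs sp sY s'Y ss eY.
  have [k [kK _ ek]] := te x; have [k' [k'K n0 e'k']] := te k.
  have cp w : G e w -> complete_to Y2 w by move=> ew; apply/forall_inP => y /all_e->.
  by move: n0; rewrite (one k' k) ?eqxx ?cp.
(* Not the mirror image of [only1]: [Y1] is known to have two vertices, but [Y2] may be [e] alone.
   Distinct neighbours of two vertices of [Y1] then come from [split_matching]. *)
have only2 u v : u \in K -> v \in K -> u != v -> complete_to Y2 u -> ~~ complete_to Y1 u ->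
    complete_to Y2 v -> ~~ complete_to Y1 v -> has_caterpillar G.
  move=> uK vK uv cu nu cv nv.
  case: (boolP [exists k in K, exists k' in K, [&& k != k', complete_to Y1 k & complete_to Y1 k']]).
    case/exists_inP=> k kK /exists_inP[k' k'K /and3P[kk ck ck']].
    apply: (@triple_star Y1 Y2 s s' e k k' u v) => //=.
    have ne y w : complete_to Y1 y -> ~~ complete_to Y1 w -> y != w.
      by move=> cy; apply: contraNneq => <-.
    by rewrite !inE !negb_or uv kk !ne.
  move=> h; have one k k' : k \in K -> k' \in K -> complete_to Y1 k -> complete_to Y1 k' -> k = k'.
    move=> kK k'K ck ck'; apply/eqP; apply: contraNT h => kk.
    by apply/exists_inP; exists k => //; apply/exists_inP; exists k' => //; rewrite kk ck.
  case: other => [all_e|[e' e'Y ee]]; last exact: (@split_one Y2 Y1 e e' s s').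
  have [t [t' [k [k' [[tY t'Y tt] [kK k'K kk tk t'k']]]]]] := split_matching sp all_e.
  case: (boolP [exists b in K, complete_to Y1 b]) => [/exists_inP[b bK cb]|none].
    have C2 w : w \in K -> w != b -> complete_to Y2 w.
      move=> wK wb; case/orP: (split_complete sp wK) => // c.
      by move: wb; rewrite (one w b) ?eqxx.
    have fin y y' w : y \in Y1 -> y' \in Y1 -> y != y' -> w \in K -> w != b -> G y w ->
        has_caterpillar G.
      move=> yY y'Y yy wK wb yw; have [k'' [k''K n1 n2]] := K_third w b.
      apply: (@double_star Y1 Y2 y y' e w b k'') => //; try by rewrite eq_sym.
      + exact: C2.
      + exact: complete_toP cb y'Y.
      + by apply: complete_toP (C2 _ _ _) eY.
    case: (eqVneq k b) => [E|kb]; last exact: (fin t t' k).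
    by apply: (fin t' t k'); rewrite // 1?eq_sym // -E.
  have C2 w : w \in K -> complete_to Y2 w.
    move=> wK; case/orP: (split_complete sp wK) => // c.
    by case/negP: none; apply/exists_inP; exists w.
  have [k'' [k''K n1 n2]] := K_third k k'.
  apply: (@double_star Y1 Y2 t t' e k k' k'') => //; try by rewrite eq_sym.
    exact: C2.
  by apply: complete_toP (C2 _ _) eY.
have [k1 [k1K _ _]] := K_third x x; have [k2 [k2K n21 _]] := K_third k1 k1.
have [k3 [k3K n31 n32]] := K_third k1 k2.
have n12 : k1 != k2 by rewrite eq_sym.
have n13 : k1 != k3 by rewrite eq_sym.
have n23 : k2 != k3 by rewrite eq_sym.
move: (split_complete sp k1K) (split_complete sp k2K) (split_complete sp k3K).
case a1: (complete_to Y1 k1); case b1: (complete_to Y2 k1) => // _;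
case a2': (complete_to Y1 k2); case b2: (complete_to Y2 k2) => // _;
case a3: (complete_to Y1 k3); case b3: (complete_to Y2 k3) => // _;
first [ by apply: (only1 k1 k2); rewrite ?a1 ?b1 ?a2' ?b2
      | by apply: (only1 k1 k3); rewrite ?a1 ?b1 ?a3 ?b3
      | by apply: (only1 k2 k3); rewrite ?a2' ?b2 ?a3 ?b3
      | by apply: (only2 k1 k2); rewrite ?a1 ?b1 ?a2' ?b2
      | by apply: (only2 k1 k3); rewrite ?a1 ?b1 ?a3 ?b3
      | by apply: (only2 k2 k3); rewrite ?a2' ?b2 ?a3 ?b3
      | by apply: (both k1 k2 k3) | by apply: (both k1 k3 k2)
      | by apply: (both k2 k1 k3) | by apply: (both k2 k3 k1)
      | by apply: (both k3 k1 k2) | by apply: (both k3 k2 k1) ].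
Qed.

(** If [X] splits, one of the parts has two vertices because [X] has at least three; it takes the
    role of [Y1]. *)
Lemma bigK_caterpillar : has_caterpillar G.
Proof.
case: (boolP [exists A : {set V}, [&& A \subset X, A != finset.set0, X :\: A != finset.set0 &
    [forall a in A, forall b in X :\: A, ~~ G a b]]]) => [|none].
  case/existsP=> A /and4P[AX /finset.set0Pn[a aA] /finset.set0Pn[b bA] /forall_inP h].
  have sp : split_X A (X :\: A).
    split=> [v|u v uA vA]; last by have /forall_inP := h u uA; apply.
    rewrite finset.in_setD; case vA: (v \in A) => //=.
    by rewrite (fintype.subsetP AX v vA).
  case: (boolP [exists a' in A, a != a']) => [/exists_inP[a' a'A aa]|].
    exact: split_caterpillar sp aA a'A aa bA.
  rewrite negb_exists_in => /forall_inP one.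
  have A1 : #|A| <= 1.
    rewrite -(cards1 a); apply: subset_leq_card; apply/fintype.subsetP => v /one.
    by rewrite negbK inE eq_sym.
  have B2 : 1 < #|X :\: A|.
    have := X_gt2; rewrite -(cardsID A X).
    have : #|X :&: A| <= #|A| by apply: subset_leq_card; apply: subsetIr.
    by move: A1; clear; lia.
  have /card_gt0P[b' ] : 0 < #|(X :\: A) :\ b| by rewrite (cardsD1 b) bA in B2; move: B2; clear; lia.
  rewrite in_setD1 => /andP[bb b'A].
  by apply: split_caterpillar (split_sym sp) bA b'A _ aA; rewrite eq_sym.
apply: conn_caterpillar => A a0 b0 AX a0A b0X b0A.
case: (boolP [exists a in A, exists b in X :\: A, G a b]) => [|no].
  case/exists_inP=> a aA /exists_inP[b]; rewrite finset.in_setD => /andP[bA bX] gab.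
  by exists a, b.
case/negP: none; apply/existsP; exists A; apply/and4P; split=> //.
- by apply/finset.set0Pn; exists a0.
- by apply/finset.set0Pn; exists b0; rewrite finset.in_setD b0A.
- apply/forall_inP => a aA; apply/forall_inP => b bA.
  apply: contra no => gab; apply/exists_inP; exists a => //.
  by apply/exists_inP; exists b.
Qed.

End BigK.

(** * At most one non-neighbour of [x] *)

Lemma K0_caterpillar : #|K| = 0 -> has_caterpillar G.
Proof.
move=> K0.
have full u v : u != v -> G u v.
  move=> uv; have : nonnbr u = finset.set0 by apply/eqP; rewrite -cards_eq0 -leqn0 -K0 xmax.
  by move/setP/(_ v); rewrite !inE eq_sym uv /= => /negbT; rewrite negbK.
have /card_gt0P[z zX] : 0 < #|X| by apply: ltn_trans X_gt2.
have sz : {subset [:: z] <= X} by move=> u; rewrite mem_seq1 => /eqP->.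
have szr := size_rest (isT : uniq [:: z]) sz.
have nz u : u \in rest X [:: z] -> u != z by rewrite mem_rest mem_seq1 => /andP[].
have r2 : 1 < size (rest X [:: z]).
  by move: szr X_gt2 => /=; clear; lia.
apply: (@caterpillar1 _ _ x (rest X [:: z]) z) => //.
- move=> v; have := count_rest v (isT : uniq [:: z]) sz; have := xXK v.
  have -> : v \in K = false by apply/negbTE; apply: contraTN isT => vK; rewrite (cardsD1 v) vK in K0.
  by rewrite /= count_cat /=; clear; count_lia.
- by apply: clique_sorted; rewrite ?rest_uniq // => a b _ _; apply: full.
- case: (rest _ _) r2 nz => // a l _ nz; apply: full; rewrite eq_sym.
  by apply: nz; rewrite inE eqxx.
- case/lastP: (rest _ _) r2 nz => // l a _ nz; rewrite last_rcons; apply: full.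
  by apply: nz; rewrite mem_rcons inE eqxx.
- move=> v; rewrite in_cons mem_rest => /orP[/eqP->|/andP[vX _]]; rewrite GC -inX //.
Qed.

(** No vertex has two non-neighbours, so [k] sees all of [X]. If [X] has three vertices, one of them
    sees the other two and is the whole spine. Otherwise a path covers [X] without some vertex [s];
    [s] misses at most one end of it, and the spine is [x], [s]. *)
Lemma K1_caterpillar : #|K| = 1 -> has_caterpillar G.
Proof.
move=> K1; have /cards1P[k Kk] : #|K| == 1 by apply/eqP.
have kK : k \in K by rewrite Kk inE.
have one v u w : u != v -> w != v -> ~~ G v u -> ~~ G v w -> u = w.
  move=> uv wv nu nw; apply/eqP; apply: contraTT (xmax v) => uw.
  rewrite -ltnNge -/K K1; apply/card_gt1P; exists u, w.
  by rewrite !inE uv wv nu nw.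
have kX v : v \in X -> G v k.
  move=> vX; apply: contraT => nvk.
  have : v = x by apply: (one k); rewrite ?(XnK vX kK) // 1?GC //; move: kK; rewrite inK eq_sym // => /andP[].
  by move=> E; move: vX; rewrite E inX adj_irr.
have nxk : x != k by move: kK; rewrite inK eq_sym => /andP[].
have cK v : (v \in K) = count_mem v [:: k] :> nat by rewrite Kk inE /= addn0 eq_sym.
have star3 t u w : (forall v, count_mem v [:: t; u; w] = (v \in X)) -> G t u -> G t w ->
    has_caterpillar G.
  move=> cX tu tw.
  have [tX uX wX] : [/\ t \in X, u \in X & w \in X].
    split; [have := cX t | have := cX u | have := cX w]; rewrite /= eqxx; case: (_ \in X) => //.
      by case: (_ == _).
    by case: (t == w); case: (u == w).
  apply: (@caterpillar1 _ _ t [:: u; k; w] x) => //.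
  - by move=> v; have := cX v; have := xXK v; rewrite cK /=; clear; count_lia.
  - by rewrite /= kX // GC kX.
  - by rewrite /= -inX.
  - by rewrite /= gxX.
  - move=> v; rewrite !in_cons in_nil orbF => /or4P[]/eqP->.
    + by rewrite -inX.
    + by rewrite GC.
    + by rewrite GC kX.
    + by rewrite GC.
case: (ltnP 3 #|X|) => [X4|X3]; last first.
  have := enum_uniq X; have : size (enum X) = 3 by rewrite -cardE; apply/eqP; rewrite eqn_leq X3 X_gt2.
  have : forall v, count_mem v (enum X) = (v \in X).
    by move=> v; rewrite count_mem_uniq ?enum_uniq // mem_enum.
  case: (enum X) => [|a [|b [|c []]]] //= cX _ /and3P[]; rewrite !inE !negb_or => /andP[ab ac] bc _.
  case: (boolP (G a b)) => gab.
    case: (boolP (G a c)) => gac; first exact: (star3 a b c).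
    apply: (star3 b a c); first by move=> v; rewrite -cX /=; clear; count_lia.
      by rewrite GC.
    by apply: contraT => nbc; have := one c a b ac bc; rewrite GC gac GC nbc => /(_ isT isT) E;
      move: ab; rewrite E eqxx.
  apply: (star3 c a b); first by move=> v; rewrite -cX /=; clear; count_lia.
    apply: contraT => nca; have := one a b c; rewrite eq_sym ab eq_sym ac gab GC nca => /(_ isT isT isT isT) E.
    by move: bc; rewrite E eqxx.
  apply: contraT => ncb; have := one b a c; rewrite ab (eq_sym c) bc GC gab GC ncb => /(_ isT isT isT isT) E.
  by move: ac; rewrite E eqxx.
have /card_gt0P[s sX] : 0 < #|X| by apply: ltn_trans X_gt2.
have XsC : #|X| = #|X :\ s|.+1 by rewrite (cardsD1 s) sX.
have /card_gt2P[a [b [c [[aY bY cY] [ab bc ca]]]]] : 2 < #|X :\ s|.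
  by move: X4; rewrite XsC ltnS.
pose P p := [/\ 1 < size p, uniq p, {subset p <= X :\ s} & sorted G p].
have [p0 Pp0] : exists p, P p.
  have ac : a != c by rewrite eq_sym.
  have H u v : u \in X :\ s -> v \in X :\ s -> u != v -> G u v -> exists p, P p.
    move=> uY vY uv guv; exists [:: u; v]; split=> //=; rewrite ?inE ?uv ?guv //.
    by move=> w; rewrite mem_seq2 => /orP[]/eqP->.
  by case/or3P: (a2 ab ac bc) => g; [apply: (H a b)|apply: (H a c)|apply: (H b c)].
have [p [sz U pY srt] cov] : exists2 p, P p & forall v, v \in X :\ s -> v \in p.
  apply: (grow_path Pp0) => [p []|p y [sz U pY srt] yY yp] //.
  case: p sz U pY srt yp => [|m1 [|m2 q]] // _ U pY srt yp.
  have m12 : m1 != last m2 q.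
    by have /andP[+ _] := U; apply: contraNneq => ->; apply: mem_last.
  case: (boolP (G y m1)) => ym1.
    exists [:: y, m1, m2 & q] => //; split=> //.
    - by rewrite cons_uniq yp.
    - by move=> u; rewrite in_cons => /orP[/eqP->//|/pY].
    - by rewrite /= ym1; move: srt.
  have yml : G y (last m2 q).
    apply: contraT => nyl; have := one y m1 (last m2 q); rewrite ym1 nyl => E.
    have ny u : u \in [:: m1, m2 & q] -> u != y by apply: contraTneq => ->.
    have : m1 = last m2 q by apply: E => //; apply: ny; [rewrite inE eqxx | rewrite in_cons mem_last orbT].
    by move/eqP; rewrite (negbTE m12).
  exists (rcons [:: m1, m2 & q] y); last by rewrite size_rcons.
  split; first by rewrite size_rcons.
  - by rewrite rcons_uniq yp.
  - by move=> u; rewrite mem_rcons in_cons => /orP[/eqP->//|/pY].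
  - by move: srt => /=; rewrite rcons_path => /andP[-> ->]; rewrite GC yml.
have cp v : count_mem v p = (v \in X :\ s).
  by rewrite count_mem_uniq //; congr nat_of_bool; apply/idP/idP; [apply: pY | apply: cov].
have szp : size p = #|X :\ s|.
  by rewrite -(card_uniqP U); apply: eq_card => v; apply/idP/idP; [apply: pY | apply: cov].
(* The rim is [f], [q], [e], [k], with [e] and [k] hanging at [s]; hence the end [e] has to see
   [s]. *)
have fin q f e : (forall v, count_mem v (f :: rcons q e) = (v \in X :\ s)) ->
    sorted G (f :: rcons q e) -> 0 < size q -> G e s -> has_caterpillar G.
  move=> cq + q0 es.
  have mq v : v \in f :: rcons q e -> v \in X.
    move=> vq; have := cq v; rewrite count_mem_uniq ?vq; last first.
      have h w : count_mem w (f :: rcons q e) <= 1 by rewrite cq; case: (_ \in _).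
      elim: (f :: rcons q e) h => //= w l IH h; apply/andP; split.
        by apply/count_memPn; have := h w; rewrite /= eqxx; case: (count_mem w l).
      by apply: IH => w'; apply: leq_trans (h w'); rewrite leq_addl.
    by rewrite in_setD1; case: (v \in X); rewrite ?andbF.
  have eX : e \in X by apply: mq; rewrite in_cons mem_rcons in_cons eqxx orbT.
  have fX : f \in X by apply: mq; rewrite in_cons eqxx.
  rewrite /= rcons_path => /andP[pq qe].
  apply: (@caterpillar2 _ _ x s q [:: e; k] f) => //.
  - move=> v; have := cq v; have := xXK v; rewrite cK in_setD1 /= -cats1 !count_cat /=.
    have : count_mem v [:: s] + ((v != s) && (v \in X)) = (v \in X).
      by rewrite /= addn0 eq_sym; case: eqP => [->|_] //=; rewrite sX.
    by rewrite /=; clear; count_lia.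
  - by rewrite -inX.
  - case: q q0 pq qe {cq mq} => // w q _ /=; rewrite cat_path /= => /andP[_ ->] ->.
    by rewrite kX.
  - by case: q q0 pq {qe cq mq} => //= w q _ /andP[].
  - by rewrite /= GC kX.
  - by move=> v vq; apply/gxX/mq; move: vq; rewrite !in_cons mem_rcons in_cons => /orP[]->; rewrite ?orbT.
  - by move=> v; rewrite mem_seq2 => /orP[]/eqP-> //; rewrite GC kX.
case: p sz U pY srt cov cp szp => [|f p] // sz U pY srt cov cp szp.
case/lastP: p sz U pY srt cov cp szp => [|q e] // sz U pY srt cov cp szp.
have q0 : 0 < size q by move: szp X4; rewrite XsC /= size_rcons; clear; lia.
have fe : f != e by have /andP[+ _] := U; rewrite mem_rcons in_cons negb_or => /andP[].
case: (boolP (G e s)) => es; first exact: (fin q f e).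
apply: (fin (rev q) e f).
- by move=> v; rewrite -cp /= -!cats1 !count_cat count_rev /=; clear; count_lia.
- have : sorted G (rev (f :: rcons q e)).
    by rewrite rev_sorted (eq_sorted (e' := G)) // => u v; rewrite GC.
  by rewrite rev_cons rev_rcons.
- by rewrite size_rev.
- have ns u : u \in f :: rcons q e -> u != s by move=> /pY; rewrite in_setD1 => /andP[].
  apply: contraT => nfs; move: fe; rewrite (one s f e) ?eqxx //.
  + by apply: ns; rewrite in_cons eqxx.
  + by apply: ns; rewrite in_cons mem_rcons in_cons eqxx orbT.
  + by rewrite GC.
  + by rewrite GC.
Qed.

(** * Exactly two non-neighbours of [x] *)

Section PairK.
Variables k k' : V.
Hypothesis kk : k != k'.
Hypothesis Kkk : K = [set k; k'].

Lemma k_in : k \in K. Proof. by rewrite Kkk !inE eqxx. Qed.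
Lemma k'_in : k' \in K. Proof. by rewrite Kkk !inE eqxx orbT. Qed.

Lemma count_K v : (v \in K) = count_mem v [:: k; k'] :> nat.
Proof.
rewrite Kkk !inE /= addn0 ![_ == v]eq_sym; case: eqP => [->|_] //=.
by rewrite (negbTE kk).
Qed.

Definition full v := G v k && G v k'.
Definition sdr2 a b := (G a k && G b k') || (G a k' && G b k).

Lemma full_sdr2 a b : full a -> G b k || G b k' -> sdr2 a b.
Proof. by rewrite /sdr2 => /andP[-> ->] /= /orP[]->; rewrite ?orbT. Qed.

Lemma sdr2_sym a b : sdr2 a b = sdr2 b a.
Proof. by rewrite /sdr2 orbC [G b k && _]andbC [G b k' && _]andbC. Qed.

Lemma sdr2l a b : sdr2 a b -> G a k || G a k'.
Proof. by case/orP=> /andP[->]; rewrite ?orbT. Qed.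

(** [x] is already one of the at most two non-neighbours of [q]. *)
Lemma miss_unique q u v : q \in K -> u \in X -> v \in X -> ~~ G u q -> ~~ G v q -> u = v.
Proof.
move=> qK uX vX nu nv; apply/eqP; apply: contraTT (xmax q) => uv; rewrite -ltnNge -/K.
have -> : #|K| = 2 by rewrite Kkk cards2 kk.
have xq : x != q by move: qK; rewrite inK eq_sym => /andP[].
have nx w : w \in X -> w != x by apply: contraTneq => ->; rewrite inX adj_irr.
apply/card_gt2P; exists x, u, v; split; last by rewrite uv (nx v) // eq_sym nx.
split; rewrite inE ?xq ?(XnK _ qK) //= GC //.
by move: qK; rewrite inK => /andP[].
Qed.

(** Two non-neighbours in [X] would force two neighbours in [K], that is, all of [K]. *)
Lemma nonfull_unique y u v : y \in X -> u \in X -> v \in X -> y != u -> y != v ->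
  ~~ full y -> ~~ G y u -> ~~ G y v -> u = v.
Proof.
move=> yX uX vX yu yv nf nu nv; apply/eqP; apply: contraNT nf => uv.
have two : two_Knbrs y by apply: (@two_KnbrsP y u v); rewrite // eq_sym.
have [a [+ ak ya]] := two k'; have [b [+ bk' yb]] := two k.
rewrite Kkk !inE (negbTE ak) (negbTE bk') ?orbF /= => /eqP bE /eqP aE.
by rewrite /full -aE ya -bE yb.
Qed.

Lemma full_unique y u v w : y \in X -> u \in X -> v \in X -> w \in X ->
  y != u -> y != v -> y != w -> u != v ->
  ~~ G y u -> ~~ G y v -> ~~ G y w -> w = u \/ w = v.
Proof.
move=> yX uX vX wX yu yv yw uv nu nv nw.
suff /orP[/eqP|/eqP] : (w == u) || (w == v) by [left | right].
apply: contraT; rewrite negb_or => /andP[wu wv].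
have : 2 < #|[set q in K | G y q]|.
  apply: (@nonnbr_le y [:: u; v; w]) => //=.
    by rewrite !inE negb_or uv (eq_sym u) wu (eq_sym v) wv.
  by move=> z; rewrite mem_seq3 => /or3P[]/eqP->; split; rewrite // eq_sym.
rewrite ltnNge => /negP[]; apply: leq_trans (_ : #|K| <= 2); last by rewrite Kkk cards2 kk.
by apply: subset_leq_card; apply/fintype.subsetP => z; rewrite finset.in_set => /andP[].
Qed.

(* [s] stays off the path: the spine will be [x, s], with [k] and [k'] as leaves of [s]. *)
Definition pair_path s p := [/\ [/\ s \in X, full s & s \notin p], 1 < size p, uniq p,
  {subset p <= X} & sorted G p /\ sdr2 (head x p) (last x p)].

(** The rim is the path closed through the edge between [k] and [k'], whose direction is dictated by
    the representatives of the two ends. *)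
Lemma pair_path_caterpillar s p : pair_path s p -> (forall v, v \in X -> v \in s :: p) ->
  has_caterpillar G.
Proof.
case=> [[sX /andP[sk sk'] sp] sz U pX [srt sd]] cov.
have cp v : count_mem v (s :: p) = (v \in X).
  rewrite count_mem_uniq ?cons_uniq ?sp //; congr nat_of_bool; apply/idP/idP; last exact: cov.
  by rewrite in_cons => /orP[/eqP->//|/pX].
case: p sp sz U pX srt sd cov cp => [|e p] // sp sz U pX srt sd cov cp.
have p0 : 0 < size p by move: sz.
have H q q' : (forall v, count_mem v [:: q; q'] = count_mem v [:: k; k']) -> G q q' -> G s q -> G s q' ->
    G (last e p) q -> G e q' -> has_caterpillar G.
  move=> cq qq sq sq' fq eq'.
  apply: (@caterpillar2 _ _ x s p [:: q; q'] e) => //.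
  - move=> v; have := cp v; have := xXK v; rewrite count_K; have := cq v.
    by rewrite /= !count_cat /=; clear; count_lia.
  - by rewrite -inX.
  - case: p p0 srt fq {sp sz U pX sd cov cp} => // w p _ /=.
    by rewrite cat_path /= => /andP[_ ->] ->; rewrite qq.
  - by case: p p0 srt {sp sz U pX sd cov cp fq} => //= w p _ /andP[].
  - by rewrite /= GC.
  - by move=> v /pX; apply: gxX.
  - by move=> v; rewrite mem_seq2 => /orP[]/eqP->; rewrite GC.
have gkk := KG k_in k'_in kk.
case/orP: sd => /= /andP[g1 g2].
  apply: (H k' k) => //; last by rewrite GC.
  by move=> v /=; clear; count_lia.
by apply: (H k k').
Qed.

(** [q] and [q'] are [k] and [k'] in either order. Since [q] represents [y], the opposite end has to
    see [q']. It does by [star] if [y] misses that end; if [y] sees both ends, the old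
    representatives decide where it is attached. *)
Lemma pair_step_nonfull s p y q q' : K = [set q; q'] -> q \in K -> q' \in K ->
  (forall a b, sdr2 a b = (G a q && G b q') || (G a q' && G b q)) ->
  pair_path s p -> y \in X -> y \notin s :: p -> G y q -> ~~ G y q' ->
  exists2 p', pair_path s p' & size p' = (size p).+1.
Proof.
move=> Kq qK q'K sE [[sX fs sp] sz U pX [srt sd]] yX; rewrite in_cons negb_or => /andP[ys yp] yq yq'.
have nf : ~~ full y.
  apply: contraNN yq' => /andP[g g'].
  by move: q'K; rewrite Kkk !inE => /orP[]/eqP->.
have sy : s != y by rewrite eq_sym.
case: p sp sz U pX srt sd yp => [|e p] // sp sz U pX srt sd yp.
have ny u : u \in e :: p -> y != u by apply: contraTneq => <-.
have eX : e \in X by apply: pX; rewrite in_cons eqxx.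
have fX : last e p \in X by apply: pX; apply: mem_last.
have yel : y != e by apply: ny; rewrite in_cons eqxx.
have yfl : y != last e p by apply: ny; apply: mem_last.
have ef : e != last e p.
  case: p {fX yfl sp pX srt sd yp ny} sz U => //= w p _ /andP[+ _].
  by apply: contraNneq => ->; apply: mem_last.
have consP : G y e -> G (last e p) q' -> exists2 p', pair_path s p' & size p' = (size (e :: p)).+1.
  move=> ye fq'; exists (y :: e :: p) => //; split=> //.
  - by rewrite in_cons negb_or sy.
  - by rewrite cons_uniq yp.
  - by move=> u; rewrite in_cons => /orP[/eqP->//|/pX].
  - by split; [rewrite /= ye; move: srt | rewrite sE /= yq fq'].
have rconsP : G y (last e p) -> G e q' -> exists2 p', pair_path s p' & size p' = (size (e :: p)).+1.
  move=> yf eq'; exists (rcons (e :: p) y); last by rewrite size_rcons.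
  split; first split=> //.
  - by rewrite mem_rcons in_cons negb_or sy.
  - by rewrite size_rcons ltnS ltnW.
  - by rewrite rcons_uniq yp.
  - by move=> u; rewrite mem_rcons in_cons => /orP[/eqP->//|/pX].
  - split; first by rewrite /= rcons_path GC yf andbT; move: srt.
    by rewrite sE last_rcons /= eq' yq orbT.
case: (boolP (G y e)) => ye.
  case: (boolP (G (last e p) q')) => fq'; first exact: consP.
  case: (boolP (G y (last e p))) => yf.
    apply: rconsP => //; move: sd; rewrite sE /= (negbTE fq') andbF /= => /andP[]//.
  by case/negP: fq'; apply: (@star y).
have yf : G y (last e p).
  apply: contraT => nyf; move: ef.
  by rewrite -(@nonfull_unique y e (last e p)) ?eqxx.
by apply: rconsP => //; apply: (@star y).
Qed.

Lemma pair_insert s e w p y : pair_path s [:: e, w & p] -> y \in X -> y \notin [:: s, e, w & p] ->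
  G y e -> G y w -> pair_path s [:: e, y, w & p].
Proof.
move=> [[sX fs sp] sz U pX [srt sd]] yX yp ye yw.
have P : perm_eq [:: e, y, w & p] [:: y, e, w & p].
  by apply/seq.permP => f /=; clear; lia.
move: yp; rewrite in_cons negb_or => /andP[ys yp].
split=> //.
- by split=> //; rewrite (perm_mem P) in_cons negb_or eq_sym ys.
- by rewrite (perm_uniq P) cons_uniq yp.
- by move=> u; rewrite (perm_mem P) in_cons => /orP[/eqP->//|/pX].
- by split=> //; move: srt; rewrite /= (GC e y) ye yw => /andP[_ ->].
Qed.

(** The delicate case is a path of two vertices both missed by a full [y]. Then [s] may enter the
    path while [y] takes its place; if [X] consists of these four vertices only, the caterpillar may
    have to be given outright, whence the first alternative. *)
Lemma pair_step s p y : pair_path s p -> y \in X -> y \notin s :: p ->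
  has_caterpillar G \/ exists s' p', pair_path s' p' /\ size p' = (size p).+1.
Proof.
move=> pp yX yp; have [[sX fs sp] sz U pX [srt sd]] := pp.
have ys : y != s by move: yp; rewrite in_cons negb_or => /andP[].
have ynp : y \notin p by move: yp; rewrite in_cons negb_or => /andP[].
have ny u : u \in p -> y != u by apply: contraTneq => <-.
case: (boolP (full y)) => fy; last first.
  case yk: (G y k); last first.
    case yk': (G y k'); last first.
      case: p pp yp ny {sp sz U pX srt sd ynp} => [|e [|w p]]; try by case=> _.
      move=> pp yp ny; right; exists s, [:: e, y, w & p]; split=> //.
      have [_ _ _ pX _] := pp.
      have adj u : u \in [:: e, w & p] -> G y u.
        move=> up; apply: contraT => nyu.
        have uy : u != y by rewrite eq_sym ny.
        have [q qK yq] := has_Knbr yX (pX u up) uy nyu.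
        by move: qK yq; rewrite Kkk !inE => /orP[]/eqP->; rewrite ?yk ?yk'.
      by apply: pair_insert => //; apply: adj; rewrite !in_cons eqxx ?orbT.
    have E1 : K = [set k'; k] by rewrite Kkk finset.setUC.
    have E2 a b : sdr2 a b = (G a k' && G b k) || (G a k && G b k') by rewrite /sdr2 orbC.
    have [p' pp' sp'] := pair_step_nonfull E1 k'_in k_in E2 pp yX yp yk' (negbT yk).
    by right; exists s, p'.
  have nyk' : ~~ G y k' by apply: contraNN fy; rewrite /full yk.
  have [p' pp' sp'] := pair_step_nonfull Kkk k_in k'_in (fun _ _ => erefl) pp yX yp yk nyk'.
  by right; exists s, p'.
case: p pp yp ynp ny sp sz U pX srt sd => [|m1 [|m2 p]] // pp yp ynp ny sp sz U pX srt sd.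
have in1 : m1 \in [:: m1, m2 & p] by rewrite in_cons eqxx.
have in2 : m2 \in [:: m1, m2 & p] by rewrite !in_cons eqxx orbT.
have inl : last m2 p \in [:: m1, m2 & p] by rewrite in_cons mem_last orbT.
have m1l : m1 != last m2 p.
  by have /andP[+ _] := U; apply: contraNneq => ->; apply: mem_last.
case: (boolP (G y m1)) => ym1.
  right; exists s, [:: y, m1, m2 & p]; split=> //; split=> //.
  - by split=> //; rewrite in_cons negb_or eq_sym ys.
  - by rewrite cons_uniq ynp.
  - by move=> u; rewrite in_cons => /orP[/eqP->//|/pX].
  - split; first by rewrite /= ym1; move: srt.
    by apply: full_sdr2 => //; apply: (@sdr2l _ m1); rewrite sdr2_sym.
case: (boolP (G y (last m2 p))) => yl.
  right; exists s, (rcons [:: m1, m2 & p] y); split; last by rewrite size_rcons.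
  split; first split=> //.
  - by rewrite mem_rcons in_cons negb_or eq_sym ys.
  - by rewrite size_rcons.
  - by rewrite rcons_uniq ynp.
  - by move=> u; rewrite mem_rcons in_cons => /orP[/eqP->//|/pX].
  - split; first by move: srt => /=; rewrite rcons_path => /andP[-> ->]; rewrite GC yl.
    by rewrite last_rcons sdr2_sym; apply: full_sdr2 => //; apply: sdr2l sd.
(* The two ends are adjacent, and they are the only non-neighbours of [y] in [X]. So [y] fits into
   an inner gap, or in front of a path of three vertices reordered along the edge between its
   ends. *)
have g1l : G m1 (last m2 p) by apply: (@nonadj_third y) => //; apply: ny.
have oth u : u \in [:: m1, m2 & p] -> u != m1 -> u != last m2 p -> G y u.
  move=> up u1 ul; apply: contraT => nyu.
  have [E|E] := @full_unique y m1 (last m2 p) u yX (pX _ in1) (pX _ inl) (pX _ up)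
    (ny _ in1) (ny _ inl) (ny _ up) m1l ym1 yl nyu.
    by move: u1; rewrite E eqxx.
  by move: ul; rewrite E eqxx.
case: p pp yp ynp ny sp sz U pX srt sd in1 in2 inl m1l yl g1l oth => [|m3 [|m4 p]]
  pp yp ynp ny sp sz U pX srt sd in1 in2 inl m1l yl g1l oth; last first.
- right; exists s, [:: m1, m2, y, m3, m4 & p]; split=> //.
  have P : perm_eq [:: m1, m2, y, m3, m4 & p] [:: y, m1, m2, m3, m4 & p].
    by apply/seq.permP => f /=; clear; lia.
  have /and3P[n1 n2 /andP[n3 _]] := U; have /and4P[g12 g23 g34 pG] := srt.
  have ym2 : G y m2.
    apply: oth => //; first by apply: contraNneq n1 => <-; rewrite in_cons eqxx.
    by apply: contraNneq n2 => /= ->; rewrite in_cons mem_last orbT.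
  have ym3 : G y m3.
    apply: oth; first by rewrite !in_cons eqxx !orbT.
      by apply: contraNneq n1 => <-; rewrite !in_cons eqxx orbT.
    by apply: contraNneq n3 => /= ->; rewrite mem_last.
  split=> //.
  + by split=> //; rewrite (perm_mem P) in_cons negb_or eq_sym ys.
  + by rewrite (perm_uniq P) cons_uniq ynp.
  + by move=> u; rewrite (perm_mem P) in_cons => /orP[/eqP->//|/pX].
  + by split=> //; rewrite /= g12 GC ym2 ym3 g34.
- right; exists s, [:: y; m2; m1; m3]; split=> //.
  have P : perm_eq [:: y; m2; m1; m3] [:: y; m1; m2; m3].
    by apply/seq.permP => f /=; clear; lia.
  move: (U) (srt); rewrite /= !in_cons !negb_or !andbT => /andP[/andP[d12 d13] d23] /andP[g12 g23].
  have ym2 : G y m2 by apply: oth => //; rewrite eq_sym.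
  split=> //.
  + by split=> //; rewrite (perm_mem P) in_cons negb_or eq_sym ys.
  + by rewrite (perm_uniq P) cons_uniq ynp.
  + by move=> u; rewrite (perm_mem P) in_cons => /orP[/eqP->//|/pX].
  + split; first by move: g1l => /= ->; rewrite ym2 GC g12.
    by apply: full_sdr2 => //; apply: (@sdr2l _ m1); rewrite sdr2_sym.
move: inl m1l yl g1l oth => /= inl m1l yl g1l oth.
have m1X := pX _ in1; have m2X := pX _ in2.
have [sm1 sm2] : s != m1 /\ s != m2.
  by move: sp; rewrite mem_seq2 negb_or => /andP[].
have [yn1 yn2] : y != m1 /\ y != m2 by split; apply: ny.
have mk s' a b c : s' \in X -> full s' -> s' \notin [:: a; b; c] -> a \in X -> b \in X -> c \in X ->
    G a b -> G b c -> a != c -> sdr2 a c -> 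
    has_caterpillar G \/ exists s' p', pair_path s' p' /\ size p' = 3.
  move=> s'X fs' ns' aX bX cX ab bc ac sac; right; exists s', [:: a; b; c]; split=> //; split=> //.
  - by rewrite /= !inE negb_or (adj_neq ab) ac (adj_neq bc).
  - by move=> u; rewrite mem_seq3 => /or3P[]/eqP->.
  - by split=> //=; rewrite ab bc.
have m1k := sdr2l sd.
have m2k : G m2 k || G m2 k' by apply: (@sdr2l _ m1); rewrite sdr2_sym.
case: (boolP (G s m1)) => gsm1.
  by apply: (mk y s m1 m2) => //; apply: full_sdr2.
case: (boolP (G s m2)) => gsm2.
  apply: (mk y s m2 m1) => //; first by rewrite !inE !negb_or ys yn1 yn2.
    by rewrite GC.
  exact: full_sdr2.
(* A vertex missing both [y] and [s] has two non-neighbours in [X] and is therefore full. *)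
have fullm m : m \in X -> y != m -> s != m -> ~~ G y m -> ~~ G s m -> full m.
  move=> mX ym sm nym nsm; apply: contraT => nf; move: ys.
  by rewrite (@nonfull_unique m y s) ?eqxx // 1?eq_sym // GC.
have f1 := fullm m1 m1X yn1 sm1 ym1 gsm1; have f2 := fullm m2 m2X yn2 sm2 yl gsm2.
have gys : G y s by apply: (@nonadj_third m1); rewrite // 1?eq_sym // GC.
case: (boolP [exists v in X, v \notin [:: m1; m2; y; s]]) => [/exists_inP[v vX]|].
  rewrite mem_seq4 !negb_or => /and4P[v1 v2 vy vs].
  have gv m : m \in X -> v != m -> y != m -> s != m -> ~~ G y m -> ~~ G s m -> G v m.
    move=> mX vm ym sm nym nsm; rewrite GC; apply: contraT => nmv.
    have [my ms mv] : [/\ m != y, m != s & m != v] by split; rewrite eq_sym.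
    have [ny' ns'] : ~~ G m y /\ ~~ G m s by split; rewrite GC.
    have [E|E] := full_unique mX yX sX vX my ms mv ys ny' ns' nmv.
      by move: vy; rewrite E eqxx.
    by move: vs; rewrite E eqxx.
  have vm1 := gv m1 m1X v1 yn1 sm1 ym1 gsm1; have vm2 := gv m2 m2X v2 yn2 sm2 yl gsm2.
  apply: (mk s m1 v m2) => //.
    by rewrite !inE !negb_or sm1 sm2 eq_sym vs.
  by rewrite GC.
rewrite negb_exists_in => /forall_inP all4; left.
have [/andP[m1k1 m1k2] /andP[m2k1 m2k2]] := (f1, f2).
have [/andP[yk1 yk2] /andP[sk1 sk2]] := (fy, fs).
apply: (@caterpillar2 _ _ m1 k [:: x] [:: y; s; k'] m2) => //.
- move=> v; have := xXK v; rewrite count_K.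
  have -> : (v \in X) = count_mem v [:: m1; m2; y; s] :> nat.
    rewrite count_mem_uniq; last first.
      by rewrite /= !inE !negb_or m1l ![_ == y]eq_sym ![_ == s]eq_sym yn1 yn2 sm1 sm2 eq_sym ys.
    congr nat_of_bool; apply/idP/idP => [/all4|]; first by rewrite negbK.
    by rewrite mem_seq4 => /or4P[]/eqP->.
  by rewrite /=; clear; count_lia.
- by rewrite /= -inX yX gys sk2.
- exact: gxX.
- by rewrite /= GC.
- by move=> v; rewrite mem_seq2 => /orP[]/eqP->; rewrite 1?GC // gxX.
- move=> v; rewrite mem_seq3 => /or3P[]/eqP-> //.
  by rewrite GC; apply: KG; rewrite // ?k_in ?k'_in.
Qed.

Lemma pair_mk s u v : s \in X -> u \in X -> v \in X -> s != u -> s != v -> full s ->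
  G u v -> sdr2 u v -> exists s p, pair_path s p.
Proof.
move=> sX uX vX su sv fs uv sd; exists s, [:: u; v]; split=> //.
- by split=> //; rewrite mem_seq2 negb_or su.
- by rewrite /= inE adj_neq.
- by move=> w; rewrite mem_seq2 => /orP[]/eqP->.
- by split; rewrite //= uv.
Qed.

Lemma full_sdr2' a b : full a -> full b -> sdr2 a b.
Proof. by move=> fa /andP[bk _]; apply: full_sdr2; rewrite // bk. Qed.

(** All other vertices of [X] are full by [miss_unique]. Three of them contain an adjacent pair; if
    there were at most two, deleting them would separate [x] and [z] from [K]. *)
Lemma pair_base_missing z : z \in X -> ~~ G z k -> ~~ G z k' -> exists s p, pair_path s p.
Proof.
move=> zX nk nk'.
have fl v : v \in X -> v != z -> full v.
  move=> vX vz; rewrite /full; apply: contraNT vz; rewrite negb_and => /orP[] nv.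
    by apply/eqP; apply: (miss_unique k_in).
  by apply/eqP; apply: (miss_unique k'_in).
have Xz : #|X| = #|X :\ z|.+1 by rewrite (cardsD1 z) zX.
case: (ltnP 2 #|X :\ z|) => [/card_gt2P[a [b [c [[aY bY cY] [ab bc ca]]]]]|le2].
  move: aY bY cY; rewrite !in_setD1 => /andP[az aX] /andP[bz bX] /andP[cz cX].
  have ac : a != c by rewrite eq_sym.
  have ba : b != a by rewrite eq_sym.
  have cb : c != b by rewrite eq_sym.
  case/or3P: (a2 ab ac bc) => g.
  - by apply: (@pair_mk c a b); rewrite ?fl ?full_sdr2' ?fl.
  - by apply: (@pair_mk b a c); rewrite ?fl ?full_sdr2' ?fl.
  - by apply: (@pair_mk a b c); rewrite ?fl ?full_sdr2' ?fl.
have kK := k_in.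
have kx : k != x by move: kK; rewrite inK => /andP[].
have kX : k \notin X by apply/negP => /XnK/(_ kK); rewrite eqxx.
have kz : k != z by apply: contraNneq kX => ->.
have [|||||a [b [aA aC bA bC gab]]] := @cut_edge _ G [set x; z] (X :\ z) x k kc.
- by rewrite ltnS.
- by rewrite !inE eqxx.
- by rewrite in_setD1 inX adj_irr andbF.
- by rewrite !inE negb_or kx.
- by rewrite in_setD1 (negbTE kX) andbF.
have bX : b \notin X.
  by move: bA bC; rewrite in_set2 negb_or in_setD1 => /andP[_ ->].
move: aA; rewrite in_set2 => /orP[] /eqP E; first by move: bX; rewrite inX -E gab.
have bx : b != x by move: bA; rewrite in_set2 negb_or => /andP[].
have : b \in K by rewrite inK bx; move: bX; rewrite inX.
by rewrite Kkk in_set2 => /orP[] /eqP E'; move: gab; rewrite E E' ?(negbTE nk) ?(negbTE nk').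
Qed.

(** If no vertex misses both [k] and [k'], any two vertices of [X] have distinct representatives,
    and at most two are not full. The second alternative is for the case that [X] is an induced path
    [a], [s], [b] in which only [s] is full. *)
Lemma pair_base : (exists s p, pair_path s p) \/ has_caterpillar G.
Proof.
case: (boolP [exists z in X, ~~ G z k && ~~ G z k']) => [/exists_inP[z zX /andP[h1 h2]]|].
  by left; apply: pair_base_missing zX h1 h2.
rewrite negb_exists_in => /forall_inP cov'.
have cov v : v \in X -> G v k || G v k' by move=> /cov'; rewrite -negb_or negbK.
have sdr u v : u \in X -> v \in X -> u != v -> sdr2 u v.
  move=> uX vX uv; have := cov u uX; have := cov v vX; rewrite /sdr2.
  have e1 : G u k || G v k.
    by apply: contraNT uv; rewrite negb_or => /andP[h1 h2]; apply/eqP/(miss_unique k_in).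
  have e2 : G u k' || G v k'.
    by apply: contraNT uv; rewrite negb_or => /andP[h1 h2]; apply/eqP/(miss_unique k'_in).
  by move: e1 e2; case: (G u k); case: (G u k'); case: (G v k); case: (G v k').
have [s sX fs] : exists2 s, s \in X & full s.
  have /card_gt2P[a [b [c [[aX bX cX] [ab bc ca]]]]] := X_gt2.
  case: (boolP (full a)) => fa; first by exists a.
  case: (boolP (full b)) => fb; first by exists b.
  case: (boolP (full c)) => fc; first by exists c.
  have ne u v q : q \in K -> u \in X -> v \in X -> u != v -> G u q || G v q.
    move=> qK uX vX uv; apply: contraNT uv; rewrite negb_or => /andP[h1 h2].
    by apply/eqP/(miss_unique qK).
  move: (ne _ _ _ k_in aX bX ab) (ne _ _ _ k_in bX cX bc) (ne _ _ _ k_in cX aX ca).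
  move: (ne _ _ _ k'_in aX bX ab) (ne _ _ _ k'_in bX cX bc) (ne _ _ _ k'_in cX aX ca).
  move: fa fb fc; rewrite /full.
  by case: (G a k); case: (G a k'); case: (G b k); case: (G b k'); case: (G c k); case: (G c k').
case: (boolP [exists u in X, exists v in X, [&& s != u, s != v & G u v]]).
  case/exists_inP=> u uX /exists_inP[v vX /and3P[su sv uv]]; left.
  by apply: (@pair_mk s u v) => //; apply: sdr => //; apply: adj_neq.
rewrite negb_exists_in => /forall_inP ind'.
have ind u v : u \in X -> v \in X -> s != u -> s != v -> ~~ G u v.
  move=> uX vX su sv; have := ind' u uX; rewrite negb_exists_in => /forall_inP/(_ v vX).
  by rewrite su sv.
have /card_gt1P[a [b [aY bY ab]]] : 1 < #|X :\ s|.
  by have := X_gt2; rewrite (cardsD1 s) sX add1n ltnS.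
move: aY bY; rewrite !in_setD1 => /andP[as_ aX] /andP[bs bX].
have [sa sb] : s != a /\ s != b by split; rewrite eq_sym.
have all3 v : v \in X -> v \in [:: a; b; s].
  move=> vX; apply: contraT; rewrite mem_seq3 !negb_or => /and3P[va vb vs].
  have sv : s != v by rewrite eq_sym.
  have [av bv] : a != v /\ b != v by split; rewrite eq_sym.
  have := a2 ab av bv; rewrite (negbTE (ind a b _ _ _ _)) // (negbTE (ind a v _ _ _ _)) //.
  by rewrite (negbTE (ind b v _ _ _ _)).
have fullcase c d : c \in X -> d \in X -> s != c -> s != d -> c != d -> full c ->
    exists s p, pair_path s p.
  move=> cX dX sc sd cd fc; have dc : d != c by rewrite eq_sym.
  have ds : d != s by rewrite eq_sym.
  case: (boolP (G d s)) => gds.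
    by apply: (@pair_mk c d s) => //; [rewrite eq_sym | apply: sdr].
  have fd : full d.
    apply: contraT => nf; have := @nonfull_unique d c s dX cX sX dc ds nf (ind _ _ dX cX sd sc) gds.
    by move=> E; move: sc; rewrite E eqxx.
  apply: (@pair_mk d c s) => //; last by apply: sdr; rewrite // eq_sym.
  by apply: (@nonadj_third d) => //; [rewrite eq_sym | apply: ind].
case: (boolP (full a)) => fa; first by left; apply: (fullcase a b).
case: (boolP (full b)) => fb; first by left; apply: (fullcase b a); rewrite // eq_sym.
right.
have ba : b != a by rewrite eq_sym.
have gas : G a s.
  apply: contraT => nas.
  have E := nonfull_unique aX bX sX ab as_ fa (ind _ _ aX bX sa sb) nas.
  by move: sb; rewrite E eqxx.
have gbs : G b s.
  apply: contraT => nbs.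
  have E := nonfull_unique bX aX sX ba bs fb (ind _ _ bX aX sb sa) nbs.
  by move: sa; rewrite E eqxx.
have /andP[sk sk'] := fs; have gkk := KG k_in k'_in kk.
have cX v : (v \in X) = count_mem v [:: a; b; s] :> nat.
  rewrite count_mem_uniq; last by rewrite /= !inE negb_or ab as_ bs.
  congr nat_of_bool; apply/idP/idP => [/all3 //|].
  by rewrite mem_seq3 => /or3P[]/eqP->.
have H q q' : (forall v, count_mem v [:: q; q'] = count_mem v [:: k; k']) -> G q q' ->
    G s q -> G s q' -> G a q -> G b q' -> has_caterpillar G.
  move=> cq qq sq sq' aq bq'.
  apply: (@caterpillar1 _ _ s [:: a; q; q'; b] x) => //.
  - move=> v; have := xXK v; rewrite count_K cX; have := cq v; rewrite /=.
    by clear; count_lia.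
  - by rewrite /= aq qq GC bq'.
  - by rewrite /= -inX.
  - by rewrite /= gxX.
  - move=> v; rewrite in_cons mem_seq4 => /orP[/eqP->|/or4P[]/eqP-> //].
    + by rewrite -inX.
    + by rewrite GC.
    + by rewrite GC.
case/orP: (sdr a b aX bX ab) => /andP[g1 g2]; first by apply: (H k k').
apply: (H k' k) => //; last by rewrite GC.
by move=> v /=; clear; count_lia.
Qed.

Lemma pair_caterpillar : has_caterpillar G.
Proof.
case: pair_base => // -[s0 [p0 Pp0]].
have [n] := ubnP (#|X| - size p0); elim: n s0 p0 Pp0 => // n IH s p Pp lt.
have [[sX _ sp] _ Up pX _] := Pp.
case: (boolP (X \subset s :: p)) => [/fintype.subsetP h|].
  exact: pair_path_caterpillar Pp h.
case/subsetPn=> y yX yp.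
have [//|[s' [p' [Pp' sp']]]] := pair_step Pp yX yp.
apply: (IH s' p') => //; have : size p < #|X|.
  rewrite -(card_uniqP Up); apply: proper_card; apply/properP; split.
    by apply/fintype.subsetP.
  by exists s.
by rewrite sp'; move: lt; clear; lia.
Qed.

End PairK.

Lemma alpha2_caterpillar_at : has_caterpillar G.
Proof.
case: (ltnP 2 #|K|) => [K3|]; first exact: bigK_caterpillar.
rewrite leq_eqVlt ltnS leq_eqVlt ltnS leqn0 => /or3P[/cards2P[k [k' [kk E]]]|/eqP K1|/eqP K0].
- exact: (pair_caterpillar kk E).
- exact: K1_caterpillar.
- exact: K0_caterpillar.
Qed.

End AlphaTwo.

Lemma alpha2_caterpillar (V : finType) (G : sgraph V) : k_connected 3 G ->
  (forall a b c, a != b -> a != c -> b != c -> [|| G a b, G a c | G b c]) -> has_caterpillar G.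
Proof.
move=> kc a2; have /card_gt0P[x0 _] : 0 < #|V| by apply: leq_trans (proj1 kc).
have [x _ xmax] := @arg_maxnP _ x0 xpredT (fun v => #|nonnbr G v|) isT.
by apply: (@alpha2_caterpillar_at _ _ kc a2 x) => v; apply: xmax.
Qed.

(** * Independence number at least three *)

Section Forbidden.
Variables (V : finType) (G : sgraph V).

Lemma induced_seq n (F : sgraph 'I_n) (x0 : V) (l : seq V) :
  size l = n -> uniq l ->
  (forall i j : 'I_n, G (nth x0 l i) (nth x0 l j) = F i j) -> induced_subgraph F G.
Proof.
move=> sl U H; exists (fun i : 'I_n => nth x0 l i); split=> // i j /eqP.
by rewrite nth_uniq ?sl // => /eqP/val_inj.
Qed.

Lemma claw_freeE : induced_free K13 G -> forall c a b d, G c a -> G c b -> G c d ->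
  a != b -> a != d -> b != d -> [|| G a b, G a d | G b d].
Proof.
move=> free c a b d ca cb cd ab ad bd; apply: contraT; rewrite !negb_or => /and3P[nab nad nbd].
have ne u v : G u v -> u != v by apply: contraTneq => ->; rewrite adj_irr.
case: free; apply: (@induced_seq _ _ c [:: c; a; b; d]) => //.
  by rewrite /= !inE !negb_or ab ad bd !ne.
move: nab nad nbd => /negbTE nab /negbTE nad /negbTE nbd.
case=> [[|[|[|[|i]]]] hi] // [[|[|[|[|j]]]] hj] //=;
  by rewrite ?adj_irr ?ca ?cb ?cd ?nab ?nad ?nbd // adj_sym ?ca ?cb ?cd ?nab ?nad ?nbd.
Qed.

Lemma bull_freeE : induced_free B11 G -> forall a b c p q,
  G a b -> G a c -> G b c -> G p a -> G p b = false -> G p c = false ->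
  G q b -> G q a = false -> G q c = false -> G p q = false -> False.
Proof.
move=> free a b c p q ab ac bc pa pb pc qb qa qc pq.
have ne u v : G u v -> u != v by apply: contraTneq => ->; rewrite adj_irr.
case: free; apply: (@induced_seq _ _ a [:: a; b; c; p; q]) => //.
  have nap : a != p by rewrite eq_sym ne.
  have naq : a != q by apply: contraFneq qc => <-.
  have nbp : b != p by apply: contraFneq pc => <-.
  have nbq : b != q by rewrite eq_sym ne.
  have ncp : c != p by apply: contraFneq pb => <-; rewrite adj_sym.
  have ncq : c != q by apply: contraFneq qa => <-; rewrite adj_sym.
  have npq : p != q by apply: contraFneq pb => ->.
  by rewrite /= !inE !negb_or nap naq nbp nbq ncp ncq npq !ne.
case=> [[|[|[|[|[|i]]]]] hi] // [[|[|[|[|[|j]]]]] hj] //=;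
  by rewrite ?adj_irr ?ab ?ac ?bc ?pa ?pb ?pc ?qb ?qa ?qc ?pq //
    adj_sym ?ab ?ac ?bc ?pa ?pb ?pc ?qb ?qa ?qc ?pq.
Qed.

End Forbidden.

Section LongPaths.
Variables (V : finType) (G : sgraph V).
Hypothesis kc : k_connected 3 G.
Hypothesis claw : forall c a b d, G c a -> G c b -> G c d ->
  a != b -> a != d -> b != d -> [|| G a b, G a d | G b d].
Hypothesis bull : forall a b c p q,
  G a b -> G a c -> G b c -> G p a -> G p b = false -> G p c = false ->
  G q b -> G q a = false -> G q c = false -> G p q = false -> False.

Let GC u v : G u v = G v u. Proof. exact: adj_sym. Qed.
Let ne u v : G u v -> u != v.
Proof. by apply: contraTneq => ->; rewrite adj_irr. Qed.

Lemma clawF c a b d : G c a -> G c b -> G c d -> a != b -> a != d -> b != d ->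
  G a b = false -> G a d = false -> G b d = false -> False.
Proof. by move=> ca cb cd ab ad bd h1 h2 h3; have := claw ca cb cd ab ad bd; rewrite h1 h2 h3. Qed.

Lemma leave_set (A : {set V}) u v : u \in A -> v \notin A ->
  exists a b, [/\ a \in A, b \notin A & G a b].
Proof.
move=> uA vA; have := @cut_edge _ G A finset.set0 u v kc.
rewrite cards0 !inE => /(_ isT uA isT vA isT)[a [b [aA _ bA _ gab]]].
by exists a, b.
Qed.

(** * Induced paths, and the first one on five vertices *)

Definition ipath k (p : nat -> V) :=
  (forall i j, i < k -> j < k -> p i = p j -> i = j) /\
  (forall i j, i < k -> j < k -> G (p i) (p j) = (i == j.+1) || (j == i.+1)).

Lemma ipath5 v0 v1 v2 v3 v4 :
  G v0 v1 -> G v1 v2 -> G v2 v3 -> G v3 v4 ->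
  G v0 v2 = false -> G v0 v3 = false -> G v0 v4 = false ->
  G v1 v3 = false -> G v1 v4 = false -> G v2 v4 = false -> 
  v0 != v2 -> v0 != v3 -> v0 != v4 -> v1 != v3 -> v1 != v4 -> v2 != v4 ->
  exists p, ipath 5 p.
Proof.
move=> g01 g12 g23 g34 g02 g03 g04 g13 g14 g24 n02 n03 n04 n13 n14 n24.
exists (nth v0 [:: v0; v1; v2; v3; v4]); split.
  move=> i j hi hj /eqP; rewrite nth_uniq //; first by move/eqP.
  by rewrite /= !inE !negb_or n02 n03 n04 n13 n14 n24 !ne.
case=> [|[|[|[|[|i]]]]] // [|[|[|[|[|j]]]]] //= _ _;
  by rewrite ?adj_irr ?g01 ?g12 ?g23 ?g34 ?g02 ?g03 ?g04 ?g13 ?g14 ?g24 //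
    GC ?g01 ?g12 ?g23 ?g34 ?g02 ?g03 ?g04 ?g13 ?g14 ?g24.
Qed.

(** An edge [w' w] leads from the vertices far from the path [a u b] to those that see it. Claws and
    bulls exclude everything except that [w] sees exactly one vertex of the path, an end, and there
    [w] and [w'] prolong it. *)
Lemma far_ipath5 a u b c : G a u -> G u b -> G a b = false -> a != b ->
  G c a = false -> G c u = false -> G c b = false -> c != a -> c != u -> c != b ->
  exists p, ipath 5 p.
Proof.
move=> au ub nab ab ca cu cb nca ncu ncb.
pose far := [set v | [&& v != a, v != u, v != b, ~~ G v a, ~~ G v u & ~~ G v b]].
have cF : c \in far by rewrite inE nca ncu ncb ca cu cb.
have aF : a \notin far by rewrite inE eqxx.
have [w' [w [w'F wF w'w]]] := leave_set cF aF.
move: w'F; rewrite inE => /and5P[w'a w'u w'b /negbTE gw'a /andP[/negbTE gw'u /negbTE gw'b]].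
have wa : w != a by apply: contraTneq w'w => ->; rewrite gw'a.
have wu : w != u by apply: contraTneq w'w => ->; rewrite gw'u.
have wb : w != b by apply: contraTneq w'w => ->; rewrite gw'b.
move: wF; rewrite inE wa wu wb /= -!negb_or negbK => wF.
have ww' : G w w' by rewrite GC.
have nba : G b a = false by rewrite GC.
have [ba aw'] : b != a /\ a != w' by split; rewrite eq_sym.
have bw' : b != w' by rewrite eq_sym.
have [ua bu] : G u a /\ G b u by split; rewrite GC.
have nboth : ~ (G w a /\ G w b).
  by case=> ga gb; apply: (@clawF w a b w') => //; rewrite GC.
case wu': (G w u).
  case ga: (G w a).
    case gb: (G w b); first by case: nboth.
    by case: (@bull w u a w' b) => //; rewrite GC.
  case gb: (G w b); first by case: (@bull w u b w' a) => //; rewrite GC.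
  by case: (@clawF u a b w) => //; rewrite 1?GC // eq_sym.
case ga: (G w a).
  have gb : G w b = false by apply/negbTE/negP => gb; apply: nboth.
  by apply: (@ipath5 w' w a u b).
case gb: (G w b); last by move: wF; rewrite ga gb wu'.
by apply: (@ipath5 w' w b u a).
Qed.

(** An edge [v' w] leaves the closed neighbourhood of [a]. If [v'] sees one of [b], [c], the other
    is far from the path through [v']; otherwise the path is [a v' w], and the absence of a claw at
    [w] makes [b] or [c] far from it. *)
Lemma indep3_ipath5 a b c : a != b -> a != c -> b != c ->
  G a b = false -> G a c = false -> G b c = false -> exists p, ipath 5 p.
Proof.
move=> ab ac bc gab gac gbc.
have [|| v' [w [vA wA vw]]] := @leave_set [set v | (v == a) || G a v] a b.
- by rewrite inE eqxx.
- by rewrite inE eq_sym (negbTE ab) gab.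
move: wA; rewrite inE negb_or => /andP[wa /negbTE aw].
have av : G a v'.
  by move: vA; rewrite inE => /orP[/eqP E|//]; move: vw; rewrite E aw.
have aw' : a != w by rewrite eq_sym.
have [ba ca] : b != a /\ c != a by split; rewrite eq_sym.
have cb : c != b by rewrite eq_sym.
have [gba gca] : G b a = false /\ G c a = false by split; rewrite GC.
have gcb : G c b = false by rewrite GC.
have bv : b != v' by apply: contraFneq gab => ->.
have cv : c != v' by apply: contraFneq gac => ->.
case gvb: (G v' b).
  apply: (@far_ipath5 a v' b c) => //.
  apply/negbTE/negP => gcv; apply: (@clawF v' a b c) => //; by rewrite GC.
case gvc: (G v' c).
  apply: (@far_ipath5 a v' c b) => //; by rewrite GC gvb.
have bw : b != w by apply: contraFneq gvb => ->.
have cw : c != w by apply: contraFneq gvc => ->.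
case gbw: (G b w); last by apply: (@far_ipath5 a v' w b) => //; rewrite GC.
case gcw: (G c w); last by apply: (@far_ipath5 a v' w c) => //; rewrite GC.
by case: (@clawF w v' b c) => //; rewrite 1?GC // eq_sym.
Qed.

Lemma ipath_size k p : ipath k p -> k <= #|V|.
Proof.
case=> inj _; rewrite -[k]card_ord; apply: (@leq_card _ _ (fun i : 'I_k => p i)) => i j e.
apply: val_inj; apply: (inj _ _ (ltn_ord i) (ltn_ord j)); exact: e.
Qed.

Lemma longest_ipath k0 p0 : ipath k0 p0 ->
  exists k p, [/\ k0 <= k, ipath k p & forall q, ~ ipath k.+1 q].
Proof.
move=> ip; have [n] := ubnP (#|V| - k0); elim: n k0 p0 ip => // n IH k0 p0 ip lt.
case: (EM (exists q, ipath k0.+1 q)) => [[q iq]|no].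
  have [|k [p [h1 h2 h3]]] := IH _ _ iq.
    by have := ipath_size iq; move: lt; clear; lia.
  by exists k, p; split=> //; apply: ltnW.
by exists k0, p0; split=> // q iq; apply: no; exists q.
Qed.

Definition near (i j : nat) := (i <= j.+1) && (j <= i.+1).

Lemma near_sym i j : near i j = near j i. Proof. by rewrite /near andbC. Qed.

(** * The structure around a longest induced path *)

Section Maximal.
Variables (k : nat) (p : nat -> V).
Hypothesis k5 : 4 < k.
Hypothesis ip : ipath k p.
Hypothesis mx : forall q, ~ ipath k.+1 q.

Definition off (q : nat -> V) w := forall j, j < k -> w != q j.

(** Stated, like [no_rcons], for every induced path of maximal length, because it is also applied to
    [p] with one vertex replaced. *)
Lemma no_cons q w : ipath k q -> off q w -> ~ (forall j, j < k -> G w (q j) = (j == 0)).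
Proof.
move=> [inj adj] ow Gw; case: (mx (q := fun j => if j is j'.+1 then q j' else w)); split.
  case=> [|i] [|j] //= hi hj; first by move=> e; have := ow j hj; rewrite e eqxx.
    by move=> e; have := ow i hi; rewrite e eqxx.
  by move=> e; congr S; apply: inj.
case=> [|i] [|j] //= hi hj; first by rewrite adj_irr.
- by rewrite Gw // eq_sym; case: j {hj}.
- by rewrite GC Gw // eqSS orbF.
- by rewrite adj.
Qed.

Lemma no_rcons q w : ipath k q -> off q w -> ~ (forall j, j < k -> G w (q j) = (j == k.-1)).
Proof.
move=> [inj adj] ow Gw; case: (mx (q := fun j => if j < k then q j else w)); split.
  move=> i j hi hj; case: ltnP => hi'; case: ltnP => hj'.
  - exact: inj.
  - by move=> e; have := ow i hi'; rewrite e eqxx.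
  - by move=> e; have := ow j hj'; rewrite e eqxx.
  - by move=> _; move: hi hj hi' hj'; clear; lia.
move=> i j hi hj; case: ltnP => hi'; case: ltnP => hj'.
- exact: adj.
- by rewrite GC Gw //; move: hi hj hi' hj' k5; clear; lia.
- by rewrite Gw //; move: hi hj hi' hj' k5; clear; lia.
- by rewrite adj_irr; move: hi hj hi' hj'; clear; lia.
Qed.

Lemma replace_ipath i a : i < k -> off p a -> (forall j, j < k -> G a (p j) = near i j) ->
  ipath k (fun j => if j == i then a else p j).
Proof.
case: ip => inj adj ik oa Ga; split=> u v hu hv; case: eqP => [->|nu]; case: eqP => [->|nv] //.
- by move=> e; have := oa v hv; rewrite e eqxx.
- by move=> e; have := oa u hu; rewrite e eqxx.
- exact: inj.
- by rewrite adj_irr; clear; lia.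
- by rewrite Ga // /near; move: nv; clear; lia.
- by rewrite GC Ga // /near; move: nu; clear; lia.
- exact: adj.
Qed.

Let pG i j : i < k -> j < k -> G (p i) (p j) = (i == j.+1) || (j == i.+1).
Proof. by case: ip => _; apply. Qed.

Let pF i j : i < k -> j < k -> (i.+1 < j) || (j.+1 < i) -> G (p i) (p j) = false.
Proof. by move=> hi hj h; rewrite pG //; move: h; clear; lia. Qed.

Let pN i j : i < k -> j < k -> i != j -> p i != p j.
Proof. by move=> hi hj; apply: contraNneq => e; apply/eqP; case: ip => inj _; apply: inj. Qed.

Let pA i j : i < k -> j < k -> (i == j.+1) || (j == i.+1) -> G (p i) (p j).
Proof. by move=> hi hj; rewrite pG. Qed.

(** A twin of [p i] relative to the path, adjacent to [p i] as well since [near i i] holds. *)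
Definition cls w i := forall j, j < k -> G w (p j) = near i j.
Definition wrap w := forall j, j < k -> G w (p j) = (j == 0) || (j == k.-1).

Lemma clsT w i j : cls w i -> j < k -> near i j -> G w (p j).
Proof. by move=> c hj; rewrite c. Qed.
Lemma clsF w i j : cls w i -> j < k -> ~~ near i j -> G w (p j) = false.
Proof. by move=> c hj /negbTE; rewrite c. Qed.
Lemma wrapT w j : wrap w -> j < k -> (j == 0) || (j == k.-1) -> G w (p j).
Proof. by move=> c hj; rewrite c. Qed.
Lemma wrapF w j : wrap w -> j < k -> ~~ ((j == 0) || (j == k.-1)) -> G w (p j) = false.
Proof. by move=> c hj /negbTE; rewrite c. Qed.

Ltac idx :=
  first [ assumption
        | rewrite /near; generalize k5;
          repeat match goal with
                 | H : is_true (leq _ _) |- _ => revert H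
                 | H : is_true (orb (leq _ _) _) |- _ => revert H
                 end; clear; lia ].

Ltac adjs :=
  first
  [ assumption | by rewrite GC
  | by apply: pA; idx | by apply: pF; idx | by apply: pN; idx
  | match goal with
    | H : off p ?w |- is_true (?w != _) => by apply: H; idx
    | H : off p ?w |- is_true (_ != ?w) => by rewrite eq_sym; apply: H; idx
    | H : cls ?w _ |- is_true (adj G ?w _) => by apply: (clsT H); idx
    | H : cls ?w _ |- is_true (adj G _ ?w) => by rewrite GC; apply: (clsT H); idx
    | H : cls ?w _ |- adj G ?w _ = false => by apply: (clsF H); idx
    | H : cls ?w _ |- adj G _ ?w = false => by rewrite GC; apply: (clsF H); idx
    | H : wrap ?w |- is_true (adj G ?w _) => by apply: (wrapT H); idx
    | H : wrap ?w |- is_true (adj G _ ?w) => by rewrite GC; apply: (wrapT H); idx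
    | H : wrap ?w |- adj G ?w _ = false => by apply: (wrapF H); idx
    | H : wrap ?w |- adj G _ ?w = false => by rewrite GC; apply: (wrapF H); idx
    end
  | by rewrite eq_sym ].

Lemma claw_mid w i : off p w -> i.+2 < k -> G w (p i.+1) -> G w (p i) || G w (p i.+2).
Proof.
move=> ow hi gw; apply: contraT; rewrite negb_or => /andP[/negbTE n1 /negbTE n2].
by case: (@clawF (p i.+1) (p i) (p i.+2) w); adjs.
Qed.

Lemma bull_mid w i : off p w -> i.+3 < k -> G w (p i.+1) -> G w (p i.+2) ->
  G w (p i) || G w (p i.+3).
Proof.
move=> ow hi g1 g2; apply: contraT; rewrite negb_or => /andP[/negbTE n1 /negbTE n2].
by case: (@bull (p i.+1) (p i.+2) w (p i) (p i.+3)); adjs.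
Qed.

Lemma claw_out w i j l : i.+1 < j -> j.+1 < l -> l < k ->
  G w (p i) -> G w (p j) -> G w (p l) -> False.
Proof. by move=> ij jl lk gi gj gl; apply: (@clawF w (p i) (p j) (p l)); adjs. Qed.

Lemma bull_right w i j : i.+2 < k -> j < k -> (j.+1 < i) || (i.+3 < j) ->
  G w (p i) -> G w (p i.+1) -> G w (p i.+2) = false -> G w (p j) -> False.
Proof.
by move=> hi hj far gi g1 n2 gj; apply: (@bull w (p i.+1) (p i) (p j) (p i.+2)); adjs.
Qed.

Lemma bull_left w i j : i.+2 < k -> j < k -> (j.+1 < i) || (i.+3 < j) ->
  G w (p i.+1) -> G w (p i.+2) -> G w (p i) = false -> G w (p j) -> False.
Proof.
by move=> hi hj far g1 g2 n0 gj; apply: (@bull w (p i.+1) (p i.+2) (p j) (p i)); adjs.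
Qed.

(** The neighbours of [w] are followed from the first one on. After an inner first neighbour, a claw
    forces the next vertex, a bull the one after it if there is one, and nothing beyond is possible.
    If [w] sees [p 0] but not [p 1], its next neighbour has to be the last vertex. *)
Lemma pattern w : off p w -> (exists2 j, j < k & G w (p j)) ->
  (exists2 i, i < k & cls w i) \/ wrap w.
Proof.
move=> ow ex.
have [i0 [hi0 gi0 min0]] : exists i0, [/\ i0 < k, G w (p i0) & forall j, j < i0 -> G w (p j) = false].
  have ex' : exists j, (j < k) && G w (p j) by case: ex => j h1 h2; exists j; rewrite h1.
  case: (ex_minnP ex') => m /andP[m1 m2] mm; exists m; split=> // j jm.
  apply/negbTE/negP => gj; have := mm j; rewrite gj (ltn_trans jm m1) => /(_ isT).
  by move: jm; clear; lia.
case: i0 hi0 gi0 min0 => [|i] hi0 gi0 min0; last first.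
  left; case: (ltnP i.+2 k) => h2; last first.
    case: (no_rcons ip ow) => j hj; case: (ltngtP j i.+1) => c.
    - by rewrite min0 //; move: c h2 hi0; clear; lia.
    - by move: c h2 hj; clear; lia.
    - by rewrite c gi0; move: h2 hi0; clear; lia.
  have ni : G w (p i) = false by apply: min0.
  have g2 : G w (p i.+2) by have := claw_mid ow h2 gi0; rewrite ni.
  case: (ltnP i.+3 k) => h3; last first.
    (* The twin comes one after the first neighbour; here it is the last vertex of the path. *)
    exists i.+2 => // j hj; case: (ltnP j i.+1) => c.
      by rewrite min0 // /near; move: c; clear; lia.
    have : (j == i.+1) || (j == i.+2) by move: c hj h3; clear; lia.
    by case/orP=> /eqP->; rewrite ?gi0 ?g2 /near; clear; lia.
  have g3 : G w (p i.+3) by have := bull_mid ow h3 gi0 g2; rewrite ni.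
  exists i.+2 => // j hj; case: (ltnP j i.+1) => c.
    by rewrite min0 // /near; move: c; clear; lia.
  case: (ltnP i.+3 j) => c'.
    have -> : near i.+2 j = false by rewrite /near; move: c'; clear; lia.
    by apply/negbTE/negP => gj; apply: (@bull_left w i j) => //; rewrite c' orbT.
  have : [|| j == i.+1, j == i.+2 | j == i.+3] by move: c c'; clear; lia.
  by case/or3P=> /eqP->; rewrite ?gi0 ?g2 ?g3 /near; clear; lia.
have lt n : n < 5 -> n < k by move=> h; apply: leq_trans h k5.
case g1: (G w (p 1)).
  left; case g2: (G w (p 2)).
    have g4 j : 3 < j -> j < k -> G w (p j) = false.
      by move=> h hj; apply/negbTE/negP => gj; apply: (@claw_out w 0 2 j).
    exists 1; first exact: lt.
    move=> [|[|[|[|j]]]] hj; [by rewrite gi0|by rewrite g1|by rewrite g2| |by rewrite g4].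
    change (G w (p 3) = false).
    by apply/negbTE/negP => g3; apply: (@bull_right w 2 0) => //; rewrite ?lt ?g4 ?lt.
  have g4 j : 3 < j -> j < k -> G w (p j) = false.
    by move=> h hj; apply/negbTE/negP => gj; apply: (@bull_right w 0 j) => //; rewrite lt.
  exists 0; first exact: lt.
  move=> [|[|[|[|j]]]] hj; [by rewrite gi0|by rewrite g1|by rewrite g2| |by rewrite g4].
  change (G w (p 3) = false).
  apply/negbTE/negP => g3; have := @claw_mid w 2 ow (lt 4 isT) g3.
  by rewrite g2 (g4 4 isT (lt 4 isT)).
case: (boolP [exists j : 'I_k, (0 < j) && G w (p j)]) => [/existsP ex'|]; last first.
  rewrite negb_exists => /forallP no; case: (no_cons ip ow) => -[|j] hj //.
  by have := no (Ordinal hj); rewrite /= => /negbTE->.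
right.
have [i1 [/andP[hi1 lt1] gi1 min1]] : exists i1, [/\ (0 < i1) && (i1 < k), G w (p i1) &
    forall j, 0 < j -> j < i1 -> G w (p j) = false].
  have ex2 : exists j, [&& 0 < j, j < k & G w (p j)].
    by case: ex' => j /andP[h1 h2]; exists j; rewrite h1 ltn_ord.
  case: (ex_minnP ex2) => m /and3P[m1 m2 m3] mm; exists m; rewrite m1 m2; split=> // j j0 jm.
  apply/negbTE/negP => gj; have := mm j; rewrite gj j0 (ltn_trans jm m2) => /(_ isT).
  by move: jm; clear; lia.
case: i1 hi1 lt1 gi1 min1 => [|[|i]] // _ lt1 gi1 min1; first by rewrite g1 in gi1.
have ni : G w (p i.+1) = false by apply: min1.
case: (ltnP i.+3 k) => h3; last first.
  move=> j hj; case: (posnP j) => [->|j0]; first by rewrite gi0.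
  case: (ltnP j i.+2) => c.
    by rewrite min1 //; move: c j0 h3 lt1; clear; lia.
  have -> : j = i.+2 by move: c hj h3; clear; lia.
  by rewrite gi1; move: h3 lt1; clear; lia.
have g3 : G w (p i.+3) by have := @claw_mid w i.+1 ow h3 gi1; rewrite ni.
case: i lt1 gi1 min1 ni h3 g3 => [|i] lt1 gi1 min1 ni h3 g3.
  have g4 : G w (p 4) = false by apply/negbTE/negP => g4; apply: (@claw_out w 0 2 4); rewrite ?lt.
  by case: (@bull_right w 2 0); rewrite ?lt.
by case: (@bull_left w i.+2 0).
Qed.

(** An edge [a b] leaves the closed neighbourhood of the path. If [a] closes the path to a cycle or
    is a twin of an inner vertex, [b] completes a claw at [a]; if [a] is a twin of an end, it
    replaces this end and [b] lengthens the path. *)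
Lemma dominated w : off p w -> exists2 j, j < k & G w (p j).
Proof.
move=> ow; apply: contrapT => no.
have now j : j < k -> G w (p j) = false.
  by move=> hj; apply/negbTE/negP => g; apply: no; exists j.
have lt n : n < 5 -> n < k by move=> h; apply: leq_trans h k5.
pose A := [set v | [exists j : 'I_k, (v == p j) || G v (p j)]].
have p0A : p 0 \in A by rewrite inE; apply/existsP; exists (Ordinal (lt 0 isT)); rewrite eqxx.
have wA : w \notin A.
  rewrite inE negb_exists; apply/forallP => j; rewrite negb_or ow ?ltn_ord //.
  by rewrite now ?ltn_ord.
have [a [b [aA bA gab]]] := leave_set p0A wA.
have ob j : j < k -> b != p j /\ G b (p j) = false.
  move=> hj; move: bA; rewrite inE negb_exists => /forallP/(_ (Ordinal hj)).
  by rewrite negb_or /= => /andP[-> /negbTE->].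
have oa : off p a.
  by move=> j hj; apply: contraTneq gab => ->; rewrite GC; have [_ ->] := ob j hj.
have ea : exists2 j, j < k & G a (p j).
  move: aA; rewrite inE => /existsP[j /orP[/eqP E|g]]; last by exists j.
  by have := oa j (ltn_ord j); rewrite E eqxx.
have obf q : (forall j, j < k -> q j = a \/ exists2 i, i < k & q j = p i) -> off q b.
  move=> h j hj; case: (h j hj) => [->|[i hi ->]]; first by rewrite eq_sym ne.
  by case: (ob i hi).
case: (pattern oa ea) => [[i hi ci]|wr]; last first.
  have l0 : 0 < k by apply: lt.
  have lk : k.-1 < k by move: k5; clear; lia.
  apply: (@clawF a (p 0) (p k.-1) b) => //; rewrite ?wr ?eqxx ?orbT ?pN //.
  - by move: k5; clear; lia.
  - by rewrite eq_sym; case: (ob 0 l0).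
  - by rewrite eq_sym; case: (ob k.-1 lk).
  - by rewrite pF //; move: k5; clear; lia.
  - by rewrite GC; case: (ob 0 l0).
  - by rewrite GC; case: (ob k.-1 lk).
have ir := replace_ipath hi oa ci.
have orr : off (fun j => if j == i then a else p j) b.
  by apply: obf => j hj; case: ifP => _; [left | right; exists j].
have gb j : j < k -> G b (if j == i then a else p j) = (j == i).
  by move=> hj; case: ifP => _; [rewrite GC | case: (ob j hj)].
case: i hi ci ir orr gb => [|i] hi ci ir orr gb; first exact: no_cons ir orr gb.
case: (ltnP i.+2 k) => h2; last first.
  by apply: (no_rcons ir orr) => j hj; rewrite gb //; move: hi h2 hj; clear; lia.
have h0 : i < k by move: h2; clear; lia.
apply: (@clawF a (p i) (p i.+2) b) => //; rewrite ?ci ?pN //.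
- by rewrite /near; clear; lia.
- by rewrite /near; clear; lia.
- by clear; lia.
- by rewrite eq_sym; case: (ob i h0).
- by rewrite eq_sym; case: (ob i.+2 h2).
- by rewrite pF //; clear; lia.
- by rewrite GC; case: (ob i h0).
- by rewrite GC; case: (ob i.+2 h2).
Qed.

(** Here and in the lemmas up to [wrap_far], a wrong adjacency produces a claw or a bull with path
    vertices. Where the path is too short on the right, its five vertices leave room for the mirror
    image. *)
Lemma cls_same w w' i : i < k -> off p w -> off p w' -> cls w i -> cls w' i -> w != w' -> G w w'.
Proof.
move=> hi ow ow' cw cw' ww; apply: contraT => /negbTE n.
case: (ltnP i.+2 k) => h2; first by case: (@clawF (p i.+1) w w' (p i.+2)); adjs.
case: i hi h2 cw cw' => [|[|i]] hi h2 cw cw'; try by move: h2 k5; clear; lia.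
by case: (@clawF (p i.+1) w w' (p i)); adjs.
Qed.

Lemma cls_next w w' i : i.+1 < k -> cls w i -> cls w' i.+1 -> G w w'.
Proof.
move=> hi cw cw'; apply: contraT => /negbTE n.
case: (ltnP i.+3 k) => h3; first by case: (@bull (p i.+1) (p i.+2) w' w (p i.+3)); adjs.
case: i hi h3 cw cw' => [|[|i]] hi h3 cw cw'; try by move: h3 k5; clear; lia.
by case: (@bull (p i.+2) (p i.+1) w w' (p i)); adjs.
Qed.

Lemma cls_far w w' i j : i.+1 < j -> j < k -> off p w -> off p w' ->
  cls w i -> cls w' j -> G w w' = false.
Proof.
move=> ij hj ow ow' cw cw'; apply/negbTE/negP => g.
case: (ltnP i.+2 j) => ij2.
  case: (ltnP j.+1 k) => hj1.
    case: j ij hj cw' ij2 hj1 => [|j] // ij hj cw' ij2 hj1.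
    by apply: (@clawF w' w (p j) (p j.+2)); adjs.
  case: i ij cw ij2 => [|i] ij cw ij2; first by apply: (@bull w (p 1) (p 0) w' (p 2)); adjs.
  by apply: (@clawF w w' (p i) (p i.+2)); adjs.
case: (ltnP j.+2 k) => hj2; first by apply: (@bull w' (p j.+1) (p j) w (p j.+2)); adjs.
case: i ij cw ij2 => [|[|i]] ij cw ij2.
- by move: ij ij2 hj2 k5; clear; lia.
- by apply: (@bull w w' (p 2) (p 0) (p 4)); adjs.
- by apply: (@bull w (p i.+1) (p i.+2) w' (p i)); adjs.
Qed.

Lemma wrap_same w w' : off p w -> off p w' -> wrap w -> wrap w' -> w != w' -> G w w'.
Proof.
move=> ow ow' cw cw' ww; apply: contraT => /negbTE n.
by case: (@clawF (p 0) w w' (p 1)); adjs.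
Qed.

Lemma wrap_first w w' : wrap w -> cls w' 0 -> G w w'.
Proof.
move=> cw cw'; apply: contraT => /negbTE n.
by case: (@bull (p 0) (p 1) w' w (p 2)); adjs.
Qed.

Lemma wrap_last w w' : wrap w -> cls w' k.-1 -> G w w'.
Proof.
move=> cw cw'; apply: contraT => /negbTE n.
by case: (@bull (p k.-1) (p k.-2) w' w (p k.-1.-2)); adjs.
Qed.

Lemma wrap_far w w' i : off p w -> off p w' -> wrap w -> cls w' i -> 0 < i -> i.+1 < k ->
  G w w' = false.
Proof.
move=> ow ow' cw cw' i0 ik; apply/negbTE/negP => g.
case: i i0 ik cw' => [|[|i]] // _ ik cw'.
  by apply: (@bull w' w (p 0) (p 2) (p k.-1)); adjs.
case: (ltnP i.+4 k) => h4; first by apply: (@clawF w' (p i.+1) (p i.+3) w); adjs.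
by apply: (@bull w' w (p i.+3) (p i.+1) (p 0)); adjs.
Qed.

(** Equality or adjacency in the cycle 0, ..., m - 1. *)
Definition cyc m i j := [|| near i j, (i == 0) && (j == m.-1) | (j == 0) && (i == m.-1)].

(** The vertices that close the path form an additional class [k] between the classes of its ends;
    on classes below [k], [cyc k.+1] coincides with [near]. *)
Definition place w n := [\/ n < k /\ w = p n, [/\ off p w, n < k & cls w n] |
  [/\ off p w, n = k & wrap w]].

Lemma place_ex w : exists n, place w n.
Proof.
case: (EM (exists2 i, i < k & w = p i)) => [[i hi E]|no]; first by exists i; constructor 1.
have ow : off p w.
  by move=> j hj; apply/eqP => E; apply: no; exists j.
case: (pattern ow (dominated ow)) => [[i hi c]|c]; first by exists i; constructor 2.
by exists k; constructor 3.
Qed.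

Lemma place_le w n : place w n -> n <= k.
Proof. by case=> [[/ltnW]|[_ /ltnW]|[_ ->]]. Qed.

Lemma place_adj u v i j : place u i -> place v j -> u != v -> G u v = cyc k.+1 i j.
Proof.
wlog le : u v i j / i <= j.
  move=> H pu pv uv; case: (leqP i j) => [le|/ltnW le]; first exact: H.
  rewrite GC (H v u j i) // 1?eq_sym //.
  by rewrite /cyc near_sym; congr orb; rewrite orbC.
move=> pu pv uv; have kk : k.+1.-1 = k by [].
rewrite /cyc kk.
case: pv => [[hj Ev]|[ov hj cv]|[ov Ej cv]].
- have hi : i < k by apply: leq_ltn_trans hj.
  have -> : (j == k) = false by move: hj; clear; lia.
  have -> : (i == k) = false by move: hi; clear; lia.
  rewrite !andbF !orbF.
  case: pu => [[_ Eu]|[ou _ cu]|[_ Ei _]]; last by move: hi; rewrite Ei ltnn.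
    rewrite Eu Ev pG // /near.
    have : i != j by apply: contraNneq uv => E; rewrite Eu Ev E.
    by clear; lia.
  by rewrite Ev cu.
- have hi : i < k by apply: leq_ltn_trans hj.
  have -> : (j == k) = false by move: hj; clear; lia.
  have -> : (i == k) = false by move: hi; clear; lia.
  rewrite !andbF !orbF.
  case: pu => [[_ Eu]|[ou _ cu]|[_ Ei _]]; last by move: hi; rewrite Ei ltnn.
    by rewrite Eu GC cv // near_sym.
  case: (ltnP i.+1 j) => c.
    by rewrite (cls_far c hj ou ov cu cv) /near; move: c; clear; lia.
  have -> : near i j by rewrite /near; move: c le; clear; lia.
  move: c le; rewrite leq_eqVlt => /orP[/eqP E _|c le]; last first.
    have E : i = j by move: c le; clear; lia.
    by apply: (cls_same hi) => //; rewrite E.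
  by apply: (@cls_next u v i); rewrite -?E.
- move: Ej le => -> _; rewrite eqxx andbT.
  have -> : (k == 0) = false by move: k5; clear; lia.
  rewrite /= orbF.
  case: pu => [[hi Eu]|[ou hi cu]|[ou Ei cu]].
  + by rewrite Eu GC cv // /near; move: hi k5; clear; lia.
  + rewrite GC.
    case: (posnP i) => [E|i0]; first by rewrite orbT (@wrap_first v u) // -E.
    case: (ltnP i.+1 k) => c.
      by rewrite (wrap_far ov ou cv cu i0 c) /near; move: c i0; clear; lia.
    have E : i = k.-1 by move: c hi; clear; lia.
    rewrite (@wrap_last v u) -?E // /near; move: c hi; clear; lia.
  + by rewrite Ei /near leqnSn (wrap_same ou ov cu cv uv).
Qed.

Lemma blowup : exists m (f : V -> nat), [/\ 4 < m, forall v, f v < m,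
  forall i, i < m -> exists v, f v = i &
  (forall u v, u != v -> G u v = near (f u) (f v)) \/
  5 < m /\ (forall u v, u != v -> G u v = cyc m (f u) (f v))].
Proof.
have [f fP] := choice place_ex.
have fp i : i < k -> f (p i) = i.
  move=> hi; case: (fP (p i)) => [[hn]|[oi _ _]|[oi _ _]].
  - by case: ip => inj _ /(inj _ _ hi hn).
  - by have := oi i hi; rewrite eqxx.
  - by have := oi i hi; rewrite eqxx.
case: (EM (exists w, f w = k)) => [[w fw]|no].
  exists k.+1, f; split; first exact: ltnW.
  - by move=> v; rewrite ltnS; apply: place_le (fP v).
  - move=> i; rewrite ltnS leq_eqVlt => /orP[/eqP->|hi]; first by exists w.
    by exists (p i); apply: fp.
  - by right; split=> // u v uv; apply: place_adj.
have lt v : f v < k.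
  by rewrite ltn_neqAle (place_le (fP v)) andbT; apply/eqP => E; apply: no; exists v.
exists k, f; split=> //; first by move=> i hi; exists (p i); apply: fp.
left=> u v uv; rewrite (place_adj (fP u) (fP v) uv) /cyc /=.
have -> : (f v == k) = false by have := lt v; clear; lia.
have -> : (f u == k) = false by have := lt u; clear; lia.
by rewrite !andbF !orbF.
Qed.

End Maximal.
End LongPaths.

(** * Clique blow-ups of paths and cycles *)

Section Blocks.
Variables (V : finType) (f : V -> nat).
Implicit Types (g : nat -> seq V).

Definition blocks g a n := flatten [seq g i | i <- iota a n].

Lemma blocksS g a n : blocks g a n.+1 = g a ++ blocks g a.+1 n.
Proof. by []. Qed.

Lemma count_blocks g a n v : (forall i u, a <= i < a + n -> u \in g i -> f u = i) ->
  count_mem v (blocks g a n) = (a <= f v < a + n) * count_mem v (g (f v)).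
Proof.
elim: n a => [|n IH] a H.
  by have -> : a <= f v < a + 0 = false by clear; lia.
rewrite blocksS count_cat IH; last first.
  by move=> i u h; apply: H; move: h; clear; lia.
case: (eqVneq (f v) a) => E.
  rewrite E ltnn mul0n addn0.
  have -> : a <= a < a + n.+1 by clear; lia.
  by rewrite mul1n.
have -> : count_mem v (g a) = 0.
  apply/count_memPn/negP => vg; move: E; rewrite (H a v) ?eqxx //; clear; lia.
by rewrite add0n; congr (nat_of_bool _ * _); move: E; clear; lia.
Qed.

Lemma size_blocks g a n : (forall i, a <= i < a + n -> 0 < size (g i)) ->
  n <= size (blocks g a n).
Proof.
elim: n a => // n IH a H; rewrite blocksS size_cat.
have := H a; rewrite leqnn addnS ltnS leq_addr => /(_ isT) h.
have : n <= size (blocks g a.+1 n).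
  by apply: IH => i hi; apply: H; move: hi; clear; lia.
by move: h; clear; lia.
Qed.

Lemma head_blocks g a n x : 0 < n -> 0 < size (g a) -> head x (blocks g a n) \in g a.
Proof. by case: n => // n _; rewrite blocksS; case: (g a) => //= y l _; rewrite inE eqxx. Qed.

Lemma last_blocks g a n x : 0 < n -> 0 < size (g (a + n.-1)) ->
  last x (blocks g a n) \in g (a + n.-1).
Proof.
elim: n a x => // -[|n] IH a x _ h; rewrite blocksS last_cat.
  by move: h; rewrite addn0; case: (g a) => //= y l _; apply: mem_last.
by have := IH a.+1 (last x (g a)) isT; rewrite /= addSnnS; apply.
Qed.

Lemma sorted_blocks (e : rel V) g a n :
  (forall i, a <= i < a + n -> 0 < size (g i) /\ sorted e (g i)) ->
  (forall i u v, a <= i -> i.+1 < a + n -> u \in g i -> v \in g i.+1 -> e u v) ->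
  sorted e (blocks g a n).
Proof.
elim: n a => // n IH a H1 H2; rewrite blocksS.
have [h0 h1] : 0 < size (g a) /\ sorted e (g a) by apply: H1; clear; lia.
have srt : sorted e (blocks g a.+1 n).
  apply: IH => [i hi|i u v hi hi']; first by apply: H1; move: hi; clear; lia.
  by apply: H2; move: hi hi'; clear; lia.
case eg: (g a) h0 h1 => [//|x l] _ /= h1; rewrite cat_path h1 /=.
case: n IH H1 H2 srt => [|n] IH H1 H2 srt //.
have ga : 0 < size (g a.+1) by have [] := H1 a.+1 => //; clear; lia.
have := @head_blocks g a.+1 n.+1 x isT ga.
case: (blocks g a.+1 n.+1) srt => //= y l' srt hy; rewrite srt andbT.
by apply: (H2 a) => //; [clear; lia | rewrite eg mem_last].
Qed.

End Blocks.

(* [f v] is the class of [v] and [E] the adjacency of classes; [phi] sends a class to the position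
   of its parent in the spine, which starts in class [a]. *)
Lemma blocks_caterpillar (V : finType) (G : sgraph V) (f : V -> nat) (E : nat -> nat -> Prop)
    (s : nat -> V) (gu gl : nat -> seq V) (phi : nat -> nat) a q au nu al nl :
  (forall u v, u != v -> E (f u) (f v) -> G u v) -> (forall i, E i i) -> (forall i, E i i.+1) ->
  0 < nu -> 0 < nl -> 2 < nu + nl ->
  (forall i, a <= i < a + q -> f (s i) = i) ->
  (forall i u, u \in gu i -> f u = i) -> (forall i u, u \in gl i -> f u = i) ->
  (forall i, au <= i < au + nu -> 0 < size (gu i)) ->
  (forall i, al <= i < al + nl -> 0 < size (gl i)) ->
  (forall v, (a <= f v < a + q) * count_mem v [:: s (f v)] +
     ((au <= f v < au + nu) * count_mem v (gu (f v)) +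
      (al <= f v < al + nl) * count_mem v (gl (f v))) = 1) ->
  au != al -> E au al ->
  au + nu.-1 != al + nl.-1 -> E (au + nu.-1) (al + nl.-1) ->
  (forall v, phi (f v) < q /\ E (f v) (a + phi (f v))) ->
  (forall i, au <= i -> i.+1 < au + nu -> phi i <= phi i.+1) ->
  (forall i, al <= i -> i.+1 < al + nl -> phi i <= phi i.+1) ->
  (forall i, i < q -> exists t, [/\ uniq t,
     forall v, v \in t -> phi (f v) = i /\ (a <= f v < a + q -> v != s (f v)) &
     2 < (0 < i) + (i.+1 < q) + size t]) ->
  has_caterpillar G.
Proof.
move=> GE E0 E1 nu0 nl0 nn fs fu fl su sl cnt hd Ehd lst Elst par phiu phil deg.
pose sp := [seq s i | i <- iota a q].
have spE : sp = blocks (fun i => [:: s i]) a q by rewrite /blocks flatten_map1.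
have cnt1 v : count_mem v (sp ++ blocks gu au nu ++ blocks gl al nl) = 1.
  rewrite !count_cat spE !(count_blocks (f := f)) //.
  - by move=> i u _; apply: fl.
  - by move=> i u _; apply: fu.
  - by move=> i u hi; rewrite inE => /eqP->; apply: fs.
have U := count1_uniq cnt1; have A := count1_mem cnt1.
have ubl : uniq (blocks gu au nu ++ blocks gl al nl).
  by move: U; rewrite cat_uniq => /and3P[].
have blk_sorted g b n : uniq (blocks g b n) -> (forall i u, u \in g i -> f u = i) ->
    (forall i, b <= i < b + n -> 0 < size (g i)) -> sorted G (blocks g b n).
  move=> Ub fg sg.
  have Ug i : b <= i < b + n -> uniq (g i).
    move=> hi; have ig : i \in iota b n by rewrite mem_iota.
    move: Ub; rewrite /blocks; elim: (iota b n) ig {sg hi} => // j l IH; rewrite in_cons.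
    rewrite /= cat_uniq => /orP[/eqP-> /and3P[]//|il /and3P[_ _ h]]; exact: IH.
  apply: sorted_blocks => [i hi|i u v hi hi' ug vg].
    split; first exact: sg.
    apply: clique_sorted; first exact: Ug.
    by move=> u v ug vg uv; apply: GE => //; rewrite (fg _ _ ug) (fg _ _ vg).
  apply: GE; last by rewrite (fg _ _ ug) (fg _ _ vg).
  by apply/eqP => e; have := fg _ _ ug; rewrite e (fg _ _ vg); clear; lia.
have par_sorted g b n : (forall i u, u \in g i -> f u = i) ->
    (forall i, b <= i < b + n -> 0 < size (g i)) ->
    (forall i, b <= i -> i.+1 < b + n -> phi i <= phi i.+1) ->
    sorted leq (map (fun v => phi (f v)) (blocks g b n)).
  move=> fg sg mono; rewrite sorted_map; apply: sorted_blocks => [i hi|i u v hi hi' ug vg] /=.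
    split; first exact: sg.
    have : forall u, u \in g i -> f u = i by move=> u; apply: fg.
    case: (g i) => // x l h /=; apply/(pathP x) => j hj.
    rewrite /relpre /= (h (nth x (x :: l) j)) ?(h (nth x l j)) // ?in_cons ?mem_nth ?orbT //.
    by rewrite -in_cons mem_nth //= ltnW.
  by rewrite (fg _ _ ug) (fg _ _ vg); apply: mono.
exists sp, (blocks gu au nu), (blocks gl al nl), (fun v => phi (f v)).
have s1 := size_blocks su; have s2 := size_blocks sl.
have inr b n : 0 < n -> b <= b < b + n /\ b <= b + n.-1 < b + n by clear; lia.
have [ru1 ru2] := inr au nu nu0; have [rl1 rl2] := inr al nl nl0.
constructor=> //.
- apply/(sortedP (s 0)) => i; rewrite size_map size_iota => hi.
  rewrite !(nth_map 0) ?size_iota ?nth_iota ?(ltnW hi) //.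
  have [e1 e2] : f (s (a + i)) = a + i /\ f (s (a + i.+1)) = (a + i).+1.
    by rewrite addnS; split; apply: fs; move: hi; clear; lia.
  apply: GE; last by rewrite e1 e2.
  by apply/eqP => e; move: e2; rewrite -e e1; clear; lia.
- apply: blk_sorted => //; by move: ubl; rewrite cat_uniq => /andP[].
- apply: blk_sorted => //; by move: ubl; rewrite cat_uniq => /and3P[].
- by apply: leq_trans s1.
- by apply: leq_trans s2.
- by apply: leq_trans nn _; apply: leq_add.
- move=> x; have h1 := head_blocks x nu0 (su _ ru1); have h2 := head_blocks x nl0 (sl _ rl1).
  apply: GE; last by rewrite (fu _ _ h1) (fl _ _ h2).
  by apply: contraNneq hd => e; rewrite -(fu _ _ h1) -(fl _ _ h2) e.
- move=> x; have h1 := last_blocks x nu0 (su _ ru2); have h2 := last_blocks x nl0 (sl _ rl2).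
  apply: GE; last by rewrite (fu _ _ h1) (fl _ _ h2).
  by apply: contraNneq lst => e; rewrite -(fu _ _ h1) -(fl _ _ h2) e.
- move=> v vul; have [p1 p2] := par v; rewrite size_map size_iota; split=> //.
  have e : nth v sp (phi (f v)) = s (a + phi (f v)).
    by rewrite (nth_map 0) ?size_iota // nth_iota.
  have fsv : f (s (a + phi (f v))) = a + phi (f v) by apply: fs; move: p1; clear; lia.
  rewrite e; apply: GE; last by rewrite fsv.
  apply/eqP => e'; have : v \in sp by rewrite e' -e mem_nth // size_map size_iota.
  by move: U; rewrite cat_uniq => /and3P[_ /hasPn/(_ v vul)/negbTE-> _].
- exact: par_sorted.
- exact: par_sorted.
- move=> i; rewrite size_map size_iota => hi; have [t [Ut ht sz]] := deg i hi.
  apply: leq_trans sz _; rewrite leq_add2l -size_filter; apply: uniq_leq_size => // v vt.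
  have [h1 h2] := ht v vt; rewrite mem_filter h1 eqxx /=.
  have := A v; rewrite mem_cat => /orP[|//] /mapP[j]; rewrite mem_iota => hj e.
  by move: h2; rewrite e fs // eqxx => /(_ hj).
Qed.

Section Blowups.
Variables (V : finType) (G : sgraph V).
Hypothesis kc : k_connected 3 G.
Variables (m : nat) (f : V -> nat).
Hypothesis fm : forall v, f v < m.
Hypothesis fsurj : forall i, i < m -> exists v, f v = i.

Let cl i := [set v | f v == i].

(** Spine and lower row run through classes 1 to m - 2, the upper row through all classes. An inner
    class gives one vertex to the spine, one to the lower row and the others to the upper row; the
    end classes hang at the ends of the spine, which is the effect of [minn]. *)
Lemma path_blowup : 4 < m -> (forall u v, u != v -> G u v = near (f u) (f v)) ->
  has_caterpillar G.
Proof.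
move=> m5 adj.
(* An inner class of at most two vertices would be a cut between the lower and the higher
   classes. *)
have third i u w : 0 < i -> i.+1 < m -> exists v, [/\ f v = i, v != u & v != w].
  move=> i0 im; apply: contrapT => no.
  have Ci : #|cl i| < 3.
    apply: leq_ltn_trans (_ : #|[set u; w]| < 3); last by rewrite cards2; case: (u != w).
    apply: subset_leq_card; apply/fintype.subsetP => v; rewrite !inE => /eqP fv.
    by apply: contraT; rewrite negb_or => /andP[h1 h2]; case: no; exists v.
  have [x fx] : exists v, f v = 0 by apply: fsurj; move: m5; clear; lia.
  have [y fy] : exists v, f v = m.-1 by apply: fsurj; move: m5; clear; lia.
  have [||||a [b []]] := @cut_edge _ G [set v | f v < i] (cl i) x y kc Ci; rewrite ?inE ?fx ?fy //.
  - by move: i0; clear; lia.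
  - by move: im; clear; lia.
  - by move: im; clear; lia.
  move=> h1 h2 h3 h4; apply/negP.
  have ab : a != b by apply: contraTneq h1 => ->; rewrite h3.
  by rewrite adj // /near; move: h1 h3 h4; clear; lia.
have [x0 _] : exists v, f v = 0 by apply: fsurj; move: m5; clear; lia.
have ex i : exists sl : V * V, 0 < i -> i.+1 < m ->
    [/\ f sl.1 = i, f sl.2 = i & sl.1 != sl.2].
  case: (boolP ((0 < i) && (i.+1 < m))) => [/andP[i0 im]|n].
    have [s1 [e1 _ _]] := third i x0 x0 i0 im; have [s2 [e2 n2 _]] := third i s1 s1 i0 im.
    by exists (s1, s2) => _ _; rewrite /= eq_sym.
  by exists (x0, x0) => i0 im; move: n; rewrite i0 im.
have [sl slP] := choice ex.
pose L i := if (0 < i) && (i.+1 < m) then [:: (sl i).1; (sl i).2] else [::].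
have LU i : uniq (L i).
  rewrite /L; case: ifP => // /andP[i0 im]; have [_ _ n] := slP i i0 im.
  by rewrite /= inE n.
have Lsub i : {subset L i <= cl i}.
  rewrite /L; case: ifP => // /andP[i0 im] v; have [e1 e2 _] := slP i i0 im.
  by rewrite mem_seq2 inE => /orP[]/eqP->; rewrite ?e1 ?e2.
have block i : i < m -> exists v, v \in rest (cl i) (L i).
  move=> im; case: (boolP ((0 < i) && (i.+1 < m))) => h; rewrite /L.
    have /andP[i0 im'] := h; have [v [fv n1 n2]] := third i (sl i).1 (sl i).2 i0 im'.
    by exists v; rewrite h mem_rest mem_seq2 negb_or n1 n2 inE fv eqxx.
  by have [v fv] := fsurj im; exists v; rewrite (negbTE h) mem_rest inE fv eqxx.
apply: (@blocks_caterpillar V G f (fun i j => near i j) (fun i => (sl i).1)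
  (fun i => rest (cl i) (L i))
  (fun i => if (0 < i) && (i.+1 < m) then [:: (sl i).2] else [::])
  (fun i => minn i.-1 m.-2.-1) 1 m.-2 0 m 1 m.-2).
- by move=> u v uv; rewrite adj.
- by move=> i; rewrite /near leqnSn.
- by move=> i; rewrite /near; clear; lia.
- by move: m5; clear; lia.
- by move: m5; clear; lia.
- by move: m5; clear; lia.
- move=> i hi; have [//||//] := slP i; move: hi; clear; lia.
- by move=> i u; rewrite mem_rest inE => /andP[/eqP].
- move=> i u; case: ifP => // /andP[i0 im]; rewrite inE => /eqP->.
  by have [] := slP i i0 im.
- move=> i /andP[_ im]; have [v] := block i im; by case: (rest _ _).
- by move=> i hi; have -> : (0 < i) && (i.+1 < m) by move: hi; clear; lia.
- move=> v; have fv := fm v.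
  have := count_rest v (LU (f v)) (@Lsub (f v)); rewrite inE eqxx /L.
  have -> : (0 <= f v < 0 + m) = true by move: fv; clear; lia.
  have -> : (1 <= f v < 1 + m.-2) = (0 < f v) && ((f v).+1 < m) by move: m5; clear; lia.
  by case: ifP => _ /=; clear; lia.
- by [].
- by [].
- by move: m5; clear; lia.
- by rewrite /near; move: m5; clear; lia.
- by move=> v; have := fm v; rewrite /near; move: m5; clear; lia.
- by move=> i _ hi; clear; lia.
- by move=> i _ hi; clear; lia.
move=> i hi; cbv beta.
have im : i.+2 < m by move: hi m5; clear; lia.
have [e1 e2 n12] := slP i.+1 isT im.
have [v vb] := block i.+1 (ltnW im).
have mid : (0 < i.+1) && (i.+2 < m) by [].
have [fv nv] : f v = i.+1 /\ v \notin [:: (sl i.+1).1; (sl i.+1).2].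
  by move: vb; rewrite mem_rest inE /L mid => /andP[/eqP-> ->].
move: nv; rewrite mem_seq2 negb_or => /andP[v1 v2].
have ok w : f w = i.+1 -> w != (sl i.+1).1 ->
    minn (f w).-1 m.-2.-1 = i /\ (1 <= f w < 1 + m.-2 -> w != (sl (f w)).1).
  by move=> fw nw; rewrite fw; split=> //; move: hi; clear; lia.
have okv := ok v fv v1.
have ok2 := ok (sl i.+1).2 e2; rewrite eq_sym in ok2; have {}ok2 := ok2 n12.
have third_leaf w : f w != i.+1 -> minn (f w).-1 m.-2.-1 = i -> ~~ (1 <= f w < 1 + m.-2) ->
    exists t, [/\ uniq t, forall v, v \in t ->
      minn (f v).-1 m.-2.-1 = i /\ (1 <= f v < 1 + m.-2 -> v != (sl (f v)).1) &
      2 < (0 < i) + (i.+1 < m.-2) + size t].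
  move=> fw mw nw; exists [:: w; v; (sl i.+1).2]; split.
  - rewrite /= !inE negb_or v2 !andbT; apply/andP; split.
      by apply: contraNneq fw => ->; rewrite fv.
    by apply: contraNneq fw => ->; rewrite e2.
  - move=> u; rewrite mem_seq3 => /or3P[]/eqP-> //.
    by split=> // h; rewrite h in nw.
  - by rewrite /=; clear; lia.
case: (eqVneq i 0) => [i0|i0].
  have [w fw] : exists v, f v = 0 by apply: fsurj; move: m5; clear; lia.
  apply: (third_leaf w); rewrite fw.
  - by rewrite i0.
  - by rewrite i0; clear; lia.
  - by [].
case/orP: (orbN (i.+1 < m.-2)) => h; last first.
  have [w fw] : exists v, f v = m.-1 by apply: fsurj; move: m5; clear; lia.
  apply: (third_leaf w); rewrite fw.
  - by move: im m5; clear; lia.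
  - by move: h hi m5; clear; lia.
  - by move: m5; clear; lia.
exists [:: v; (sl i.+1).2]; split.
- by rewrite /= inE v2.
- by move=> u; rewrite mem_seq2 => /orP[]/eqP->.
- by rewrite lt0n i0 h.
Qed.

(** Classes 0 and 1 may be singletons, so the spine occupies classes 2 to m - 1. The lower row is
    class 0, and the upper row goes from class 1 through the remaining vertices; class 1 hangs at
    the first spine vertex, class 0 at the last. *)
Lemma cycle_blowup_from : 5 < m -> (forall u v, u != v -> cyc m (f u) (f v) -> G u v) ->
  (forall i u, 1 < i -> i < m -> exists v, f v = i /\ v != u) -> has_caterpillar G.
Proof.
move=> m6 adj big.
have [x0 _] : exists v, f v = 0 by apply: fsurj; move: m6; clear; lia.
have ex i : exists v, i < m -> f v = i.
  case: (ltnP i m) => im; last by exists x0.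
  by have [v fv] := fsurj im; exists v.
have [s sP] := choice ex.
pose L i := if (1 < i) && (i < m) then [:: s i] else [::].
have LU i : uniq (L i) by rewrite /L; case: ifP.
have Lsub i : {subset L i <= cl i}.
  rewrite /L; case: ifP => // /andP[_ im] v; rewrite mem_seq1 inE => /eqP->.
  by rewrite sP.
have block i : i < m -> exists v, v \in rest (cl i) (L i).
  move=> im; case: (ltnP 1 i) => h; rewrite /L.
    have [v [fv n1]] := big i (s i) h im.
    by exists v; rewrite h im mem_rest mem_seq1 n1 inE fv eqxx.
  have [v fv] := fsurj im; exists v; rewrite ltnNge h /= mem_rest inE fv eqxx //.
apply: (@blocks_caterpillar V G f (fun i j => cyc m i j) s (fun i => rest (cl i) (L i))
  (fun i => if i == 0 then rest (cl 0) [::] else [::])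
  (fun i => if i == 0 then m.-2.-1 else i.-2) 2 m.-2 1 m.-1 0 1).
- exact: adj.
- by move=> i; rewrite /cyc /near leqnSn.
- by move=> i; rewrite /cyc /near; clear; lia.
- by move: m6; clear; lia.
- by [].
- by move: m6; clear; lia.
- by move=> i hi; apply: sP; move: hi m6; clear; lia.
- by move=> i u; rewrite mem_rest inE => /andP[/eqP].
- by move=> i u; case: eqP => // ->; rewrite mem_rest inE => /andP[/eqP].
- move=> i hi; have [|v] := block i; first by move: hi m6; clear; lia.
  by case: (rest _ _).
- move=> i hi; have -> : i = 0 by move: hi; clear; lia.
  have [v] := block 0 (ltn_trans (isT : 0 < 5) m6).
  by rewrite /L /=; case: (rest _ _).
- move=> v; have fv := fm v.
  have := count_rest v (LU (f v)) (@Lsub (f v)); rewrite inE eqxx.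
  have -> : (2 <= f v < 2 + m.-2) = (1 < f v) && (f v < m) by move: m6; clear; lia.
  have -> : (1 <= f v < 1 + m.-1) = (0 < f v) by move: m6 fv; clear; lia.
  have -> : (0 <= f v < 0 + 1) = (f v == 0) by clear; lia.
  rewrite /L; case: (f v) => [|i] /=; first by clear; lia.
  by case: ifP => _ /=; clear; lia.
- by [].
- by [].
- by move: m6; clear; lia.
- by rewrite /cyc /near; move: m6; clear; lia.
- move=> v; have := fm v; rewrite /cyc /near.
  by case: (f v) => [|[|i]] /= h; move: h m6; clear; lia.
- by case=> [|[|i]] //= _ _; clear; lia.
- by move=> i _; clear; lia.
move=> i hi; cbv beta.
have im : i.+2 < m by move: hi m6; clear; lia.
have [v vb] := block i.+2 im.
have [fv nv] : f v = i.+2 /\ v != s i.+2.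
  by move: vb; rewrite mem_rest inE /L im /= mem_seq1 => /andP[/eqP-> ->].
have okv : (if f v == 0 then m.-2.-1 else (f v).-2) = i /\
    (2 <= f v < 2 + m.-2 -> v != s (f v)) by rewrite fv.
have second w : f w != i.+2 -> (if f w == 0 then m.-2.-1 else (f w).-2) = i ->
    ~~ (2 <= f w < 2 + m.-2) -> (0 < i) || (i.+1 < m.-2) -> exists t, [/\ uniq t,
      forall v, v \in t -> (if f v == 0 then m.-2.-1 else (f v).-2) = i /\
      (2 <= f v < 2 + m.-2 -> v != s (f v)) & 2 < (0 < i) + (i.+1 < m.-2) + size t].
  move=> fw mw nw h; exists [:: w; v]; split.
  - by rewrite /= inE andbT; apply: contraNneq fw => ->; rewrite fv.
  - move=> u; rewrite mem_seq2 => /orP[]/eqP-> //.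
    by split=> // h'; rewrite h' in nw.
  - by move: h; rewrite /=; case: (0 < i); case: (i.+1 < m.-2).
(* An end of the spine has one spine neighbour and needs a second leaf, supplied by class 1 or class
   0. *)
case: (eqVneq i 0) => [i0|i0].
  have [w fw] : exists v, f v = 1 by apply: fsurj; move: m6; clear; lia.
  apply: (second w); rewrite ?fw ?i0 //.
  by move: m6; clear; lia.
case/orP: (orbN (i.+1 < m.-2)) => h; last first.
  have [w fw] : exists v, f v = 0 by apply: fsurj; move: m6; clear; lia.
  apply: (second w); rewrite ?fw //= ?lt0n ?i0 //.
  by move: h hi m6; clear; lia.
exists [:: v]; split=> //; last by rewrite lt0n i0 h.
by move=> u; rewrite mem_seq1 => /eqP->.
Qed.

Definition big_class i := forall u, exists v, f v = i /\ v != u.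

(** Two non-adjacent classes of one vertex each would separate the two arcs between them. *)
Lemma cycle_class : 5 < m -> (forall u v, u != v -> G u v = cyc m (f u) (f v)) ->
  forall i j, i < m -> j < m -> ~~ cyc m i j -> big_class i \/ big_class j.
Proof.
move=> m6 adj i j; wlog ij : i j / i < j.
  move=> H hi hj n; case: (ltngtP i j) => [h|h|h]; first exact: H.
    have n' : ~~ cyc m j i by move: n; rewrite /cyc /near; clear; lia.
    by case: (H j i h hj hi n'); [right | left].
  by move: n; rewrite /cyc /near h; clear; lia.
move=> hi hj n; apply: contrapT => no.
have small l : ~ big_class l -> exists u, cl l \subset [set u].
  move=> nb; apply: contrapT => ns; apply: nb => u; apply: contrapT => nv; apply: ns.
  exists u; apply/fintype.subsetP => v; rewrite !inE => /eqP fv; apply: contraT => vu.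
  by case: nv; exists v.
have [|u su] := small i; first by move=> b; apply: no; left.
have [|w sw] := small j; first by move=> b; apply: no; right.
have C3 : #|cl i :|: cl j| < 3.
  apply: leq_ltn_trans (_ : #|[set u] :|: [set w]| < 3).
    by apply: subset_leq_card; apply: finset.setUSS.
  by apply: leq_ltn_trans (leq_card_setU _ _) _; rewrite !cards1.
have ij2 : i.+1 < j by move: n ij; rewrite /cyc /near; clear; lia.
have [x fx] : exists v, f v = i.+1 by apply: fsurj; move: ij2 hj; clear; lia.
(* A class on the other arc: before [i], or after [j] if [i] is 0; then [j] is not the last class,
   which is adjacent to class 0. *)
have [y fy] : exists v, f v = if 0 < i then i.-1 else j.+1.
  by apply: fsurj; case: ifP => h; move: n h ij2 hi hj; rewrite /cyc /near; clear; lia.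
have [||||a [b []]] := @cut_edge _ G [set v | i < f v < j] (cl i :|: cl j) x y kc C3.
- by rewrite inE fx; move: ij2; clear; lia.
- by rewrite !inE fx; move: ij2; clear; lia.
- by rewrite inE fy; case: ifP => h; move: h; clear; lia.
- by rewrite !inE fy; case: ifP => h; move: h ij2; clear; lia.
rewrite !inE => h1 h2 h3 h4; apply/negP.
have ab : a != b by apply: contraTneq h1 => ->.
have := fm a; have := fm b.
by rewrite adj // /cyc /near; move: h1 h3 h4 hj; clear; lia.
Qed.

End Blowups.

(** Addition of [c] modulo [m] for [i < m] and [c <= m], written so that linear arithmetic
    applies. *)
Definition rotate m c i := if i + c < m then i + c else i + c - m.

Lemma cycle_rotation (V : finType) (G : sgraph V) m f : k_connected 3 G ->
  (forall v, f v < m) -> (forall i, i < m -> exists v, f v = i) -> 5 < m ->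
  (forall u v, u != v -> G u v = cyc m (f u) (f v)) ->
  exists2 c, c <= m & forall j, j < m -> 1 < rotate m c j -> @big_class V f j.
Proof.
move=> kc fm fs m6 adj; have cc := cycle_class kc fm fs m6 adj.
case: (EM (exists2 i, i < m & ~ big_class f i)) => [[i hi nb]|no]; last first.
  by exists 0 => // j hj _; apply: contrapT => n; apply: no; exists j.
have near_i j : j < m -> ~ big_class f j -> cyc m i j.
  by move=> hj n; apply: contraT => h; case: (cc i j hi hj h).
pose nx := if i.+1 < m then i.+1 else 0; pose pv := if 0 < i then i.-1 else m.-1.
have hnx : nx < m by rewrite /nx; case: ifP => // _; move: m6; clear; lia.
have hpv : pv < m by rewrite /pv; case: ifP => _; move: hi m6; clear; lia.
case: (EM (big_class f nx)) => [bn|nbn].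
  (* The successor of [i] is big, so [i] goes to position 1 and its predecessor to 0. Otherwise [i]
     goes to 0 and its successor to 1. *)
  exists (if 0 < i then m - i.-1 else 1); first by case: ifP => _; move: m6; clear; lia.
  move=> j hj rj; apply: contrapT => n; have := near_i j hj n.
  have jn : j != nx by apply/eqP => E; apply: n; rewrite E.
  move: rj jn; rewrite /rotate /nx /cyc /near; move: hi hj m6; clear.
  by case: (posnP i) => [->|i0]; case: ifP; case: ifP; lia.
exists (m - i); first by rewrite leq_subr.
move=> j hj rj; apply: contrapT => n; have cij := near_i j hj n.
have jp : j = pv.
  move: rj cij; rewrite /rotate /pv /cyc /near; move: hi hj m6; clear.
  by case: (posnP i) => [->|i0]; case: ifP; lia.
have := cc nx pv hnx hpv; rewrite -jp => H; case: H => //.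
rewrite jp /nx /pv /cyc /near; move: hi m6; clear.
by case: (posnP i) => [->|i0]; case: ifP; lia.
Qed.

Lemma cycle_blowup (V : finType) (G : sgraph V) m f : k_connected 3 G ->
  (forall v, f v < m) -> (forall i, i < m -> exists v, f v = i) -> 5 < m ->
  (forall u v, u != v -> G u v = cyc m (f u) (f v)) -> has_caterpillar G.
Proof.
move=> kc fm fs m6 adj; have [c cm big] := cycle_rotation kc fm fs m6 adj.
have inv i : i < m -> exists2 j, j < m & rotate m c j = i.
  move=> im; exists (if c <= i then i - c else i + m - c).
    by case: ifP; move: im cm; clear; lia.
  by rewrite /rotate; case: (leqP c i) => h; case: ifP; move: h im cm; clear; lia.
apply: (@cycle_blowup_from V G m (fun v => rotate m c (f v))) => //.
- by move=> v; rewrite /rotate; have := fm v; case: ifP; move: cm; clear; lia.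
- move=> i im; have [j jm rj] := inv i im; have [v fv] := fs j jm.
  by exists v; rewrite fv.
- move=> u v uv; rewrite adj //; have := fm u; have := fm v.
  rewrite /rotate /cyc /near; move: cm m6; clear.
  by case: ifP => h1; case: ifP => h2; move: h1 h2; lia.
- move=> i u i1 im; have [j jm rj] := inv i im.
  have [|v [fv vu]] := big j jm _ u; first by rewrite rj.
  by exists v; rewrite fv.
Qed.

Theorem theorem1p5 (R : realType) (V : finType) (G : sgraph V) :
  k_connected 3 G -> induced_free K13 G -> induced_free B11 G ->
  exists H : sgraph V, spanning_subgraph H G /\ halin R H.
Proof.
move=> kc noclaw nobull.
suff [s [up [lo [par cat]]]] : has_caterpillar G by apply: caterpillar_halin cat.
have claw := claw_freeE noclaw; have bull := bull_freeE nobull.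
case: (boolP [exists a, exists b, exists c, [&& a != b, a != c, b != c,
    ~~ G a b, ~~ G a c & ~~ G b c]]) => [|no]; last first.
  apply: (alpha2_caterpillar kc) => a b c ab ac bc; apply: contraT.
  rewrite !negb_or => /and3P[h1 h2 h3]; case/negP: no.
  by apply/existsP; exists a; apply/existsP; exists b; apply/existsP; exists c;
    rewrite ab ac bc h1 h2 h3.
case/existsP=> a /existsP[b /existsP[c /and5P[ab ac bc /negbTE h1 /andP[/negbTE h2 /negbTE h3]]]].
have [p0 ip0] := indep3_ipath5 kc claw bull ab ac bc h1 h2 h3.
have [k [p [k5 ip mx]]] := longest_ipath ip0.
have [m [f [m5 fm fs [adj|[m6 adj]]]]] := blowup kc claw bull k5 ip mx.
- exact: (path_blowup kc fm fs m5 adj).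
- exact: (cycle_blowup kc fm fs m6 adj).
Qed.
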